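(* Fix $m$, a correlation matrix $R$, simplex weights $\boldsymbol w$, and $\nu>1$. Let $\boldsymbol Z$ have the standard multivariate-$t_\nu$ distribution with correlation matrix $R$, and let $T_\nu$ denote the univariate standard-$t_\nu$ distribution function. All limits are as $t\to\infty$. For one-sided reciprocal scores $Y_i=\{1-T_\nu(Z_i)\}^{-1}$, $$\Pr\!\left(\sum_iw_iY_i>t\right)=\begin{cases}t^{-1}+D^{+}_{\nu,\boldsymbol w}t^{-1-2/\nu}+o(t^{-1-2/\nu}),&\nu>2,\\[3pt] t^{-1}+\{D^{+}_{2,\boldsymbol w}+a_2\mathbb E(A_+C_-)\}t^{-2}+o(t^{-2}),&\nu=2,\\[3pt] t^{-1}+a_\nu\mathbb E(A_+C_-)\,t^{-2}+o(t^{-2}),&1<\nu<2.\end{cases}$$ For two-sided reciprocal scores $Y_i=[2\{1-T_\nu(|Z_i|)\}]^{-1}$, $$\Pr\!\left(\sum_iw_iY_i>t\right)=t^{-1}+D^{|\cdot|}_{\nu,\boldsymbol w}t^{-1-2/\nu}+o(t^{-1-2/\nu}).$$ For either one- or two-sided Half-Cauchy scores $H_i=\cot\{\pi/(2Y_i)\}$, with the corresponding choice $s=+$ (one-sided) or $s=|\cdot|$ (two-sided), $$\Pr\!\left(\sum_iw_iH_i>t\right)=\frac ct+c^{1+2/\nu}D^{s}_{\nu,\boldsymbol w}t^{-1-2/\nu}+o(t^{-1-2/\nu}),\qquad c=\frac2\pi.$$ The second-order coefficient is zero for a single active coordinate (i.e. when exactly one $w_i$ is nonzero).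
   Context: Simplex weights: $w_i\ge0$, $\sum_iw_i=1$. The standard multivariate-$t_\nu$ vector is $\boldsymbol Z=\sqrt{\nu/W}\,\boldsymbol G$ with $\boldsymbol G\sim N_m(\boldsymbol 0,R)$ and $W\sim\chi^2_\nu$ independent. With $x^+=\max(x,0)$, define $$a_\nu=\frac{\nu^{\nu/2}}{2^{\nu/2}\Gamma(\nu/2+1)},\quad b_\nu=\frac{\nu^2}{2(\nu+2)},\quad k_\nu=\frac{\Gamma((\nu+1)/2)\,\nu^{\nu/2-1}}{\sqrt\pi\,\Gamma(\nu/2)},\quad d_\nu=\frac{\nu^2(\nu+1)}{2(\nu+2)},$$ $$A_+=k_\nu^{-1}\sum_iw_i(G_i^+)^\nu,\qquad C_-=\sum_iw_i\mathbf 1\{G_i<0\},\qquad B_+=d_\nu k_\nu^{-1}\sum_iw_i\mathbf 1\{G_i>0\}G_i^{\nu-2},$$ $$A_{|\cdot|}=(2k_\nu)^{-1}\sum_iw_i|G_i|^\nu,\qquad B_{|\cdot|}=d_\nu(2k_\nu)^{-1}\sum_iw_i|G_i|^{\nu-2},$$ $$D^{s}_{\nu,\boldsymbol w}=a_\nu\,\mathbb E\!\left[(A_s)^{2/\nu}(B_s-b_\nu A_s)\right],\qquad s\in\{+,|\cdot|\}.$$ *)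

(* Defs.v *)
From HB Require Import structures.
From mathcomp Require Export all_boot all_order all_algebra.
From mathcomp Require Export all_classical all_reals all_analysis.

Set Implicit Arguments.
Unset Strict Implicit.
Unset Printing Implicit Defensive.

Export Order.TTheory GRing.Theory Num.Theory.
Export numFieldNormedType.Exports.

Local Open Scope classical_set_scope.
Local Open Scope ring_scope.

(* Lets the library's little-o notation be used at +oo. *)
Canonical pinfty_filter_on (R : numFieldType) :=
  FilterType (pinfty_nbhs R) (@filter_filter R _ (@proper_pinfty_nbhs R)).

Section special_functions.
Context {R : realType}.

Definition Gamma (s : R) : R :=
  Rintegral lebesgue_measure `]0, +oo[ (fun x => x `^ (s - 1) * expR (- x)).

Definition cot (x : R) : R := cos x / sin x.

End special_functions.

Section distributions.
Context {R : realType}.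

(* Centred normal law of variance v, with v = 0 allowed: the case split is
   needed since [normal_prob m 0] is not the Dirac mass at m in the library. *)
Definition centered_normal (v : R) (A : set R) : \bar R :=
  if v == 0 then \d_(0 : R) A else normal_prob 0 (Num.sqrt v) A.

Definition chi2_pdf (nu x : R) : R :=
  x `^ (nu / 2 - 1) * expR (- (x / 2)) / (2 `^ (nu / 2) * Gamma (nu / 2)).

Definition chi2_law (nu : R) (A : set R) : \bar R :=
  (\int[lebesgue_measure]_(x in A `&` `]0%R, +oo[) (chi2_pdf nu x)%:E)%E.

Definition t_pdf (nu x : R) : R :=
  Gamma ((nu + 1) / 2) / (Num.sqrt (nu * pi) * Gamma (nu / 2)) *
  (1 + x ^+ 2 / nu) `^ (- ((nu + 1) / 2)).

Definition t_cdf (nu z : R) : R :=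
  Rintegral lebesgue_measure `]-oo, z] (t_pdf nu).

End distributions.

Section random_vectors.
Context {R : realType} {m : nat}.

Definition correlation_matrix (Rho : 'M[R]_m) : Prop :=
  [/\ Rho^T = Rho, forall i, Rho i i = 1
    & forall a : 'rV[R]_m, 0 <= (a *m Rho *m a^T) 0 0].

Definition simplex_weights (w : 'I_m -> R) : Prop :=
  (forall i, 0 <= w i) /\ \sum_i w i = 1.

Context {d : measure_display} {T : measurableType d} (P : probability T R).

(* G ~ N_m(0, Rho), with Rho possibly singular: every linear combination a.G
   has the centred normal law of variance a Rho a^T. *)
Definition gaussian_vector (Rho : 'M[R]_m) (G : {RV P >-> m.-tuple R}) : Prop :=
  forall (a : 'rV[R]_m) (A : set R), measurable A ->
    P [set x | A (\sum_i a 0 i * tnth (G x) i)] =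
    centered_normal ((a *m Rho *m a^T) 0 0) A.

Definition chi2_variable (nu : R) (W : {RV P >-> R}) : Prop :=
  forall A : set R, measurable A -> P (W @^-1` A) = chi2_law nu A.

Definition independent_RV (G : {RV P >-> m.-tuple R}) (W : {RV P >-> R}) :
    Prop :=
  forall (A : set (m.-tuple R)) (B : set R), measurable A -> measurable B ->
    P (G @^-1` A `&` W @^-1` B) = (P (G @^-1` A) * P (W @^-1` B))%E.

Definition mvt_vector (nu : R) (G : T -> m.-tuple R) (W : T -> R) (x : T) :
    m.-tuple R :=
  [tuple Num.sqrt (nu / W x) * tnth (G x) i | i < m].

Definition tail (X : T -> R) (t : R) : R := fine (P [set x | t < X x]).

End random_vectors.

Section scores.
Context {R : realType}.

Definition Y_one (nu z : R) : R := (1 - t_cdf nu z)^-1.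
Definition Y_two (nu z : R) : R := (2 * (1 - t_cdf nu `|z|))^-1.
Definition H_one (nu z : R) : R := cot (pi / (2 * Y_one nu z)).
Definition H_two (nu z : R) : R := cot (pi / (2 * Y_two nu z)).

Definition weighted_score (m : nat) (w : 'I_m -> R) (score : R -> R)
    (z : m.-tuple R) : R :=
  \sum_i w i * score (tnth z i).

End scores.

Section coefficients.
Context {R : realType}.

Definition a_coef (nu : R) : R :=
  nu `^ (nu / 2) / (2 `^ (nu / 2) * Gamma (nu / 2 + 1)).
Definition b_coef (nu : R) : R := nu ^+ 2 / (2 * (nu + 2)).
Definition k_coef (nu : R) : R :=
  Gamma ((nu + 1) / 2) * nu `^ (nu / 2 - 1) / (Num.sqrt pi * Gamma (nu / 2)).
Definition d_coef (nu : R) : R := nu ^+ 2 * (nu + 1) / (2 * (nu + 2)).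

Context {m : nat} (nu : R) (w : 'I_m -> R).

(* For nu < 2 the power nu - 2 is negative and [0 `^ (nu - 2)] is 0; this only
   matters on the event that some coordinate vanishes, which is null under
   N_m(0, Rho) as the coordinates have variance 1. *)
Definition A_plus (g : m.-tuple R) : R :=
  (k_coef nu)^-1 * \sum_i w i * Num.max (tnth g i) 0 `^ nu.
Definition C_minus (g : m.-tuple R) : R :=
  \sum_i w i * (tnth g i < 0)%R%:R.
Definition B_plus (g : m.-tuple R) : R :=
  d_coef nu * (k_coef nu)^-1 *
  \sum_i w i * (0 < tnth g i)%R%:R * tnth g i `^ (nu - 2).
Definition A_abs (g : m.-tuple R) : R :=
  (2 * k_coef nu)^-1 * \sum_i w i * `|tnth g i| `^ nu.
Definition B_abs (g : m.-tuple R) : R :=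
  d_coef nu * (2 * k_coef nu)^-1 * \sum_i w i * `|tnth g i| `^ (nu - 2).

Context {d : measure_display} {T : measurableType d} (P : probability T R)
  (G : T -> m.-tuple R).

(* The expectations below are finite for nu > 1, so [fine] loses nothing. *)
Definition D_gen (A B : m.-tuple R -> R) : R :=
  a_coef nu *
  fine 'E_P[fun x => A (G x) `^ (2 / nu) * (B (G x) - b_coef nu * A (G x))].
Definition D_plus : R := D_gen A_plus B_plus.
Definition D_abs : R := D_gen A_abs B_abs.

Definition E_AC : R := fine 'E_P[fun x => A_plus (G x) * C_minus (G x)].

End coefficients.

(* Main.v *)
(** Write q = (W / nu)^(nu/2).  Conditionally on G, the weighted score is a
    function of q, and a score with expansion phi = N + M + lower order terms,
    N homogeneous of degree nu and M of degree nu (1 - kap), exceeds t exactly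
    when q lies below a threshold (A + B t^-kap + o(t^-kap)) / t, where A and B
    are the weighted sums of N and M at G.  The chi-square law of W gives
    P(q < x) = a x - a b x^(1+2/nu) + O(x^(1+4/nu)), hence the conditional tail
    a A / t + a A^kap (B - [kap = 2/nu] b A) t^(-1-kap) + o(t^(-1-kap)); a
    dominated convergence argument, resting on negative moments of order > -1
    of Gaussian coordinates and on Young's inequality, integrates this over G
    whatever the correlation matrix.  The scores enter through the expansion
    1 / (1 - T_nu(z)) = k^-1 z^nu + d k^-1 z^(nu-2) + O(z^(nu-4)), the limit 1
    of the one-sided reciprocal score at -oo (which produces C_-), and
    cot x = 1/x + O(x).  The leading coefficient is 1 because
    a E(g^+)^nu = k, and a single active coordinate has vanishing second order
    by E(g^+)^(nu+2) = (nu+1) E(g^+)^nu. *)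

From HB Require Import structures.
Require Import Defs.
From mathcomp Require Import measurable_realfun.
From mathcomp Require Import ring lra.

Set Implicit Arguments.
Unset Strict Implicit.
Unset Printing Implicit Defensive.

Local Open Scope ring_scope.
Local Open Scope classical_set_scope.

(** * Improper integrals and the Gamma function *)

Section exhaustion.
Context {R : realType}.
Notation mu := (@lebesgue_measure R).
Implicit Types (f F G : R -> R) (a b : R^nat).

(** The weighted score along a ray need not be monotone in [q]: for one-sided scores, coordinates of
    opposite signs pull it in opposite directions. The level set in [q] is therefore never computed
    but enclosed between two intervals starting at 0, roughly and uniformly in G for the domination,
    sharply at fixed G for the limit. The exponent [kap] is the relative order of the leading
    correction. The curvature of the chi-square law and the second term of the t tail both give
    2/nu; the limit 1 of the one-sided reciprocal score at -oo gives 1. Their competition creates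
    the three regimes around nu = 2. Half-Cauchy scores vanish at -oo, so 2/nu serves them for every
    nu > 1. The condition nu > 1 enters twice: the second term of a score has degree nu - 2,
    integrable at the origin against a Gaussian density because nu - 2 > -1, and the error of the
    cotangent, of order z^(-nu), is negligible against z^(nu-2) because -nu < nu - 2. *)

Lemma measurable_fun_pos_continuous f :
  (forall x : R, 0 < x -> {for x, continuous f}) ->
  measurable_fun `](0:R), +oo[ f.
Proof.
move=> cf; apply: open_continuous_measurable_fun; first exact: interval_open.
by move=> x; rewrite inE /= in_itv/= andbT; exact: cf.
Qed.

Lemma pos_itv_exhaustion a b : (forall n, 0 < a n) ->
  a @ \oo --> (0:R) -> b @ \oo --> +oo ->
  \bigcup_n `[a n, b n]%classic = `]0, +oo[%classic.
Proof.
move=> a0 acv bcv; apply/seteqP; split => x /=.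
  by case=> n _ /=; rewrite !in_itv/= andbT => /andP[+ _]; exact: lt_le_trans.
rewrite in_itv/= andbT => x0.
near \oo => n; exists n => //=; rewrite in_itv/=; apply/andP; split.
  near: n.
  have /cvgrPdist_lt/(_ _ x0) := acv; apply: filterS => n /=.
  by rewrite sub0r normrN gtr0_norm// => /ltW.
by near: n; move/cvgryPge : bcv; exact.
Unshelve. all: by end_near. Qed.

(** Integrands may blow up at 0 and primitives are differentiable only on the positive half-line, so
    compact intervals must approach both ends; monotone convergence then gives the limit. *)
Lemma ge0_integral_exhaustion f a b :
  (forall x : R, 0 < x -> 0 <= f x) ->
  measurable_fun `](0:R), +oo[ f ->
  (forall n, 0 < a n) -> nonincreasing_seq a -> nondecreasing_seq b ->
  (\int[mu]_(x in `[a n, b n]) (f x)%:E)%E @[n --> \oo] -->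
  (\int[mu]_(x in \bigcup_n `[a n, b n]) (f x)%:E)%E.
Proof.
move=> f0 mf a0 ai bi.
have sub n : `[a n, b n] `<=` `]0, +oo[.
  by move=> x /=; rewrite !in_itv/= andbT => /andP[+ _]; exact: lt_le_trans.
apply: ge0_nondecreasing_set_cvg_integral.
- move=> m n mn; apply/subsetPset => x /=; rewrite !in_itv/= => /andP[h1 h2].
  by rewrite (le_trans (ai _ _ mn) h1) (le_trans h2 (bi _ _ mn)).
- by move=> i; exact: measurable_itv.
- by move=> i; apply/measurable_EFinP; apply: measurable_funS (sub i) mf.
- move=> i x /sub /=; rewrite in_itv/= andbT => x0.
  by rewrite lee_fin; exact: f0.
Qed.

Lemma continuous_FTC2_pos f F (a b : R) : 0 < a -> a < b ->
  (forall x : R, 0 < x -> {for x, continuous f}) ->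
  (forall x : R, 0 < x -> is_derive x 1 F (f x)) ->
  (\int[mu]_(x in `[a, b]) (f x)%:E)%E = (F b - F a)%:E.
Proof.
move=> a0 ab cf dF; rewrite EFinB.
have cF x : 0 < x -> {for x, continuous F}.
  move=> x0; apply: differentiable_continuous; apply/derivable1_diffP.
  exact: (@ex_derive _ _ _ _ _ _ _ (dF x x0)).
apply: continuous_FTC2 => //.
- apply/continuous_within_itvP => //; split.
  + by move=> x; rewrite in_itv/= => /andP[ax _]; apply: cf; exact: lt_trans ax.
  + by apply: cvg_at_right_filter; exact: cf.
  + by apply: cvg_at_left_filter; apply: cf; exact: lt_trans ab.
- split.
  + move=> x; rewrite in_itv/= => /andP[ax _].
    exact: (@ex_derive _ _ _ _ _ _ _ (dF x (lt_trans a0 ax))).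
  + by apply: cvg_at_right_filter; exact: cF.
  + by apply: cvg_at_left_filter; apply: cF; exact: lt_trans ab.
- move=> x; rewrite in_itv/= => /andP[ax _]; rewrite derive1E.
  exact: (@derive_val _ _ _ _ _ _ _ (dF x (lt_trans a0 ax))).
Qed.

(** The exhausting sequences stay abstract so that a constant [b] yields a bounded interval and an
    unbounded [b] the whole half-line. *)
Lemma ge0_FTC2_exhaustion f F a b (l0 l : R) :
  (forall x : R, 0 < x -> {for x, continuous f}) ->
  (forall x : R, 0 < x -> 0 <= f x) ->
  (forall x : R, 0 < x -> is_derive x 1 F (f x)) ->
  (forall n, 0 < a n) -> (forall n, a n < b n) ->
  nonincreasing_seq a -> nondecreasing_seq b ->
  F (a n) @[n --> \oo] --> l0 -> F (b n) @[n --> \oo] --> l ->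
  (\int[mu]_(x in \bigcup_n `[a n, b n]) (f x)%:E)%E = (l - l0)%:E.
Proof.
move=> cf f0 dF a0 ab ai bi cva cvb.
have h := ge0_integral_exhaustion f0 (measurable_fun_pos_continuous cf) a0 ai bi.
apply: (cvg_unique _ h) => //=.
under eq_fun do rewrite (continuous_FTC2_pos (a0 _) (ab _) cf dF).
by apply: cvg_EFin; [exact: nearW|exact: cvgB].
Qed.

(** The shifts ensure [lo_seq n <= 1 < hi_seq n] already at [n = 0], so no interval of the
    exhaustion degenerates. *)
Definition lo_seq : R^nat := fun n => n.+1%:R^-1.
Definition hi_seq : R^nat := fun n => n.+2%:R.

Lemma lo_seq_gt0 n : 0 < lo_seq n. Proof. by rewrite invr_gt0. Qed.

Lemma lo_seq_noninc : nonincreasing_seq lo_seq.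
Proof. by move=> m n mn; rewrite lef_pV2 ?posrE// ler_nat. Qed.

Lemma hi_seq_nondec : nondecreasing_seq hi_seq.
Proof. by move=> m n mn; rewrite ler_nat. Qed.

Lemma lo_lt_hi n : lo_seq n < hi_seq n.
Proof.
rewrite (@le_lt_trans _ _ 1)//; first by rewrite invf_le1// ler1n.
by rewrite ltr1n.
Qed.

Lemma cvg_lo_seq : lo_seq @ \oo --> (0:R).
Proof. exact: cvg_harmonic. Qed.

Lemma cvg_hi_seq : hi_seq @ \oo --> +oo.
Proof.
apply/cvgryPge => A; near=> n; rewrite /hi_seq.
rewrite (@le_trans _ _ n%:R)// ?ler_nat; last by rewrite -addn2 leq_addr.
by near: n; exact: nbhs_infty_ger.
Unshelve. all: by end_near. Qed.

Lemma cvg_comp_lo_seq F (l : R) :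
  F x @[x --> 0^'+] --> l -> F (lo_seq n) @[n --> \oo] --> l.
Proof.
move=> /cvg_at_rightP; apply; split; last exact: cvg_lo_seq.
by move=> n; exact: lo_seq_gt0.
Qed.

Lemma ge0_FTC2_0y f F (l0 l : R) :
  (forall x : R, 0 < x -> {for x, continuous f}) ->
  (forall x : R, 0 < x -> 0 <= f x) ->
  (forall x : R, 0 < x -> is_derive x 1 F (f x)) ->
  F x @[x --> 0^'+] --> l0 -> F x @[x --> +oo] --> l ->
  (\int[mu]_(x in `]0%R, +oo[) (f x)%:E)%E = (l - l0)%:E.
Proof.
move=> cf f0 dF cva cvb.
rewrite -(pos_itv_exhaustion lo_seq_gt0 cvg_lo_seq cvg_hi_seq).
apply: (ge0_FTC2_exhaustion cf f0 dF).
- exact: lo_seq_gt0.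
- exact: lo_lt_hi.
- exact: lo_seq_noninc.
- exact: hi_seq_nondec.
- exact: cvg_comp_lo_seq.
- exact: (cvg_comp _ _ cvg_hi_seq cvb).
Qed.

Lemma ge0_FTC2_0b f F (b l0 : R) : 0 < b ->
  (forall x : R, 0 < x -> {for x, continuous f}) ->
  (forall x : R, 0 < x -> 0 <= f x) ->
  (forall x : R, 0 < x -> is_derive x 1 F (f x)) ->
  F x @[x --> 0^'+] --> l0 ->
  (\int[mu]_(x in `]0%R, b]) (f x)%:E)%E = (F b - l0)%:E.
Proof.
move=> b0 cf f0 dF cva.
(* The denominator n + 2 gives [a n < b] from [n = 0] on. *)
pose a n := b / n.+2%:R.
have a0 n : 0 < a n by rewrite divr_gt0.
have ca : a @ \oo --> (0:R).
  rewrite -(mulr0 b); apply: cvgMr.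
  have := @cvg_harmonic R; rewrite -(cvg_shiftS); apply: cvg_trans.
  by apply: near_eq_cvg; near=> n.
have -> : `]0, b]%classic = \bigcup_n `[a n, b]%classic.
  apply/seteqP; split => x /=.
    rewrite in_itv/= => /andP[x0 xb].
    near \oo => n; exists n => //=; rewrite in_itv/= xb andbT.
    near: n; have /cvgrPdist_lt/(_ _ x0) := ca; apply: filterS => n /=.
    by rewrite sub0r normrN gtr0_norm// => /ltW.
  by case=> n _ /=; rewrite !in_itv/= => /andP[an ->]; rewrite (lt_le_trans _ an).
apply: (ge0_FTC2_exhaustion (b := fun=> b) cf f0 dF) => //.
- by move=> n; rewrite ltr_pdivrMr// ltr_pMr// ltr1n.
- by move=> m n mn; rewrite /a ler_pM2l// lef_pV2 ?posrE// ler_nat !ltnS.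
- by move/cvg_at_rightP : cva; apply; split => // n; exact: a0.
- exact: cvg_cst.
Unshelve. all: by end_near. Qed.

(** The substitution is made on the compact intervals between [lo_seq n] and [hi_seq n]. Their
    images under the increasing [F] exhaust the half-line too, by the two limits of [F], so both
    sides converge to the improper integrals. *)
Lemma ge0_substitution_0y F (dF : R -> R) G :
  (forall x : R, 0 < x -> is_derive x 1 F (dF x)) ->
  (forall x : R, 0 < x -> {for x, continuous dF}) ->
  (forall x : R, 0 < x -> 0 < dF x) ->
  (forall x : R, 0 < x -> 0 < F x) ->
  F x @[x --> 0^'+] --> (0:R) -> F x @[x --> +oo] --> +oo ->
  (forall x : R, 0 < x -> {for x, continuous G}) ->
  (forall x : R, 0 < x -> 0 <= G x) ->
  (\int[mu]_(x in `]0%R, +oo[) (G x)%:E =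
   \int[mu]_(x in `]0%R, +oo[) (G (F x) * dF x)%:E)%E.
Proof.
move=> dFE cdF dF0 F0 cv0 cvy cG G0.
have derF x : 0 < x -> derivable F x 1.
  by move=> x0; exact: (@ex_derive _ _ _ _ _ _ _ (dFE x x0)).
have cF x : 0 < x -> {for x, continuous F}.
  by move=> x0; apply: differentiable_continuous; apply/derivable1_diffP/derF.
have F'E x : 0 < x -> F^`() x = dF x.
  move=> x0; rewrite derive1E.
  exact: (@derive_val _ _ _ _ _ _ _ (dFE x x0)).
have incF x y : 0 < x -> x < y -> F x < F y.
  move=> x0 xy; rewrite -subr_gt0.
  have [| |c cxy ->] := @MVT R F dF _ _ xy.
  - by move=> z; rewrite in_itv/= => /andP[xz _]; apply: dFE; exact: lt_trans xz.
  - apply: derivable_within_continuous => z; rewrite in_itv/= => /andP[xz _].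
    by apply: derF; exact: lt_le_trans xz.
  - rewrite mulr_gt0 ?subr_gt0// dF0//.
    by move: cxy; rewrite in_itv/= => /andP[xz _]; exact: lt_trans xz.
have dFcont x : 0 < x -> {for x, continuous F^`()}.
  move=> x0; have : F^`() @ x --> dF x; last by rewrite -F'E.
  apply: cvg_trans (cdF x x0); apply: near_eq_cvg.
  near=> y; rewrite F'E//; near: y; exact: lt_nbhsr.
pose c n := F (lo_seq n); pose d n := F (hi_seq n).
have hi0 n : 0 < hi_seq n by [].
rewrite -[LHS](_ : (\int[mu]_(x in \bigcup_n `[c n, d n]) (G x)%:E)%E = _); last first.
  congr (integral _ _ _); apply: pos_itv_exhaustion.
  - by move=> n; apply: F0; exact: lo_seq_gt0.
  - exact: cvg_comp_lo_seq.
  - exact: (cvg_comp _ _ cvg_hi_seq cvy).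
rewrite -[RHS](_ : (\int[mu]_(x in \bigcup_n `[lo_seq n, hi_seq n])
   (G (F x) * dF x)%:E)%E = _); last first.
  congr (integral _ _ _); apply: pos_itv_exhaustion.
  - exact: lo_seq_gt0.
  - exact: cvg_lo_seq.
  - exact: cvg_hi_seq.
have hL : (\int[mu]_(x in `[c n, d n]) (G x)%:E)%E @[n --> \oo] -->
    (\int[mu]_(x in \bigcup_n `[c n, d n]) (G x)%:E)%E.
  apply: ge0_integral_exhaustion => //.
  - exact: measurable_fun_pos_continuous.
  - by move=> n; apply: F0; exact: lo_seq_gt0.
  - move=> m n mn; rewrite /c; have := lo_seq_noninc mn.
    by rewrite le_eqVlt => /predU1P[->//|h]; apply: ltW; exact: incF (lo_seq_gt0 _) h.
  - move=> m n mn; rewrite /d; have := hi_seq_nondec mn.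
    by rewrite le_eqVlt => /predU1P[->//|h]; apply: ltW; exact: incF (hi0 _) h.
have hR : (\int[mu]_(x in `[lo_seq n, hi_seq n]) (G (F x) * dF x)%:E)%E @[n --> \oo] -->
    (\int[mu]_(x in \bigcup_n `[lo_seq n, hi_seq n]) (G (F x) * dF x)%:E)%E.
  apply: (@ge0_integral_exhaustion (fun x => G (F x) * dF x)).
  - by move=> x x0; rewrite mulr_ge0// ?G0 ?F0// ltW// dF0.
  - apply: measurable_fun_pos_continuous => x x0.
    by apply: continuousM; [apply: continuous_comp; [exact: cF|exact/cG/F0]|exact: cdF].
  - exact: lo_seq_gt0.
  - exact: lo_seq_noninc.
  - exact: hi_seq_nondec.
apply: (cvg_unique _ hL) => //; apply: cvg_trans hR.
apply: near_eq_cvg; near=> n; rewrite /c /d.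
have pos x : lo_seq n <= x -> 0 < x by apply: lt_le_trans; exact: lo_seq_gt0.
rewrite (@integration_by_substitution_increasing R F G (lo_seq n) (hi_seq n)).
- apply: eq_integral => x; rewrite inE /= in_itv/= => /andP[/pos x0 _].
  by rewrite fctE /= F'E.
- exact/ltW/lo_lt_hi.
- move=> x y; rewrite !in_itv/= => /andP[/pos x0 _] _; exact: incF.
- by move=> x; rewrite in_itv/= => /andP[/ltW/pos x0 _]; exact: dFcont.
- apply/cvg_ex; exists (F^`() (lo_seq n)); apply: cvg_at_right_filter.
  exact: dFcont (lo_seq_gt0 _).
- apply/cvg_ex; exists (F^`() (hi_seq n)); apply: cvg_at_left_filter.
  exact: dFcont.
- split.
  + by move=> x; rewrite in_itv/= => /andP[/ltW/pos x0 _]; exact: derF.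
  + by apply: cvg_at_right_filter; apply: cF; exact: lo_seq_gt0.
  + by apply: cvg_at_left_filter; exact: cF.
- have FF : F (lo_seq n) < F (hi_seq n) by apply: incF; [exact: lo_seq_gt0|exact: lo_lt_hi].
  have F0' : 0 < F (lo_seq n) by apply: F0; exact: lo_seq_gt0.
  apply/continuous_within_itvP => //; split.
  + by move=> x; rewrite in_itv/= => /andP[ax _]; apply: cG; exact: lt_trans ax.
  + by apply: cvg_at_right_filter; exact: cG.
  + by apply: cvg_at_left_filter; apply: cG; exact: lt_trans FF.
Unshelve. all: by end_near. Qed.

End exhaustion.

(** * The Gamma function and integrals that reduce to it *)

Section gamma.
Context {R : realType}.
Notation mu := (@lebesgue_measure R).

Lemma continuous_is_derive (f : R -> R) (x df : R) :
  is_derive x 1 f df -> {for x, continuous f}.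
Proof.
move=> h; apply: differentiable_continuous; apply/derivable1_diffP.
exact: (@ex_derive _ _ _ _ _ _ _ h).
Qed.

Lemma is_derive_conv (f : R -> R) (x a b : R) :
  is_derive x 1 f a -> a = b -> is_derive x 1 f b.
Proof. by move=> + <-. Qed.

Lemma is_derive_mul (f g : R -> R) (x a b : R) :
  is_derive x 1 f a -> is_derive x 1 g b ->
  is_derive x 1 (fun y => f y * g y) (a * g x + f x * b).
Proof.
move=> hf hg; apply: is_derive_conv (is_deriveM hf hg) _.
by rewrite addrC [a * _]mulrC.
Qed.

Lemma is_derive_mull (k : R) (f : R -> R) (x a : R) :
  is_derive x 1 f a -> is_derive x 1 (fun y => k * f y) (k * a).
Proof. by move=> hf; exact: (is_deriveZ k hf). Qed.

Lemma is_derive_add (f g : R -> R) (x a b : R) :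
  is_derive x 1 f a -> is_derive x 1 g b ->
  is_derive x 1 (fun y => f y + g y) (a + b).
Proof. by move=> hf hg; exact: (is_deriveD hf hg). Qed.

Lemma is_derive_compose (f g : R -> R) (x a b : R) :
  is_derive (g x) 1 f a -> is_derive x 1 g b ->
  is_derive x 1 (fun y => f (g y)) (a * b).
Proof. by move=> hf hg; exact: (is_derive1_comp hf hg). Qed.

Lemma continuous_powR_pos (r x : R) : 0 < x -> {for x, continuous (@powR R ^~ r)}.
Proof. by move=> x0; apply: continuous_is_derive (is_derive1_powR r x0). Qed.

Lemma le_integral_0y (f g : R -> R) :
  (forall x : R, 0 < x -> {for x, continuous f}) ->
  (forall x : R, 0 < x -> {for x, continuous g}) ->
  (forall x : R, 0 < x -> 0 <= f x <= g x) ->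
  (\int[mu]_(x in `]0%R, +oo[) (f x)%:E <= \int[mu]_(x in `]0%R, +oo[) (g x)%:E)%E.
Proof.
move=> cf cg fg; apply: ge0_le_integral => //=.
- by move=> x; rewrite in_itv/= andbT => /fg/andP[+ _]; rewrite lee_fin.
- by apply/measurable_EFinP; exact: measurable_fun_pos_continuous.
- by apply/measurable_EFinP; exact: measurable_fun_pos_continuous.
- by move=> x; rewrite in_itv/= andbT => /fg/andP[_]; rewrite lee_fin.
Qed.

(** This is y/m <= exp(y/m) raised to the power m. *)
Lemma powR_le_expR (m y : R) : 0 < m -> 0 < y -> y `^ m <= m `^ m * expR y.
Proof.
move=> m0 y0.
have -> : expR y = expR (y / m) `^ m by rewrite -expRM divfK// gt_eqF.
rewrite -powRM ?expR_ge0 ?(ltW m0)//; apply: ge0_ler_powR; rewrite ?nnegrE//.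
- exact: ltW.
- exact: ltW.
- by rewrite mulr_ge0 ?expR_ge0// ltW.
- rewrite -ler_pdivrMl//; apply: le_trans (expR_ge1Dx _).
  by rewrite mulrC lerDr.
Qed.

Definition gamma_fun (r x : R) : R := x `^ (r - 1) * expR (- x).

Lemma is_derive_expRN (l x : R) :
  is_derive x 1 (fun x => expR (- (l * x))) (- l * expR (- (l * x))).
Proof.
have h : is_derive x 1 (fun y : R => - l * id y) (- l * 1) by exact: is_derive_mull.
have -> : (fun x : R => expR (- (l * x))) = (fun x => expR (- l * id x)).
  by apply/funext => y; rewrite mulNr.
apply: is_derive_conv (is_derive_compose (is_derive_expR _) h) _.
by rewrite mulr1 mulrC -mulNr.
Qed.

Lemma continuous_expRN (l : R) : continuous (fun x : R => expR (- (l * x))).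
Proof. by move=> x; apply: continuous_is_derive (is_derive_expRN l x). Qed.

Lemma continuous_gamma_fun (r x : R) : 0 < x -> {for x, continuous (gamma_fun r)}.
Proof.
move=> x0; apply: continuousM; first exact: continuous_powR_pos.
by have := @continuous_expRN 1 x; under eq_fun do rewrite mul1r.
Qed.

Lemma gamma_fun_ge0 (r x : R) : 0 <= gamma_fun r x.
Proof. by rewrite mulr_ge0// ?powR_ge0 ?expR_ge0. Qed.

Lemma cvg_inv1Dx : (1 + x)^-1 @[x --> +oo] --> (0:R).
Proof.
apply/cvgrPdist_le => e e0; near=> x.
have x1 : e^-1 <= x by near: x; apply: nbhs_pinfty_ge; rewrite num_real.
have x0 : 0 < x by rewrite (lt_le_trans _ x1)// invr_gt0.
rewrite sub0r normrN ger0_norm ?invr_ge0 ?addr_ge0 ?(ltW x0)//.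
rewrite -[X in _ <= X]invrK lef_pV2 ?posrE ?invr_gt0 ?addr_gt0//.
by rewrite (le_trans x1)// lerDr.
Unshelve. all: by end_near. Qed.

(** The integrand is dominated by a function with an explicit bounded primitive: the derivative of
    (x/(1+x))^r is r x^(r-1) (1+x)^(-r-1). The constant [C] is that of [powR_le_expR] at exponent r
    + 1 and point 1 + x. *)
Lemma integral_gamma_fun_lty (r : R) : 0 < r ->
  (\int[mu]_(x in `]0%R, +oo[) (gamma_fun r x)%:E < +oo)%E.
Proof.
move=> r0.
pose C := (r + 1) `^ (r + 1) * expR 1.
pose g x := C * (x `^ (r - 1) * (1 + x) `^ (- (r + 1))).
pose G x := (C / r) * (x `^ r * (1 + x) `^ (- r)).
have d1 (x : R) : is_derive x 1 (fun x : R => 1 + x) 1.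
  rewrite (_ : (fun x : R => 1 + x) = cst 1 + id)//.
  by apply: is_derive_eq; rewrite add0r.
have dG (x : R) : 0 < x -> is_derive x 1 G (g x).
  move=> x0; have x10 : 0 < 1 + x by rewrite addr_gt0.
  have h1 := is_derive1_powR r x0.
  have h2 : is_derive x 1 (fun x => (1 + x) `^ (- r)) (- r * (1 + x) `^ (- r - 1) * 1).
    exact: (is_derive_compose (is_derive1_powR (- r) x10) (d1 x)).
  apply: is_derive_conv (is_derive_mull (C / r) (is_derive_mul h1 h2)) _.
  rewrite /g.
  rewrite (_ : - (r + 1) = - r - 1); last by ring.
  have -> : x `^ r = x * x `^ (r - 1) by rewrite mulr_powRB1// ltW.
  have -> : (1 + x) `^ (- r) = (1 + x) * (1 + x) `^ (- r - 1).
    rewrite [in RHS]powRD; last by rewrite (gt_eqF x10) implybT.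
    by rewrite powR_inv1 ?(ltW x10)// mulrCA divff ?gt_eqF// mulr1.
  by field; rewrite gt_eqF.
have cg (x : R) : 0 < x -> {for x, continuous g}.
  move=> x0; have x10 : 0 < 1 + x by rewrite addr_gt0.
  apply: continuousM; first exact: cvg_cst.
  apply: continuousM; first exact: continuous_powR_pos.
  exact: (continuous_comp (continuous_is_derive (d1 x)) (@continuous_powR_pos _ _ x10)).
have C0 : 0 <= C by rewrite mulr_ge0 ?powR_ge0 ?expR_ge0.
have g0 (x : R) : 0 < x -> 0 <= g x by move=> x0; rewrite !mulr_ge0 ?powR_ge0.
apply: (@le_lt_trans _ _ (\int[mu]_(x in `]0%R, +oo[) (g x)%:E)%E).
  apply: le_integral_0y => // x x0; first exact: continuous_gamma_fun.
  rewrite gamma_fun_ge0/= /gamma_fun /g mulrCA ler_wpM2l ?powR_ge0//.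
  have x10 : 0 < 1 + x by rewrite addr_gt0.
  rewrite powRN expRN ler_pdivlMr ?powR_gt0// mulrC ler_pdivrMr ?expR_gt0//.
  rewrite /C -mulrA -expRD; apply: powR_le_expR => //; exact: addr_gt0.
rewrite (@ge0_FTC2_0y _ g G 0 (C / r))//; first by rewrite subr0 ltry.
- rewrite -[X in _ --> X](mulr0 (C / r)); apply: cvgMr.
  rewrite -[X in _ --> X](mul0r ((1 + 0) `^ (- r))); apply: cvgM.
    exact: powR_cvg0.
  apply: cvg_at_right_filter.
  have p10 : 0 < 1 + 0 :> R by rewrite addr0.
  exact: (continuous_comp (continuous_is_derive (d1 0)) (@continuous_powR_pos _ _ p10)).
- rewrite -[X in _ --> X](mulr1 (C / r)); apply: cvgMr.
  have : (1 - (1 + x)^-1) `^ r @[x --> +oo] --> (1:R).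
    have h1 : (1 : R) - (1 + x)^-1 @[x --> +oo] --> (1:R).
      rewrite -[X in _ --> X]subr0.
      by apply: cvgB; [exact: cvg_cst|exact: cvg_inv1Dx].
    have h2 : y `^ r @[y --> (1:R)] --> (1:R) `^ r.
      exact: (@continuous_powR_pos r 1).
    by rewrite powR1 in h2; exact: cvg_comp h1 h2.
  apply: cvg_trans; apply: near_eq_cvg; near=> x.
  have x0 : 0 < x by near: x; apply: nbhs_pinfty_gt; rewrite num_real.
  have x10 : 0 < 1 + x by rewrite addr_gt0.
  rewrite powRN -[in LHS](_ : x / (1 + x) = 1 - (1 + x)^-1); last first.
    by field; rewrite gt_eqF.
  rewrite powRM ?invr_ge0 ?(ltW x0) ?(ltW x10)//; congr (_ * _).
  by rewrite -powR_inv1 ?(ltW x10)// -powRrM mulN1r powRN.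
Unshelve. all: by end_near. Qed.

Lemma Gamma_EFin (r : R) : 0 < r ->
  (\int[mu]_(x in `]0%R, +oo[) (gamma_fun r x)%:E)%E = (Gamma r)%:E.
Proof.
move=> r0; rewrite /Gamma /Rintegral fineK// ge0_fin_numE.
  exact: integral_gamma_fun_lty.
by apply: integral_ge0 => x _; rewrite lee_fin gamma_fun_ge0.
Qed.

(** On ]0, 1] the exponential is at least exp(-1), which leaves a power with a known positive
    integral. *)
Lemma Gamma_gt0 (r : R) : 0 < r -> 0 < Gamma r.
Proof.
move=> r0; rewrite -lte_fin -Gamma_EFin//.
apply: (@lt_le_trans _ _ (\int[mu]_(x in `]0%R, 1%R]) (gamma_fun r x)%:E)%E); last first.
  apply: ge0_subset_integral => //=.
  - by apply/measurable_EFinP; apply: measurable_fun_pos_continuous => x; exact: continuous_gamma_fun.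
  - by move=> x _; rewrite lee_fin gamma_fun_ge0.
  - by move=> x /=; rewrite !in_itv/= andbT => /andP[].
pose g x := expR (-1) * x `^ (r - 1).
have cg (x : R) : 0 < x -> {for x, continuous g}.
  by move=> x0; apply: continuousM; [exact: cvg_cst|exact: continuous_powR_pos].
have S : `]0%R, 1%R] `<=` (`]0%R, +oo[ : set R).
  by move=> x /=; rewrite !in_itv/= andbT => /andP[].
apply: (@lt_le_trans _ _ (\int[mu]_(x in `]0%R, 1%R]) (g x)%:E)%E); last first.
  apply: ge0_le_integral => //=.
  - by move=> x _; rewrite lee_fin mulr_ge0 ?expR_ge0 ?powR_ge0.
  - apply/measurable_EFinP; apply: measurable_funS S _ => //.
    exact: measurable_fun_pos_continuous.
  - apply/measurable_EFinP; apply: measurable_funS S _ => //.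
    by apply: measurable_fun_pos_continuous => x; exact: continuous_gamma_fun.
  - move=> x; rewrite in_itv/= => /andP[x0 x1]; rewrite lee_fin /g mulrC.
    by rewrite ler_wpM2l ?powR_ge0// ler_expR lerN2.
have dG (x : R) : 0 < x -> is_derive x 1 (fun x => expR (-1) / r * x `^ r) (g x).
  move=> x0; apply: is_derive_conv (is_derive_mull _ (is_derive1_powR r x0)) _.
  by rewrite /g mulrA divfK// gt_eqF.
rewrite (@ge0_FTC2_0b _ g (fun x => expR (-1) / r * x `^ r) 1 0 _ _ _ dG)//.
- by rewrite subr0 lte_fin powR1 mulr1 divr_gt0 ?expR_gt0.
- by move=> x x0; rewrite mulr_ge0 ?expR_ge0 ?powR_ge0.
- rewrite -[X in _ --> X](mulr0 (expR (-1) / r)); apply: cvgMr.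
  exact: powR_cvg0.
Qed.

(** Integration by parts on compact intervals for x^r exp(-x), whose derivative is [f2 - f1]. The
    identity [step] is kept as a sum, so that each term has its own limit in the extended reals. *)
Lemma Gamma_add1 (r : R) : 0 < r -> Gamma (r + 1) = r * Gamma r.
Proof.
move=> r0; have r10 : 0 < r + 1 by rewrite addr_gt0.
pose F x := x `^ r * expR (- x).
pose f1 := gamma_fun (r + 1); pose f2 x := r * gamma_fun r x.
have cf1 (x : R) : 0 < x -> {for x, continuous f1} by exact: continuous_gamma_fun.
have cf2 (x : R) : 0 < x -> {for x, continuous f2}.
  by move=> x0; apply: continuousM; [exact: cvg_cst|exact: continuous_gamma_fun].
have f10 (x : R) : 0 < x -> 0 <= f1 x by move=> _; exact: gamma_fun_ge0.
have f20 (x : R) : 0 < x -> 0 <= f2 x.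
  by move=> _; rewrite mulr_ge0 ?gamma_fun_ge0// ltW.
have dF (x : R) : 0 < x -> is_derive x 1 F (f2 x - f1 x).
  move=> x0.
  have h2 : is_derive x 1 (fun x => expR (- x)) (- 1 * expR (- x)).
    have := is_derive_expRN 1 x.
    by rewrite (_ : (fun x : R => expR (- (1 * x))) = (fun x => expR (- x))) ?mul1r//;
      apply/funext => y; rewrite mul1r.
  apply: is_derive_conv (is_derive_mul (is_derive1_powR r x0) h2) _.
  rewrite /f2 /f1 /gamma_fun addrK.
  by ring.
have cF (x : R) : 0 < x -> {for x, continuous (fun x => f2 x - f1 x)}.
  by move=> x0; apply: continuousB; [exact: cf2|exact: cf1].
have step n : (\int[mu]_(x in `[lo_seq n, hi_seq n]) (f2 x)%:E =
    (F (hi_seq n) - F (lo_seq n))%:E +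
    \int[mu]_(x in `[lo_seq n, hi_seq n]) (f1 x)%:E)%E.
  rewrite -(continuous_FTC2_pos (lo_seq_gt0 n) (lo_lt_hi n) cF dF).
  have wc f : (forall x : R, 0 < x -> {for x, continuous f}) ->
      mu.-integrable `[lo_seq n, hi_seq n] (EFin \o f).
    move=> cf; apply: continuous_compact_integrable; first exact: segment_compact.
    apply: continuous_in_subspaceT => x; rewrite inE/= in_itv/= => /andP[h _].
    by apply: cf; rewrite (lt_le_trans _ h)// lo_seq_gt0.
  have mI : measurable (`[lo_seq n, hi_seq n] : set R) by exact: measurable_itv.
  rewrite -integralD; [|exact: mI|exact: wc|exact: wc].
  by apply: eq_integral => x _; rewrite /= -EFinD subrK.
have h1 := ge0_integral_exhaustion f10 (measurable_fun_pos_continuous cf1)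
  (@lo_seq_gt0 R) (@lo_seq_noninc R) (@hi_seq_nondec R).
have h2 := ge0_integral_exhaustion f20 (measurable_fun_pos_continuous cf2)
  (@lo_seq_gt0 R) (@lo_seq_noninc R) (@hi_seq_nondec R).
rewrite (pos_itv_exhaustion (@lo_seq_gt0 R) (@cvg_lo_seq R) (@cvg_hi_seq R)) in h1 h2.
rewrite Gamma_EFin// in h1.
have E2 : (\int[mu]_(x in `]0%R, +oo[) (f2 x)%:E)%E = (r * Gamma r)%:E.
  under eq_integral do rewrite EFinM.
  rewrite ge0_integralZl//= ?Gamma_EFin ?EFinM//.
  - by apply/measurable_EFinP; apply: measurable_fun_pos_continuous => x; exact: continuous_gamma_fun.
  - by move=> x _; rewrite lee_fin gamma_fun_ge0.
  - by rewrite lee_fin ltW.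
rewrite E2 in h2.
have F0 : F x @[x --> 0^'+] --> (0:R).
  rewrite -[X in _ --> X](mul0r (expR (- 0))); apply: cvgM; first exact: powR_cvg0.
  apply: cvg_at_right_filter.
  have := @continuous_expRN 1 0; rewrite /continuous_at mul1r; apply: cvg_trans.
  by apply: near_eq_cvg; apply: nearW => y; rewrite mul1r.
have Fy : F x @[x --> +oo] --> (0:R).
  (* Since x^r (1 + x) <= (1 + x)^(r+1) <= C exp(x), the boundary term is at most C / (1 + x). *)
  pose C := (r + 1) `^ (r + 1) * expR 1.
  apply: (@squeeze_cvgr _ _ _ _ (cst 0) (fun x => C * (1 + x)^-1)); last 2 first.
  - exact: cvg_cst.
  - rewrite -[X in _ --> X](mulr0 C); apply: cvgMr; exact: cvg_inv1Dx.
  near=> x; have x0 : 0 < x by near: x; apply: nbhs_pinfty_gt; rewrite num_real.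
  have x10 : 0 < 1 + x by rewrite addr_gt0.
  rewrite mulr_ge0 ?powR_ge0 ?expR_ge0//= /F expRN ler_pdivrMr ?expR_gt0// mulrAC.
  rewrite ler_pdivlMr// /C -mulrA -expRD.
  apply: le_trans (powR_le_expR _ x10); last exact: r10.
  rewrite powRD ?(gt_eqF r10)// powRr1 ?(ltW x10)// ler_pM2r//.
  by rewrite ge0_ler_powR ?nnegrE ?lerDr 1?ltW.
have hF : F (hi_seq n) - F (lo_seq n) @[n --> \oo] --> (0:R).
  rewrite -(subr0 0); apply: cvgB.
    exact: (cvg_comp _ _ (@cvg_hi_seq R) Fy).
  exact: cvg_comp_lo_seq.
have hF' : (F (hi_seq n) - F (lo_seq n))%:E @[n --> \oo] --> 0%:E.
  by apply: cvg_EFin; [exact: nearW|exact: hF].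
have hd : (0%:E +? (Gamma (r + 1))%:E)%E by [].
have h3 := cvgeD hd hF' h1.
have h4 : (r * Gamma r)%:E = (0%:E + (Gamma (r + 1))%:E)%E.
  have h5 : (\int[mu]_(x in `[lo_seq n, hi_seq n]) (f2 x)%:E)%E @[n --> \oo] -->
      (0%:E + (Gamma (r + 1))%:E)%E.
    under eq_fun do rewrite step.
    exact: h3.
  exact: (cvg_unique (@ereal_hausdorff R) h2 h5).
by move: h4; rewrite add0e => -[].
Unshelve. all: by end_near. Qed.

Lemma integral_gamma_scale (r l : R) : 0 < r -> 0 < l ->
  (\int[mu]_(x in `]0%R, +oo[) (x `^ (r - 1) * expR (- (l * x)))%:E)%E =
  (l `^ (- r) * Gamma r)%:E.
Proof.
move=> r0 l0; rewrite EFinM -Gamma_EFin//.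
have dl (x : R) : is_derive x 1 (fun x : R => l * x) l.
  rewrite (_ : (fun x : R => l * x) = l \*: (@id R))//.
  by apply: is_derive_eq; rewrite /GRing.scale/= mulr1.
rewrite (@ge0_substitution_0y R (fun x => l * x) (fun=> l) (gamma_fun r)) //.
- rewrite -ge0_integralZl//=.
  + apply: eq_integral => x; rewrite inE/= in_itv/= andbT => x0.
    rewrite -EFinM; congr EFin; rewrite /gamma_fun powRM 1?ltW//.
    rewrite -[X in _ = _ * (_ * X)](@powRr1 _ l (ltW l0)).
    have E : l `^ (- r) * l `^ (r - 1) * l `^ 1 = 1.
      rewrite -!powRD ?(gt_eqF l0) ?implybT//.
      by rewrite (_ : _ + _ = 0) ?powRr0//; ring.
    transitivity (l `^ (- r) * l `^ (r - 1) * l `^ 1 *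
      (x `^ (r - 1) * expR (- (l * x)))); first by rewrite E mul1r.
    by ring.
  + apply/measurable_EFinP; apply: measurable_funM => //.
    apply: measurable_fun_pos_continuous => x x0.
    apply: (@continuous_comp _ _ _ (fun x : R => l * x) (gamma_fun r)).
      exact: continuous_is_derive (dl x).
    by apply: continuous_gamma_fun; rewrite mulr_gt0.
  + by move=> x _; rewrite lee_fin mulr_ge0 ?gamma_fun_ge0// ltW.
  + by rewrite lee_fin powR_ge0.
- by move=> x _; exact: cvg_cst.
- by move=> x x0; rewrite mulr_gt0.
- apply: cvg_at_right_filter; rewrite -[X in _ --> X](mulr0 l).
  exact: continuous_is_derive (dl 0).
- exact: gt0_cvgMry.
- by move=> x; exact: continuous_gamma_fun.
- by move=> x _; exact: gamma_fun_ge0.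
Qed.

Lemma integral_gauss_moment (s : R) : -1 < s ->
  (\int[mu]_(x in `]0%R, +oo[) (x `^ s * expR (- (x ^+ 2 / 2)))%:E)%E =
  (2 `^ ((s - 1) / 2) * Gamma ((s + 1) / 2))%:E.
Proof.
move=> s1; have r0 : 0 < (s + 1) / 2 by rewrite divr_gt0// -ltrBlDr sub0r.
rewrite EFinM -Gamma_EFin//.
have dl (x : R) : is_derive x 1 (fun x : R => x ^+ 2 / 2) x.
  rewrite (_ : (fun x : R => x ^+ 2 / 2) = 2^-1 \*: ((@id R) ^+ 2)); last first.
    by apply/funext => y /=; rewrite /GRing.scale/= mulrC.
  apply: is_derive_eq; rewrite /GRing.scale/= mulr1 expr1; by field.
rewrite (@ge0_substitution_0y R (fun x => x ^+ 2 / 2) (fun x => x) (gamma_fun ((s + 1) / 2))) //.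
- rewrite -ge0_integralZl//=.
  + apply: eq_integral => x; rewrite inE/= in_itv/= andbT => x0.
    rewrite -EFinM; congr EFin; rewrite /gamma_fun powRM ?exprn_ge0 1?ltW// ?invr_ge0//.
    have -> : (s + 1) / 2 - 1 = (s - 1) / 2 by field.
    set e := expR _; set p := (s - 1) / 2.
    have E : 2 `^ p * 2^-1 `^ p = 1 :> R.
      by rewrite -powRM ?invr_ge0// divff// powR1.
    have -> : (x ^+ 2) `^ p = x `^ (2%:R * p) by rewrite powRrM powR_mulrn// ltW.
    have -> : x `^ s = x `^ (2%:R * p) * x.
      rewrite -[X in _ * X]powRr1 1?ltW// -powRD; last by rewrite (gt_eqF x0) implybT.
      by congr powR; rewrite /p; field.
    transitivity (2 `^ p * 2^-1 `^ p * (x `^ (2%:R * p) * x * e)).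
      by rewrite E mul1r.
    by ring.
  + apply/measurable_EFinP; apply: measurable_funM => //.
    apply: measurable_fun_pos_continuous => x x0.
    apply: (@continuous_comp _ _ _ (fun x : R => x ^+ 2 / 2) (gamma_fun ((s + 1) / 2))).
      exact: continuous_is_derive (dl x).
    by apply: continuous_gamma_fun; rewrite divr_gt0 ?exprn_gt0.
  + move=> x; rewrite in_itv/= andbT => x0.
    by rewrite lee_fin mulr_ge0 ?gamma_fun_ge0// ltW.
- by move=> x _; exact: cvg_id.
- by move=> x x0; rewrite divr_gt0 ?exprn_gt0.
- apply: cvg_at_right_filter.
  have : (fun x : R => x ^+ 2 / 2) z @[z --> (0:R)] --> (0:R) ^+ 2 / 2.
    exact: continuous_is_derive (dl 0).
  by rewrite expr0n mul0r.
- apply/cvgryPge => A; near=> x.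
  have x1 : 2 <= x by near: x; apply: nbhs_pinfty_ge; rewrite num_real.
  have xA : A <= x by near: x; apply: nbhs_pinfty_ge; rewrite num_real.
  rewrite (le_trans xA)// ler_pdivlMr// expr2 ler_pM2l//.
- by move=> x; exact: continuous_gamma_fun.
- by move=> x _; exact: gamma_fun_ge0.
Unshelve. all: by end_near. Qed.

End gamma.

(** * Level sets of homogeneous scores *)

Section powR_facts.
Context {R : realType}.
Implicit Types x y r s t : R.

Lemma powRD_pos x r s : 0 < x -> x `^ (r + s) = x `^ r * x `^ s.
Proof. by move=> x0; rewrite powRD// (gt_eqF x0) implybT. Qed.

Lemma powRVM x r : 0 < x -> x `^ (- r) * x `^ r = 1.
Proof. by move=> x0; rewrite -powRD_pos// addNr powRr0. Qed.

Lemma powRV x r : 0 < x -> x^-1 `^ r = x `^ (- r).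
Proof. by move=> x0; rewrite -powR_inv1 ?(ltW x0)// -powRrM mulN1r. Qed.

Lemma powR_div x y r : 0 <= x -> 0 < y -> (x / y) `^ r = x `^ r * y `^ (- r).
Proof. by move=> x0 y0; rewrite powRM ?invr_ge0 ?(ltW y0)// powRV. Qed.

Lemma le_powR x y r : 0 <= r -> 0 <= x -> x <= y -> x `^ r <= y `^ r.
Proof.
move=> r0 x0 xy; apply: ge0_ler_powR => //; rewrite nnegrE//.
exact: le_trans xy.
Qed.

Lemma lt_powR x y r : 0 < r -> 0 <= x -> x < y -> x `^ r < y `^ r.
Proof.
move=> r0 x0 xy; apply: gt0_ltr_powR => //; rewrite nnegrE//.
exact: le_trans (ltW xy).
Qed.

Lemma le_powRN x y r : r <= 0 -> 0 < x -> x <= y -> y `^ r <= x `^ r.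
Proof.
move=> r0 x0 xy; rewrite -(opprK r) powRN [leRHS]powRN lef_pV2 ?posrE ?powR_gt0//.
  by rewrite le_powR ?oppr_ge0// ltW.
exact: lt_le_trans xy.
Qed.

Lemma cvgy_powRN r : 0 < r -> t `^ (- r) @[t --> +oo] --> (0:R).
Proof.
move=> r0; apply/cvgrPdist_le => e e0; near=> t.
have t1 : e `^ (- r^-1) <= t by near: t; apply: nbhs_pinfty_ge; rewrite num_real.
have c0 : 0 < e `^ (- r^-1) by rewrite powR_gt0.
rewrite sub0r normrN ger0_norm ?powR_ge0//.
apply: (le_trans (le_powRN _ c0 t1)); first by rewrite oppr_le0 ltW.
by rewrite -powRrM mulrNN mulVf ?gt_eqF// powRr1// ltW.
Unshelve. all: by end_near. Qed.

Lemma cvg_powR_comp (F : set_system R) (f : R -> R) x r : Filter F -> 0 < x ->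
  f t @[t --> F] --> x -> (f t) `^ r @[t --> F] --> x `^ r.
Proof. by move=> FF x0 h; exact: cvg_comp h (@continuous_powR_pos R r x x0). Qed.

End powR_facts.

(* [N] is the leading part of the score [phi] and [M] its next term, of degree
   [nu * (1 - kap)]; [se_rho] makes [M] integrable at the origin against a
   Gaussian law. *)
Record score_expansion {R : realType} (nu kap : R) (phi N M : R -> R) : Prop :=
  ScoreExpansion {
  se_nu : 0 < nu;
  se_kap0 : 0 < kap;
  se_kap : kap <= 2 / nu;
  se_rho : -1 < nu * (1 - kap);
  se_N0 : forall z, 0 <= N z;
  se_homN : forall u z, 0 < u -> N (u * z) = u `^ nu * N z;
  se_homM : forall u z, 0 < u -> M (u * z) = u `^ (nu * (1 - kap)) * M z;
  se_bound : exists2 K, 0 <= K & forall z, z != 0 ->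
    `|phi z - N z| <=
      K * (`|z| `^ (Num.min 0 (nu * (1 - kap))) + `|z| `^ (nu * (1 - kap)));
  se_crude : exists2 K, 0 <= K & forall z, phi z <= K * (1 + N z);
  se_asymp : forall e, 0 < e -> exists2 z0, 0 < z0 & forall z, z0 <= `|z| ->
    `|phi z - N z - M z| <= e * `|z| `^ (nu * (1 - kap));
  se_mphi : measurable_fun setT phi;
  se_mN : measurable_fun setT N;
  se_mM : measurable_fun setT M }.

Section level_sets.
Context {R : realType} {m : nat}.
Variables (nu kap : R) (phi N M : R -> R) (w : 'I_m -> R).
Hypothesis se : score_expansion nu kap phi N M.
Hypothesis hw : simplex_weights w.
Notation rho := (nu * (1 - kap)).
Notation e1 := (Num.min 0 (nu * (1 - kap))).
Implicit Types (g : 'I_m -> R) (q t : R).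

Definition wsum (f : R -> R) g := \sum_i w i * f (g i).

Definition radial_score g q := wsum (fun z => phi (q `^ (- nu^-1) * z)) g.

Lemma wsum_ge0 (f : R -> R) g : (forall z, 0 <= f z) -> 0 <= wsum f g.
Proof. by move=> f0; apply: sumr_ge0 => i _; rewrite mulr_ge0// hw.1. Qed.

Lemma wsum_le (f1 f2 : R -> R) g : (forall i, f1 (g i) <= f2 (g i)) ->
  wsum f1 g <= wsum f2 g.
Proof. by move=> f12; apply: ler_sum => i _; rewrite ler_wpM2l// hw.1. Qed.

Lemma wsum_const (c : R) g : wsum (fun=> c) g = c.
Proof. by rewrite /wsum -mulr_suml hw.2 mul1r. Qed.

Lemma wsumD (f1 f2 : R -> R) g :
  wsum (fun z => f1 z + f2 z) g = wsum f1 g + wsum f2 g.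
Proof. by rewrite /wsum -big_split; apply: eq_bigr => i _; rewrite mulrDr. Qed.

Lemma wsumZ (c : R) (f : R -> R) g : wsum (fun z => c * f z) g = c * wsum f g.
Proof. by rewrite /wsum mulr_sumr; apply: eq_bigr => i _; rewrite mulrCA. Qed.

Let nu0 : 0 < nu := se_nu se.

Lemma scale_powR q r (z : R) : 0 < q ->
  `|q `^ (- nu^-1) * z| `^ r = q `^ (- (r / nu)) * `|z| `^ r.
Proof.
move=> q0; rewrite normrM ger0_norm ?powR_ge0// powRM ?powR_ge0//.
by rewrite -powRrM mulNr (mulrC nu^-1).
Qed.

Lemma scale_N q (z : R) : 0 < q -> N (q `^ (- nu^-1) * z) = q^-1 * N z.
Proof.
move=> q0; rewrite (se_homN se) ?powR_gt0// -powRrM mulNr mulVf ?gt_eqF//.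
by rewrite powR_inv1// ltW.
Qed.

Lemma rho_nu : rho / nu = 1 - kap.
Proof. by rewrite mulrAC divff ?gt_eqF ?mul1r. Qed.

Lemma scale_M q (z : R) : 0 < q ->
  M (q `^ (- nu^-1) * z) = q `^ (kap - 1) * M z.
Proof.
move=> q0; rewrite (se_homM se) ?powR_gt0// -powRrM mulNr (mulrC nu^-1) rho_nu.
by rewrite opprB.
Qed.

Lemma e1_le_rho : e1 <= rho. Proof. by rewrite ge_min lexx orbT. Qed.

(** This inequality dictates [e1]. Near the origin [phi - N] is merely bounded, and after
    multiplication by [q] a constant error has order 1/t, too large when [kap > 1]. In that case rho
    < 0 and the bound |z|^rho, larger near 0, restores the order t^(-kap). *)
Lemma kap_le_e1 : kap <= 1 - e1 / nu.
Proof.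
have : e1 / nu <= rho / nu by rewrite ler_pM2r ?invr_gt0// e1_le_rho.
by rewrite rho_nu; lra.
Qed.

Lemma e1_gtN1 : -1 < e1.
Proof. by rewrite lt_min (se_rho se) ltrN10. Qed.

(** Times t^(-kap), this bounds the error on [q * t] when the score is replaced by its leading part,
    over the range [q * t <= P]. It does not depend on [t], which makes it fit for domination. *)
Definition gap (K P : R) g : R :=
  K * wsum (fun z => `|z| `^ e1 * P `^ (1 - e1 / nu) + `|z| `^ rho * P `^ kap) g.

Lemma gap_ge0 K P g : 0 <= K -> 0 <= gap K P g.
Proof.
by move=> K0; rewrite mulr_ge0// wsum_ge0// => z; rewrite addr_ge0// mulr_ge0 ?powR_ge0.
Qed.

Lemma radial_scoreB K g q : 0 < q ->
  (forall z, z != 0 -> `|phi z - N z| <= K * (`|z| `^ e1 + `|z| `^ rho)) ->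
  (forall i, g i != 0) ->
  `|radial_score g q - wsum N g / q| <=
  K * wsum (fun z => q `^ (- (e1 / nu)) * `|z| `^ e1 + q `^ (kap - 1) * `|z| `^ rho) g.
Proof.
move=> q0 hK g0; rewrite /radial_score /wsum mulr_suml -sumrB mulr_sumr.
apply: le_trans (ler_norm_sum _ _ _) _; apply: ler_sum => i _.
rewrite -mulrA -mulrBr normrM ger0_norm ?hw.1// mulrCA ler_wpM2l ?hw.1//.
rewrite [N _ / _]mulrC -scale_N//; apply: le_trans (hK _ _) _.
  by rewrite mulf_neq0// gt_eqF// powR_gt0.
by rewrite !scale_powR// rho_nu opprB.
Qed.

(* Multiplying the score by [q = p / t] turns the approximation error of
   [radial_scoreB] into one of size [t^-kap] uniformly in [p <= P]. *)
Lemma gapP K P g q t : 0 <= K -> 0 < q -> 1 <= t -> q * t <= P ->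
  q * (K * wsum (fun z => q `^ (- (e1 / nu)) * `|z| `^ e1 + q `^ (kap - 1) * `|z| `^ rho) g)
  <= gap K P g * t `^ (- kap).
Proof.
move=> K0 q0 t1 qtP; have t0 : 0 < t by exact: lt_le_trans t1.
rewrite /gap mulrCA -!mulrA ler_wpM2l//.
rewrite /wsum mulr_sumr mulr_suml; apply: ler_sum => i _.
rewrite mulrCA -mulrA ler_wpM2l ?hw.1//.
have P0 : 0 <= P by rewrite (le_trans _ qtP)// mulr_ge0// ltW.
have qE (r : R) : q * q `^ (r - 1) = q `^ r.
  by rewrite -[X in X * _]powRr1 ?(ltW q0)// -powRD_pos// addrC subrK.
have key (r : R) : 0 <= r -> kap <= r -> q `^ r <= P `^ r * t `^ (- kap).
  move=> r0 kr; rewrite -(mulfK (lt0r_neq0 t0) q) powR_div ?mulr_ge0 ?(ltW q0) ?(ltW t0)//.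
  apply: ler_pM; rewrite ?powR_ge0//.
    by rewrite le_powR// mulr_ge0 ?(ltW q0) ?(ltW t0).
  by rewrite ler_powR// lerN2.
rewrite mulrDr mulrDl; apply: lerD.
  have E : q * q `^ (- (e1 / nu)) = q `^ (1 - e1 / nu).
    by rewrite -[in RHS]qE; congr (q * q `^ _); ring.
  rewrite mulrA E mulrC -mulrA ler_wpM2l ?powR_ge0// key ?kap_le_e1//.
  by rewrite (le_trans _ kap_le_e1)// ltW// (se_kap0 se).
rewrite mulrA qE mulrC -mulrA ler_wpM2l ?powR_ge0// key//.
by rewrite ltW// (se_kap0 se).
Qed.

(** The crude bound localises [q]: with A = [wsum N g], exceeding [t] forces t < K (1 + A/q), and K
    <= t/2 absorbs the constant, whence q t <= 2 K A. On that range [gapP] controls the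
    approximation error. *)
Lemma level_set_upper K g q t : 1 <= K -> 0 < q -> 2 * K <= t ->
  (forall z, z != 0 -> `|phi z - N z| <= K * (`|z| `^ e1 + `|z| `^ rho)) ->
  (forall z, phi z <= K * (1 + N z)) ->
  (forall i, g i != 0) ->
  t < radial_score g q ->
  q * t < wsum N g + gap K (2 * K * wsum N g) g * t `^ (- kap)
  /\ q * t <= 2 * K * wsum N g.
Proof.
move=> K1 q0 Kt hK hC g0 tS; have K0 : 0 <= K by exact: le_trans K1.
have t1 : 1 <= t by rewrite (le_trans _ Kt)//; nra.
have qtP : q * t <= 2 * K * wsum N g.
  have : radial_score g q <= K * (1 + wsum N g / q).
    rewrite /radial_score -(mulrC q^-1) -wsumZ -[X in X + _](wsum_const 1 g) -wsumD -wsumZ.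
    by apply: wsum_le => i; rewrite -scale_N.
  move=> /(lt_le_trans tS) h.
  have : t * q < K * (q + wsum N g).
    have := h; rewrite -(ltr_pM2r q0) -mulrA mulrDl mul1r divfK ?gt_eqF//.
  nra.
split=> //.
have := radial_scoreB q0 hK g0.
move=> /ler_normlP[_]; rewrite lerBlDr => /(lt_le_trans tS).
rewrite -(ltr_pM2l q0) => /lt_le_trans; apply.
rewrite mulrDr addrC mulrCA divff ?gt_eqF// mulr1 lerD2l.
exact: gapP.
Qed.

Lemma level_set_lower K g q t : 1 <= K -> 0 < q -> 2 * K <= t ->
  (forall z, z != 0 -> `|phi z - N z| <= K * (`|z| `^ e1 + `|z| `^ rho)) ->
  (forall i, g i != 0) ->
  q * t < wsum N g - gap K (2 * K * wsum N g) g * t `^ (- kap) ->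
  t < radial_score g q.
Proof.
move=> K1 q0 Kt hK g0 qtA; have K0 : 0 <= K by exact: le_trans K1.
have t1 : 1 <= t by rewrite (le_trans _ Kt)//; nra.
have A0 : 0 <= wsum N g by apply: wsum_ge0; exact: se_N0 se.
(* The range is deliberately that of [level_set_upper], so that a single [gap] serves both
   inclusions. *)
have qtP : q * t <= 2 * K * wsum N g.
  apply: (@le_trans _ _ (wsum N g)); last by nra.
  by rewrite (le_trans (ltW qtA))// gerBl mulr_ge0 ?powR_ge0// gap_ge0.
have := radial_scoreB q0 hK g0; rewrite ler_distlC => /andP[_ h].
rewrite -(ltr_pM2l q0); apply: lt_le_trans qtA _.
rewrite -(ler_pM2l q0) mulrDr [q * (wsum N g / q)]mulrCA divff ?gt_eqF// mulr1 in h.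
have := @gapP K (2 * K * wsum N g) g q t K0 q0 t1 qtP.
by lra.
Qed.

Lemma radial_score_asymp g e : (forall i, g i != 0) -> 0 < e ->
  exists2 q0, 0 < q0 & forall q, 0 < q -> q <= q0 ->
  `|radial_score g q - wsum N g / q - q `^ (kap - 1) * wsum M g|
    <= e * q `^ (kap - 1).
Proof.
move=> g0 e0.
pose D := wsum (fun z => `|z| `^ rho) g.
have D0 : 0 <= D by apply: wsum_ge0 => z; exact: powR_ge0.
have [z0 z00 hz] := se_asymp se (divr_gt0 e0 (ltr_pwDr ltr01 D0)).
(* A positive lower bound of all the |g i|, obtained without a minimum over a finite family. *)
pose mg := \prod_i Num.min 1 `|g i|.
have mgi i : mg <= `|g i|.
  rewrite /mg (bigD1 i)//=.
  have h : \prod_(j | j != i) Num.min 1 `|g j| <= 1.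
    apply: prodr_ile1 => j _; rewrite le_min ler01 normr_ge0/=.
    by rewrite ge_min lexx.
  apply: (@le_trans _ _ (Num.min 1 `|g i| * 1)).
    by rewrite ler_wpM2l// le_min ler01/=.
  by rewrite mulr1 ge_min lexx orbT.
have mg0 : 0 < mg by apply: prodr_gt0 => i _; rewrite lt_min ltr01 normr_gt0 g0.
(* For [q] below this value q^(-1/nu) mg >= z0, so every scaled coordinate lies in the asymptotic
   range. *)
exists ((mg / z0) `^ nu); first by rewrite powR_gt0// divr_gt0.
move=> q q0 qle.
have hqi i : z0 <= `|q `^ (- nu^-1) * g i|.
  rewrite normrM ger0_norm ?powR_ge0//.
  apply: (@le_trans _ _ (q `^ (- nu^-1) * mg)); last first.
    by rewrite ler_wpM2l// powR_ge0.
  rewrite powRN -ler_pdivrMl ?invr_gt0 ?powR_gt0// invrK mulrC.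
  rewrite -ler_pdivlMl// mulrC.
  have -> : mg / z0 = ((mg / z0) `^ nu) `^ nu^-1.
    by rewrite -powRrM divff ?gt_eqF// powRr1// ltW// divr_gt0.
  by apply: le_powR => //; rewrite ?invr_ge0 ltW.
rewrite /radial_score /wsum mulr_suml mulr_sumr -!sumrB.
apply: le_trans (ler_norm_sum _ _ _) _.
apply: (@le_trans _ _ (e / (D + 1) * (q `^ (kap - 1) * D))).
  rewrite [q `^ _ * D]mulr_sumr mulr_sumr; apply: ler_sum => i _.
  rewrite [q `^ _ * (w i * M _)]mulrCA -[w i * N _ / q]mulrA -!mulrBr.
  rewrite normrM ger0_norm ?hw.1//.
  rewrite [X in _ <= _ * X]mulrCA [X in _ <= X]mulrCA ler_wpM2l ?hw.1//.
  rewrite [N _ / q]mulrC -scale_N// -scale_M//.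
  apply: le_trans (hz _ (hqi i)) _; rewrite scale_powR// rho_nu opprB.
  by [].
rewrite mulrCA [X in _ <= X]mulrC ler_wpM2l ?powR_ge0//.
rewrite mulrAC ler_pdivrMr ?ltr_wpDl// ler_wpM2l ?lerDl// ltW//.
Qed.

Lemma se_const : exists K, [/\ 1 <= K,
  forall z, z != 0 -> `|phi z - N z| <= K * (`|z| `^ e1 + `|z| `^ rho) &
  forall z, phi z <= K * (1 + N z)].
Proof.
have [K1 K10 h1] := se_bound se; have [K2 K20 h2] := se_crude se.
exists (1 + K1 + K2); split; first by rewrite -addrA lerDl addr_ge0.
  move=> z /h1 /le_trans; apply; rewrite ler_wpM2r ?addr_ge0 ?powR_ge0//.
  by rewrite addrAC lerDr addr_ge0.
move=> z; apply: le_trans (h2 z) _; rewrite ler_wpM2r ?addr_ge0 ?(se_N0 se)//.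
by rewrite lerDr addr_ge0.
Qed.

Lemma powR_near (A e r : R) : 0 < A -> 0 < e -> exists2 eta, 0 < eta &
  forall p, `|p - A| <= eta -> `|p `^ r - A `^ r| <= e.
Proof.
move=> A0 e0; have := @continuous_powR_pos R r A A0.
move=> /cvgrPdist_le/(_ _ e0)/nbhs_ballP[eta /= eta0 h].
exists (eta / 2); first by rewrite divr_gt0.
move=> p hp; rewrite distrC; apply: h; rewrite /ball/= distrC.
by rewrite (le_lt_trans hp)// ltr_pdivrMr// ltr_pMr// ltr1n.
Qed.

(** Put p = q t. Outside a window |p - A| <= L t^(-kap) the rough inclusions decide both
    implications. Inside it, q is close to A/t and hence small, so the asymptotics of the score give
    q times the score as A + p^kap B t^(-kap) up to a small multiple of t^(-kap), and p^kap is close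
    to A^kap by continuity. *)
Lemma level_set_sharp g e : (forall i, g i != 0) -> 0 < e -> 0 < wsum N g ->
  \forall t \near +oo, forall q, 0 < q ->
    (t < radial_score g q ->
     q * t < wsum N g + (wsum N g `^ kap * wsum M g + e) * t `^ (- kap)) /\
    (q * t < wsum N g + (wsum N g `^ kap * wsum M g - e) * t `^ (- kap) ->
     t < radial_score g q).
Proof.
move=> g0 e0; set A := wsum N g; set B := wsum M g => A0.
have [K [K1 hK hC]] := se_const.
pose Mg := gap K (2 * K * A) g.
have Mg0 : 0 <= Mg by apply: gap_ge0; exact: le_trans K1.
(* The width must exceed both the rough error [Mg] and the sharp correction, so that all thresholds
   lie within the window. *)
pose L := Mg + `|A `^ kap * B| + e.
have L0 : 0 < L by rewrite /L ltr_wpDl// addr_ge0.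
(* [e2] bounds the change of p^kap and [dl] the asymptotic error of the score; each is tuned to
   contribute at most e/2. The cap at 1 gives p^kap <= A^kap + 1, which is what [dl] is divided
   by. *)
pose e2 := Num.min 1 (e / (2 * (`|B| + 1))).
have e20 : 0 < e2 by rewrite lt_min ltr01/= divr_gt0// mulr_gt0// ltr_wpDl.
have [eta eta0 heta] := powR_near kap A0 e20.
pose dl := e / (2 * (A `^ kap + 1)).
have dl0 : 0 < dl by rewrite divr_gt0// mulr_gt0// ltr_wpDl// powR_ge0.
have [q1 q10 hq1] := radial_score_asymp g0 dl0.
have kap0 := se_kap0 se.
near=> t => q q0.
have Kt : 2 * K <= t by near: t; apply: nbhs_pinfty_ge; rewrite num_real.
have t0 : 0 < t by rewrite (lt_le_trans _ Kt)//; lra.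
have At : 3 / 2 * A / q1 <= t by near: t; apply: nbhs_pinfty_ge; rewrite num_real.
have ts : L * t `^ (- kap) <= Num.min eta (A / 2).
  near: t.
  have eA0 : 0 < Num.min eta (A / 2) by rewrite lt_min eta0/= divr_gt0.
  have h0 : L * t `^ (- kap) @[t --> +oo] --> (0:R).
    by rewrite -[X in _ --> X](mulr0 L); apply: cvgMr; exact: cvgy_powRN.
  have /cvgrPdist_lt/(_ _ eA0) := h0; apply: filterS => x.
  by rewrite sub0r normrN => /ltW; apply: le_trans; rewrite ler_norm.
have s0 : 0 < t `^ (- kap) by rewrite powR_gt0.
have ABL : `|A `^ kap * B| + e <= L by rewrite /L -addrA lerDr.
have ML : Mg <= L by rewrite /L -addrA lerDl addr_ge0// ltW.
have := ler_norm (A `^ kap * B); have := ler_norm (- (A `^ kap * B)); rewrite normrN.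
move=> AB1 AB2.
set T := t `^ (- kap) in s0 ts *.
have hM : Mg * T <= L * T by rewrite ler_pM2r.
have hAB1 : (A `^ kap * B - e) * T <= L * T by rewrite ler_pM2r//; clear -AB2 ABL e0; lra.
have hAB2 : - (L * T) <= (A `^ kap * B + e) * T by rewrite -mulNr ler_pM2r//; clear -AB1 ABL e0; lra.
have [pU|pU] := ltP (A + L * T) (q * t).
  split => [tS|h]; last by exfalso; clear -h pU hAB1; lra.
  by have [h _] := level_set_upper K1 q0 Kt hK hC g0 tS; exfalso; rewrite -/A -/Mg -/T in h; clear -h pU hM; lra.
have [pL|pL] := ltP (q * t) (A - L * T).
  split => [_|_]; first by clear -hAB2 pL; lra.
  by apply: (level_set_lower K1 q0 Kt hK g0); rewrite -/A -/Mg -/T; clear -hM pL; lra.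
move: ts; rewrite le_min => /andP[ts1 ts2].
have pA : `|q * t - A| <= eta by rewrite ler_distl; apply/andP; split; clear -pU pL ts1; lra.
have qq1 : q <= q1.
  rewrite -(ler_pM2r t0); apply: (@le_trans _ _ (3 / 2 * A)); first by clear -pU ts2; lra.
  by rewrite -ler_pdivrMl// mulrC.
have := hq1 _ q0 qq1; rewrite -/A -/B => hS.
have qk : q * q `^ (kap - 1) = (q * t) `^ kap * t `^ (- kap).
  have -> : (q * t) `^ kap = q `^ kap * t `^ kap by apply: powRM; exact: ltW.
  rewrite -mulrA [t `^ kap * _]mulrC (powRVM _ t0) mulr1.
  by rewrite -[X in X * _]powRr1 ?(ltW q0)// -powRD_pos// addrC subrK.
have hqS : `|q * radial_score g q - A - (q * t) `^ kap * t `^ (- kap) * B|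
    <= dl * ((q * t) `^ kap * t `^ (- kap)).
  rewrite -qk [X in _ <= X]mulrCA.
  have -> : q * radial_score g q - A - q * q `^ (kap - 1) * B =
     q * (radial_score g q - A / q - q `^ (kap - 1) * B).
    by field; rewrite gt_eqF.
  by rewrite normrM (ger0_norm (ltW q0)) ler_wpM2l// ltW.
have hp := heta _ pA.
have pk0 : 0 <= (q * t) `^ kap by exact: powR_ge0.
have e21 : e2 <= 1 by rewrite ge_min lexx.
have e2B : e2 * (`|B| + 1) <= e / 2.
  rewrite -ler_pdivlMr ?ltr_wpDl// -mulrA -invfM.
  by rewrite ge_min lexx orbT.
have dlA : dl * (A `^ kap + 1) = e / 2.
  rewrite /dl; field.
  by rewrite gt_eqF// ltr_wpDl// powR_ge0.
have Ak0 : 0 <= A `^ kap by exact: powR_ge0.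
have key : `|q * radial_score g q - A - A `^ kap * B * t `^ (- kap)| <= e * t `^ (- kap).
  have -> : q * radial_score g q - A - A `^ kap * B * t `^ (- kap) =
    (q * radial_score g q - A - (q * t) `^ kap * t `^ (- kap) * B) +
    ((q * t) `^ kap - A `^ kap) * B * t `^ (- kap) by ring.
  apply: le_trans (ler_normD _ _) _.
  apply: (@le_trans _ _ (dl * ((A `^ kap + 1) * t `^ (- kap)) + e2 * (`|B| + 1) * t `^ (- kap))).
    apply: lerD.
      apply: (le_trans hqS); rewrite ler_pM2l// ler_pM2r//.
      by move: hp; rewrite ler_distl => /andP[_ h]; clear -h e21; lra.
    rewrite !normrM [`|t `^ _|]ger0_norm ?powR_ge0// ler_pM2r//.
    by apply: ler_pM => //; rewrite lerDl.
  rewrite mulrA dlA -mulrDl; apply: ler_wpM2r; first exact: ltW.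
  by rewrite [X in _ <= X](splitr e) lerD2l.
move: key; rewrite ler_distl -/T => /andP[k1 k2].
split.
  rewrite -(ltr_pM2l q0) => h; apply: (lt_le_trans h); clear -k2; lra.
move=> h; rewrite -(ltr_pM2l q0); apply: (lt_le_trans h); clear -k1; lra.
Unshelve. all: by end_near. Qed.

End level_sets.

Section cdf_expansion.
Context {R : realType}.
Variables (nu kap a b K3 : R) (H : R -> R).
Hypotheses (nu0 : 0 < nu) (kap0 : 0 < kap) (kapnu : kap <= 2 / nu).
Hypothesis H_lo : forall x, 0 < x -> a * x - a * b * x `^ (1 + 2 / nu) <= H x.
Hypothesis H_hi2 : forall x, 0 < x ->
  H x <= a * x - a * b * x `^ (1 + 2 / nu) + K3 * x `^ (1 + 4 / nu).

(* The second term of the distribution function [H] has relative order [t^(-2/nu)], so it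
   matters only when [kap = 2 / nu]. *)
Definition second_coef : R := if kap == 2 / nu then b else 0.

Let tpow (t s : R) : 0 < t -> t `^ (1 + kap) * t `^ (- (1 + s)) = t `^ (- (s - kap)).
Proof. by move=> t0; rewrite -powRD_pos//; congr powR; ring. Qed.

(** The linear part of [H] contributes exactly [a * c]. The next term carries the factor t^(kap -
    2/nu), which survives only if kap = 2/nu, and the last one vanishes because kap <= 2/nu < 4/nu.
    The bounds on [H] thus squeeze the left-hand side between [f] and [f2]. *)
Lemma cdf_scaling_cvg (A c : R) : 0 < A ->
  t `^ (1 + kap) * (H ((A + c * t `^ (- kap)) / t) - a * A / t) @[t --> +oo] -->
  a * c - a * second_coef * A `^ (1 + 2 / nu).
Proof.
move=> A0.
pose y (t : R) := A + c * t `^ (- kap).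
have cy : y t @[t --> +oo] --> A.
  rewrite -[X in _ --> X]addr0; apply: cvgD; first exact: cvg_cst.
  by rewrite -[X in _ --> X](mulr0 c); apply: cvgMr; exact: cvgy_powRN.
have cyp r : (y t) `^ r @[t --> +oo] --> A `^ r by exact: cvg_powR_comp.
have n40 : 0 < 4 / nu - kap.
  rewrite subr_gt0 (le_lt_trans kapnu)// ltr_pM2r ?invr_gt0//; lra.
pose f (t : R) := a * c - a * b * ((y t) `^ (1 + 2 / nu) * t `^ (- (2 / nu - kap))).
pose f2 (t : R) := f t + K3 * ((y t) `^ (1 + 4 / nu) * t `^ (- (4 / nu - kap))).
have cf : f t @[t --> +oo] --> a * c - a * second_coef * A `^ (1 + 2 / nu).
  apply: cvgB; first exact: cvg_cst.
  rewrite /second_coef; have [E|ne] := eqVneq kap (2 / nu).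
    apply: cvgMr.
    rewrite E subrr oppr0 -[X in _ --> X]mulr1; apply: cvgM; first exact: cyp.
    by under eq_fun do rewrite powRr0; exact: cvg_cst.
  rewrite mulr0 mul0r -(mulr0 (a * b)); apply: cvgMr.
  rewrite -(mulr0 (A `^ (1 + 2 / nu))); apply: cvgM; first exact: cyp.
  by apply: cvgy_powRN; rewrite subr_gt0 lt_neqAle ne.
have cf2 : f2 t @[t --> +oo] --> a * c - a * second_coef * A `^ (1 + 2 / nu).
  rewrite -[X in _ --> X]addr0; apply: cvgD; first exact: cf.
  rewrite -(mulr0 K3); apply: cvgMr.
  rewrite -(mulr0 (A `^ (1 + 4 / nu))); apply: cvgM; first exact: cyp.
  exact: cvgy_powRN.
apply: squeeze_cvgr cf cf2; near=> t.
have t0 : 0 < t by near: t; apply: nbhs_pinfty_gt; rewrite num_real.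
have y0 : 0 < y t.
  near: t; have /cvgrPdist_lt/(_ _ A0) := cy; apply: filterS => x.
  by move=> /ltr_normlP[_]; rewrite gtrBl.
have x0 : 0 < y t / t by rewrite divr_gt0.
have tk0 : 0 < t `^ (1 + kap) by rewrite powR_gt0.
have E1 : t `^ (1 + kap) * (a * (y t / t) - a * A / t) = a * c.
  rewrite powRD_pos// powRr1 ?(ltW t0)// /y.
  transitivity (a * c * (t `^ (- kap) * t `^ kap)); last by rewrite powRVM// mulr1.
  by field; rewrite gt_eqF.
have Es s : t `^ (1 + kap) * (y t / t) `^ (1 + s) = (y t) `^ (1 + s) * t `^ (- (s - kap)).
  by rewrite powR_div ?(ltW y0)// mulrCA tpow.
have fE : f t = t `^ (1 + kap) *
    ((a * (y t / t) - a * b * (y t / t) `^ (1 + 2 / nu)) - a * A / t).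
  rewrite /f -Es -E1; ring.
have f2E : f2 t = t `^ (1 + kap) *
    ((a * (y t / t) - a * b * (y t / t) `^ (1 + 2 / nu) +
      K3 * (y t / t) `^ (1 + 4 / nu)) - a * A / t).
  rewrite /f2 fE -Es; ring.
by rewrite fE f2E -/(y t) !ler_pM2l// !lerD2r H_lo// H_hi2.
Unshelve. all: by end_near. Qed.

End cdf_expansion.

(** * The conditional tail: uniform domination and pointwise limit *)

Section conditional_tail.
Context {R : realType} {m : nat}.
Variables (nu kap a b K3 : R) (phi N M : R -> R) (w : 'I_m -> R).
Hypothesis se : score_expansion nu kap phi N M.
Hypothesis hw : simplex_weights w.
Variables (H : R -> R) (F : ('I_m -> R) -> R -> R) (t0 : R).
Hypotheses (a0 : 0 <= a) (b0 : 0 <= b).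
Hypothesis H_lo : forall x, 0 < x -> a * x - a * b * x `^ (1 + 2 / nu) <= H x.
Hypothesis H_hi : forall x, 0 < x -> H x <= a * x.
Hypothesis H_hi2 : forall x, 0 < x ->
  H x <= a * x - a * b * x `^ (1 + 2 / nu) + K3 * x `^ (1 + 4 / nu).
Hypothesis F_ge0 : forall g t, 0 <= F g t.
(** Since the level set in [q] need not be an interval, [F] is only compared with intervals that
    contain it or lie in it. [F_empty] handles the vectors with [wsum w N g = 0], for which no
    positive end point [x] is available uniformly. *)
Hypothesis F_hi : forall g t x, t0 <= t -> 0 < x ->
  (forall q, 0 < q -> t < radial_score nu phi w g q -> q < x) -> F g t <= H x.
Hypothesis F_lo : forall g t x, t0 <= t -> 0 < x ->
  (forall q, 0 < q -> q < x -> t < radial_score nu phi w g q) -> H x <= F g t.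
Hypothesis F_empty : forall g t, t0 <= t ->
  (forall q, 0 < q -> radial_score nu phi w g q <= t) -> F g t = 0.
Implicit Types (g : 'I_m -> R) (t : R).

Let nu0 : 0 < nu := se_nu se.
Let kap0 : 0 < kap := se_kap0 se.

Definition scaled_tail g t : R := t `^ (1 + kap) * (F g t - a * wsum w N g / t).

Lemma wsumN_ge0 g : 0 <= wsum w N g.
Proof. by apply: (wsum_ge0 hw); exact: se_N0 se. Qed.

Let level_set_wsum0 K g t : 1 <= K -> 2 * K <= t ->
  (forall z, z != 0 -> `|phi z - N z| <= K * (`|z| `^ (Num.min 0 (nu * (1 - kap))) + `|z| `^ (nu * (1 - kap)))) ->
  (forall z, phi z <= K * (1 + N z)) ->
  (forall i, g i != 0) -> wsum w N g = 0 ->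
  forall q, 0 < q -> radial_score nu phi w g q <= t.
Proof.
move=> K1 Kt hK hC g0 A0 q q0; rewrite leNgt; apply/negP => tS.
have [_] := level_set_upper se hw K1 q0 Kt hK hC g0 tS.
rewrite A0 mulr0 leNgt mulr_gt0//; apply: lt_le_trans Kt; lra.
Qed.

Lemma scaled_tail_dominated : exists K, [/\ 1 <= K, t0 <= 2 * K &
  forall g t, (forall i, g i != 0) -> 2 * K <= t ->
  `|scaled_tail g t| <=
    a * gap nu kap w K (2 * K * wsum w N g) g + a * b * wsum w N g `^ (1 + 2 / nu)].
Proof.
have [K' [K1' hK' hC']] := se_const se.
(* The extra summand makes 2 K >= t0, so one threshold serves the level set lemmas and the
   hypotheses on [F]. *)
pose K := K' + Num.max 0 t0.
have mx0 : 0 <= Num.max 0 t0 by rewrite le_max lexx.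
have KK' : K' <= K by rewrite lerDl.
have K1 : 1 <= K by exact: le_trans KK'.
have hK : forall z, z != 0 -> `|phi z - N z| <= K * (`|z| `^ (Num.min 0 (nu * (1 - kap))) + `|z| `^ (nu * (1 - kap))).
  by move=> z /hK' /le_trans; apply; rewrite ler_wpM2r// addr_ge0// powR_ge0.
have hC : forall z, phi z <= K * (1 + N z).
  by move=> z; apply: le_trans (hC' z) _; rewrite ler_wpM2r// addr_ge0// (se_N0 se).
have tK : t0 <= 2 * K.
  have ht0 : t0 <= Num.max 0 t0 by rewrite le_max lexx orbT.
  rewrite /K; lra.
exists K; split => // g t g0 Kt.
set A := wsum w N g; set Mg := gap _ _ _ _ _ _.
have A0 : 0 <= A by exact: wsumN_ge0.
have Mg0 : 0 <= Mg by apply: (gap_ge0 _ _ hw); exact: le_trans K1.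
have t00 : t0 <= t by exact: le_trans Kt.
have tp : 0 < t by apply: lt_le_trans Kt; lra.
have t1 : 1 <= t by apply: le_trans Kt; lra.
have tk : 0 < t `^ (1 + kap) by rewrite powR_gt0.
have aM0 : 0 <= a * Mg by rewrite mulr_ge0.
have abA : 0 <= a * b * A `^ (1 + 2 / nu) by rewrite !mulr_ge0 ?powR_ge0.
have Ec (c : R) : t `^ (1 + kap) * (a * ((A + c * t `^ (- kap)) / t) - a * A / t) = a * c.
  rewrite powRD_pos// powRr1 ?(ltW tp)//.
  transitivity (a * c * (t `^ (- kap) * t `^ kap)); last by rewrite powRVM// mulr1.
  by field; rewrite gt_eqF.
have hup : F g t <= a * ((A + Mg * t `^ (- kap)) / t).
  have [x0|x0] := ltP 0 ((A + Mg * t `^ (- kap)) / t).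
    apply: le_trans (H_hi x0); apply: F_hi => // q q0 tS.
    by have [h _] := level_set_upper se hw K1 q0 Kt hK hC g0 tS; rewrite ltr_pdivlMr.
  (* A nonpositive end point forces A = 0, and then the level set is empty. *)
  rewrite F_empty//; last first.
    apply: (level_set_wsum0 K1 Kt hK hC g0); apply/eqP; rewrite eq_le A0 andbT -/A.
    move: x0; rewrite pmulr_lle0 ?invr_gt0//; apply: le_trans.
    by rewrite lerDl mulr_ge0// powR_ge0.
  by rewrite mulr_ge0// divr_ge0 ?(ltW tp)// addr_ge0// mulr_ge0// powR_ge0.
have hlo : a * ((A + - Mg * t `^ (- kap)) / t) - a * b * (A / t) `^ (1 + 2 / nu) <= F g t.
  have [x0|x0] := ltP 0 ((A + - Mg * t `^ (- kap)) / t).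
    apply: (@le_trans _ _ (H ((A + - Mg * t `^ (- kap)) / t))).
      apply: le_trans (H_lo x0); rewrite lerD2l lerN2 ler_wpM2l ?mulr_ge0//.
      apply: le_powR; [by rewrite addr_ge0// divr_ge0// ltW|exact: ltW|].
      by rewrite ler_pM2r ?invr_gt0// mulNr gerBl mulr_ge0// powR_ge0.
    apply: F_lo => // q q0; rewrite ltr_pdivlMr// mulNr => qt.
    exact: (level_set_lower se hw K1 q0 Kt hK g0).
  apply: le_trans (F_ge0 g t).
  rewrite subr_le0; apply: (@le_trans _ _ 0); last by rewrite !mulr_ge0 ?powR_ge0.
  by rewrite mulr_ge0_le0.
rewrite ler_norml; apply/andP; split; last first.
  apply: (@le_trans _ _ (a * Mg)); last by rewrite lerDl.
  by rewrite -Ec /scaled_tail ler_pM2l// lerD2r.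
(* The power of t that remains is t^(kap - 2/nu), at most 1 because kap <= 2/nu and t >= 1. *)
have hA : t `^ (1 + kap) * (A / t) `^ (1 + 2 / nu) <= A `^ (1 + 2 / nu).
  rewrite powR_div// mulrCA -powRD_pos//.
  rewrite -[X in _ <= X]mulr1 ler_wpM2l ?powR_ge0// -[X in _ <= X](powRr0 t) ler_powR//.
  by have := se_kap se; lra.
rewrite opprD; apply: (@le_trans _ _ (t `^ (1 + kap) *
  (a * ((A + - Mg * t `^ (- kap)) / t) - a * b * (A / t) `^ (1 + 2 / nu) - a * A / t))).
  rewrite addrAC mulrDr Ec mulrN [X in _ <= _ + X]mulrN lerD2l lerN2.
  by rewrite mulrCA ler_wpM2l// mulr_ge0.
by rewrite /scaled_tail ler_pM2l// lerD2r.
Qed.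

Lemma scaled_tail_cvg g : (forall i, g i != 0) ->
  scaled_tail g t @[t --> +oo] -->
  a * (wsum w N g `^ kap * (wsum w M g - second_coef nu kap b * wsum w N g `^ (1 + 2 / nu - kap))).
Proof.
move=> g0; set A := wsum w N g; set B := wsum w M g; set p := 1 + 2 / nu.
have A0 : 0 <= A by exact: wsumN_ge0.
(* If A = 0, the conditional tail vanishes for large t, in agreement with the limit, where 0^kap =
   0. *)
have [E0|A1] := eqVneq A 0.
  have [K [K1 hK hC]] := se_const se.
  rewrite E0 powR0 ?gt_eqF// mul0r mulr0.
  apply: cvg_near_cst; near=> t.
  have Kt : 2 * K <= t by near: t; apply: nbhs_pinfty_ge; rewrite num_real.
  have t00 : t0 <= t by near: t; apply: nbhs_pinfty_ge; rewrite num_real.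
  rewrite /scaled_tail -/A E0 (F_empty t00) ?mulr0 ?mul0r ?subr0 ?mulr0//.
  exact: (level_set_wsum0 K1 Kt hK hC g0).
have Ap : 0 < A by rewrite lt_neqAle eq_sym A1.
have -> : a * (A `^ kap * (B - second_coef nu kap b * A `^ (p - kap))) =
    a * (A `^ kap * B) - a * second_coef nu kap b * A `^ p.
  have -> : A `^ p = A `^ (p - kap) * A `^ kap by rewrite -powRD_pos// subrK.
  by ring.
set L := _ - a * second_coef nu kap b * _.
(* The slack is [a * e] from the shift of the threshold by [e], plus [e] from the convergence in
   [cdf_scaling_cvg]. *)
have ub e : 0 < e -> \forall t \near +oo, scaled_tail g t <= L + (a + 1) * e.
  move=> e0.
  have := cdf_scaling_cvg (c := A `^ kap * B + e) nu0 kap0 (se_kap se) H_lo H_hi2 Ap.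
  move=> /cvgrPdist_le/(_ _ e0) h.
  have ls := level_set_sharp se hw g0 e0 Ap.
  near=> t.
  have tp : 0 < t by near: t; apply: nbhs_pinfty_gt; rewrite num_real.
  have ht : scaled_tail g t <= t `^ (1 + kap) * (H ((A + (A `^ kap * B + e) * t `^ (- kap)) / t) - a * A / t).
    rewrite /scaled_tail ler_pM2l ?powR_gt0// lerD2r; apply: F_hi.
    - by near: t; apply: nbhs_pinfty_ge; rewrite num_real.
    - rewrite divr_gt0//; near: t.
      have cy : A + (A `^ kap * B + e) * t `^ (- kap) @[t --> +oo] --> A.
        rewrite -[X in _ --> X]addr0; apply: cvgD; first exact: cvg_cst.
        by rewrite -[X in _ --> X](mulr0 (A `^ kap * B + e)); apply: cvgMr; exact: cvgy_powRN.
      have /cvgrPdist_lt/(_ _ Ap) := cy; apply: filterS => x.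
      by move=> /ltr_normlP[_]; rewrite gtrBl.
    - have lt : forall q, 0 < q -> (t < radial_score nu phi w g q ->
        q * t < A + (A `^ kap * B + e) * t `^ (- kap)) /\
       (q * t < A + (A `^ kap * B - e) * t `^ (- kap) -> t < radial_score nu phi w g q).
        by near: t; exact: ls.
      by move=> q q0 tS; rewrite ltr_pdivlMr//; apply: (lt q q0).1.
  have := near h t; move=> /(_ _)/ler_normlP[|h1 h2]; first by [].
  apply: (le_trans ht); rewrite /L; move: h1 h2; rewrite -/p => h1 h2; lra.
have lb e : 0 < e -> \forall t \near +oo, L - (a + 1) * e <= scaled_tail g t.
  move=> e0.
  have := cdf_scaling_cvg (c := A `^ kap * B - e) nu0 kap0 (se_kap se) H_lo H_hi2 Ap.
  move=> /cvgrPdist_le/(_ _ e0) h.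
  have ls := level_set_sharp se hw g0 e0 Ap.
  near=> t.
  have tp : 0 < t by near: t; apply: nbhs_pinfty_gt; rewrite num_real.
  have ht : t `^ (1 + kap) * (H ((A + (A `^ kap * B - e) * t `^ (- kap)) / t) - a * A / t) <= scaled_tail g t.
    rewrite /scaled_tail ler_pM2l ?powR_gt0// lerD2r; apply: F_lo.
    - by near: t; apply: nbhs_pinfty_ge; rewrite num_real.
    - rewrite divr_gt0//; near: t.
      have cy : A + (A `^ kap * B - e) * t `^ (- kap) @[t --> +oo] --> A.
        rewrite -[X in _ --> X]addr0; apply: cvgD; first exact: cvg_cst.
        by rewrite -[X in _ --> X](mulr0 (A `^ kap * B - e)); apply: cvgMr; exact: cvgy_powRN.
      have /cvgrPdist_lt/(_ _ Ap) := cy; apply: filterS => x.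
      by move=> /ltr_normlP[_]; rewrite gtrBl.
    - have lt : forall q, 0 < q -> (t < radial_score nu phi w g q ->
        q * t < A + (A `^ kap * B + e) * t `^ (- kap)) /\
       (q * t < A + (A `^ kap * B - e) * t `^ (- kap) -> t < radial_score nu phi w g q).
        by near: t; exact: ls.
      by move=> q q0; rewrite ltr_pdivlMr// => qt; apply: (lt q q0).2.
  have := near h t; move=> /(_ _)/ler_normlP[|h1 h2]; first by [].
  apply: le_trans ht; rewrite /L; move: h1 h2; rewrite -/p => h1 h2; lra.
apply/cvgrPdist_le => e e0.
have a10 : 0 < a + 1 by rewrite ltr_wpDl.
have e'0 : 0 < e / (a + 1) by rewrite divr_gt0.
have := ub _ e'0; have := lb _ e'0; apply: filterS2 => t.
by rewrite mulrCA divff ?gt_eqF// mulr1 => h1 h2; rewrite ler_distlC h1 h2.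
Unshelve. all: by end_near. Qed.

End conditional_tail.

(** * Gaussian moments and the chi-square law near the origin *)

Section density.
Local Open Scope ereal_scope.
Import HBSimple HBNNSimple.
Context d (T : measurableType d) (R : realType).
Variables (mu nu : {measure set T -> \bar R}) (p : T -> R).
Hypothesis p0 : forall x, (0 <= p x)%R.
Hypothesis mp : measurable_fun setT p.
Hypothesis nuE : forall A, measurable A -> nu A = \int[mu]_(x in A) (p x)%:E.

Lemma ge0_integral_density (f : T -> \bar R) :
  measurable_fun setT f -> (forall x, 0 <= f x) ->
  \int[nu]_x f x = \int[mu]_x (f x * (p x)%:E).
Proof.
move=> mf f0; pose f_ := nnsfun_approx measurableT mf.
have mfp n : measurable_fun setT (fun x : T => (f_ n x)%:E * (p x)%:E).
  by apply: emeasurable_funM; apply/measurable_EFinP.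
have step n : \int[nu]_x (f_ n x)%:E = \int[mu]_x ((f_ n x)%:E * (p x)%:E).
  rewrite integralT_nnsfun sintegralE.
  under [RHS]eq_integral.
    move=> x _; rewrite fimfunE -fsumEFin// ge0_mule_fsuml; last first.
      by move=> y; rewrite lee_fin; exact: nnfun_muleindic_ge0.
    over.
  rewrite ge0_integral_fsum//=; last 2 first.
  - move=> y; apply: emeasurable_funM; apply/measurable_EFinP => //.
    by apply: measurable_funM.
  - move=> y x _; rewrite mule_ge0 ?lee_fin//.
    by have := nnfun_muleindic_ge0 (f_ n) y x; rewrite lee_fin.
  apply: eq_fsbigr => y; rewrite inE => -[t _ <-{y}].
  have mA : measurable (f_ n @^-1` [set f_ n t]) by exact: measurable_funPTI.
  under eq_integral do rewrite EFinM -muleA.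
  rewrite ge0_integralZl//=.
  - rewrite nuE//; congr (_ * _); rewrite [LHS]integral_mkcond.
    apply: eq_integral => x _; rewrite patchE indicE.
    by case: ifPn => xA; rewrite ?mul1e ?mul0e.
  - by apply: emeasurable_funM; apply/measurable_EFinP.
  - by move=> x _; rewrite mule_ge0 ?lee_fin.
  - by rewrite lee_fin.
transitivity (limn (fun n => \int[nu]_x (f_ n x)%:E)).
  rewrite -monotone_convergence//=.
  - by apply: eq_integral => x _; apply/esym/cvg_lim => //; exact: cvg_nnsfun_approx.
  - by move=> n; apply/measurable_EFinP.
  - by move=> n x _; rewrite lee_fin.
  - by move=> x _ m n mn; rewrite lee_fin; exact/lefP/nd_nnsfun_approx.
under eq_fun do rewrite step.
rewrite -monotone_convergence//=.
- apply: eq_integral => x _; apply/cvg_lim => //; apply: cvgeZr => //.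
  exact: cvg_nnsfun_approx.
- by move=> n x _; rewrite mule_ge0 ?lee_fin.
- move=> x _ m n mn; rewrite lee_wpmul2r ?lee_fin//.
  exact/lefP/nd_nnsfun_approx.
Qed.

End density.

Lemma ge0_integral_law d d' (T : measurableType d) (T' : measurableType d')
    (R : realType) (P : probability T R) (mu : {measure set T' -> \bar R})
    (p : T' -> R) (X : T -> T') :
  (forall x, 0 <= p x) -> measurable_fun setT p -> measurable_fun setT X ->
  (forall A, measurable A -> P (X @^-1` A) = (\int[mu]_(x in A) (p x)%:E)%E) ->
  forall f : T' -> \bar R, measurable_fun setT f -> (forall x, 0 <= f x)%E ->
  (\int[P]_x f (X x) = \int[mu]_x (f x * (p x)%:E))%E.
Proof.
move=> p0 mp mX hX f mf f0.
pose X' : {mfun T >-> T'} := HB.pack X (isMeasurableFun.Build _ _ _ _ X mX).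
have hX' A : measurable A -> distribution P X' A = (\int[mu]_(x in A) (p x)%:E)%E.
  by move=> mA; rewrite -hX.
rewrite -(ge0_integral_density p0 mp hX' mf f0).
by rewrite (ge0_integral_distribution X' mf f0).
Qed.

Section gaussian_moments.
Context {R : realType}.
Notation mu := (@lebesgue_measure R).

(** The indicator removes the default values of [powR] at nonpositive bases. One function then
    covers the positive parts in [A_plus] and [B_plus] and, with s = 0 at the opposite point, the
    indicator in [C_minus]. *)
Definition pos_powR (s x : R) : R := (0 < x)%R%:R * x `^ s.

Lemma pos_powR_ge0 s x : 0 <= pos_powR s x.
Proof. by rewrite mulr_ge0 ?powR_ge0. Qed.

Lemma measurable_pos_powR s : measurable_fun setT (pos_powR s).
Proof.
apply: measurable_funM; last exact: measurable_powR.
rewrite (_ : (fun x : R => (0 < x)%R%:R) = \1_(`]0, +oo[%classic : set R)).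
  exact: measurable_indic.
apply/funext => x; rewrite indicE; congr (_%:R); apply: congr1.
by apply/idP/idP; rewrite inE/= in_itv/= andbT.
Qed.

(** The moment E (g^+)^s of a standard normal g, in closed form for s > -1. *)
Definition half_moment (s : R) : R :=
  (Num.sqrt (2 * pi))^-1 * (2 `^ ((s - 1) / 2) * Gamma ((s + 1) / 2)).

Lemma half_moment_recurrence (s : R) : -1 < s ->
  half_moment (s + 2) = (s + 1) * half_moment s.
Proof.
move=> s1; rewrite /half_moment.
have -> : (s + 2 + 1) / 2 = (s + 1) / 2 + 1 by field.
have -> : (s + 2 - 1) / 2 = (s - 1) / 2 + 1 by field.
rewrite Gamma_add1; last by rewrite divr_gt0// -ltrBlDr sub0r.
rewrite powRD_pos// powRr1//; field.
by rewrite gt_eqF// sqrtr_gt0 mulr_gt0// pi_gt0.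
Qed.

Context d (T : measurableType d) (P : probability T R).

Lemma ge0_integral_std_normal (X : T -> R) (s : R) : measurable_fun setT X ->
  -1 < s ->
  (forall A, measurable A -> P (X @^-1` A) = normal_prob 0 1 A) ->
  (\int[P]_x (pos_powR s (X x))%:E)%E = (half_moment s)%:E.
Proof.
move=> mX s1 hX.
have mf : measurable_fun setT (EFin \o pos_powR s).
  by apply/measurable_EFinP; exact: measurable_pos_powR.
have f0 y : (0 <= (EFin \o pos_powR s) y)%E by rewrite lee_fin pos_powR_ge0.
have h1 (x : R) : 0 <= normal_pdf 0 1 x by exact: normal_pdf_ge0.
have E := @ge0_integral_law _ _ T _ R P mu (normal_pdf 0 1) X h1
    (measurable_normal_pdf _ _) mX hX (EFin \o pos_powR s) mf f0.
rewrite [LHS]E.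
rewrite /half_moment EFinM -integral_gauss_moment//.
rewrite -ge0_integralZl//=; last 2 first.
- apply/measurable_EFinP; apply: measurable_fun_pos_continuous => x x0.
  apply: continuousM; first exact: continuous_powR_pos.
  apply: (@continuous_comp _ _ _ (fun x : R => - (x ^+ 2 / 2)) expR).
    by apply: continuousN; apply: continuousM; [exact: exprn_continuous|exact: cvg_cst].
  exact: continuous_expR.
- by move=> x _; rewrite lee_fin mulr_ge0 ?powR_ge0 ?expR_ge0.
rewrite [RHS]integral_mkcond; apply: eq_integral => x _.
rewrite patchE; case: ifPn => [|/negP h].
  rewrite inE/= in_itv/= andbT => x0.
  rewrite -!EFinM /pos_powR x0 mul1r /normal_pdf oner_eq0 /normal_peak /normal_fun.
  rewrite expr1n mul1r subr0 mulr_natl; congr EFin.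
  by rewrite mulrCA -(mulr_natl 1) mulr1 mulNr.
rewrite /= /pos_powR; case: ltP => [x0|]; last by rewrite mul0r mul0e.
by exfalso; apply: h; rewrite inE/= in_itv/= x0.
Qed.

Lemma integrable_pos_powR (X : T -> R) (s : R) : measurable_fun setT X ->
  -1 < s ->
  (forall A, measurable A -> P (X @^-1` A) = normal_prob 0 1 A) ->
  P.-integrable setT (fun x => (pos_powR s (X x))%:E).
Proof.
move=> mX s1 hX; apply/integrableP; split.
  apply/measurable_EFinP; apply: measurableT_comp => //.
  exact: measurable_pos_powR.
under eq_integral do rewrite gee0_abs ?lee_fin ?pos_powR_ge0//.
by rewrite ge0_integral_std_normal// ltry.
Qed.

End gaussian_moments.

Section chi2.
Context {R : realType}.
Notation mu := (@lebesgue_measure R).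
Variable nu : R.
Hypothesis nu0 : 0 < nu.

(* The distribution function of [(W / nu)^(nu/2)]. *)
Definition radial_cdf (x : R) : R := fine (chi2_law nu `](0:R), nu * x `^ (2 / nu)[).

Lemma integral_powR (s b : R) : 0 < s -> 0 < b ->
  (\int[mu]_(x in `]0%R, b]) (x `^ (s - 1))%:E)%E = (b `^ s / s)%:E.
Proof.
move=> s0 b0.
have dG (x : R) : 0 < x -> is_derive x 1 (fun x => s^-1 * x `^ s) (x `^ (s - 1)).
  move=> x0; apply: is_derive_conv (is_derive_mull _ (is_derive1_powR s x0)) _.
  by rewrite mulrA mulVf ?mul1r// gt_eqF.
rewrite (@ge0_FTC2_0b _ _ _ b 0 _ _ _ dG)//.
- by rewrite subr0 mulrC.
- by move=> x; exact: continuous_powR_pos.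
- by move=> x _; rewrite powR_ge0.
- rewrite -[X in _ --> X](mulr0 s^-1); apply: cvgMr.
  exact: powR_cvg0.
Qed.

(** The quadratic bound follows from exp(y) >= 1 + y and (1 - y + y^2)(1 + y) = 1 + y^3. *)
Lemma expRN_bounds (y : R) : 0 <= y -> 1 - y <= expR (- y) <= Num.min 1 (1 - y + y ^+ 2).
Proof.
move=> y0; have h : 1 - y <= expR (- y) by exact: expR_ge1Dx.
rewrite h le_min expR_le1 oppr_le0 y0/= expRN.
have y1 : 0 < 1 + y by rewrite ltr_wpDr.
apply: (@le_trans _ _ (1 + y)^-1).
  by rewrite lef_pV2 ?posrE ?expR_gt0// expR_ge1Dx.
rewrite -[leLHS]div1r ler_pdivrMr//.
have : 0 <= y ^+ 3 by rewrite exprn_ge0.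
rewrite (_ : (1 - y + y ^+ 2) * (1 + y) = 1 + y ^+ 3); last by ring.
by rewrite lerDl.
Qed.

Let r := nu / 2.
Let r0 : 0 < r. Proof. by rewrite divr_gt0. Qed.

(** The bounds of [expRN_bounds] at y/2 are integrated against y^(r-1). The term of negative sign is
    moved to the other side, so that every integrand is nonnegative and integrals add without
    integrability conditions. *)
Lemma radial_cdf_bounds (x : R) : 0 < x ->
  let w := nu * x `^ (2 / nu) in
  let C := 2 `^ r * Gamma r in
  [/\ chi2_law nu `](0:R), w[ = (radial_cdf x)%:E,
   radial_cdf x <= w `^ r / r / C,
   w `^ r / r / C <= radial_cdf x + w `^ (r + 1) / (r + 1) / 2 / C &
   radial_cdf x + w `^ (r + 1) / (r + 1) / 2 / C <=
     w `^ r / r / C + w `^ (r + 2) / (r + 2) / 4 / C].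
Proof.
move=> x0 w C.
have w0 : 0 < w by rewrite mulr_gt0// powR_gt0.
have C0 : 0 < C by rewrite mulr_gt0 ?powR_gt0// Gamma_gt0.
pose D : set R := `](0:R), w].
have mD : measurable D by exact: measurable_itv.
pose f (s y : R) : R := y `^ (s - 1) * expR (- (y / 2)).
have D0 y : D y -> 0 < y by rewrite /D/= in_itv/= => /andP[].
have SD : D `<=` `](0:R), +oo[.
  by move=> y /D0 y0; rewrite /= in_itv/= andbT.
have mpow (s : R) : measurable_fun D (fun y : R => y `^ s).
  apply: measurable_funTS; exact: measurable_powR.
have mexp : measurable_fun D (fun y : R => expR (- (y / 2))).
  apply: measurable_funTS; apply: continuous_measurable_fun => y.
  have := @continuous_expRN R 2^-1 y.
  by rewrite (_ : (fun x : R => expR (- (2^-1 * x))) = (fun y : R => expR (- (y / 2))))//;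
    apply/funext => z; rewrite mulrC.
have mf s : measurable_fun D (f s) by apply: measurable_funM; [exact: mpow|exact: mexp].
have f0 (s y : R) : 0 <= f s y by rewrite mulr_ge0 ?powR_ge0 ?expR_ge0.
pose I := (\int[mu]_(y in D) (f r y)%:E)%E.
have Ir : (I <= (w `^ r / r)%:E)%E.
  rewrite -integral_powR//; apply: ge0_le_integral => //=.
  - by move=> y _; rewrite lee_fin.
  - by apply/measurable_EFinP; exact: mf.
  - by apply/measurable_EFinP; exact: mpow.
  - move=> y /D0 y0; rewrite lee_fin -[leRHS]mulr1 ler_wpM2l ?powR_ge0//.
    by rewrite expR_le1 oppr_le0 divr_ge0// ltW.
have I0 : (0 <= I)%E by apply: integral_ge0 => y _; rewrite lee_fin.
have IE : I = (fine I)%:E.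
  by rewrite fineK// ge0_fin_numE// (le_lt_trans Ir)// ltry.
have int2 (s c : R) : 0 < s -> 0 <= c ->
    (\int[mu]_(y in D) (y `^ (s - 1) * c)%:E)%E = (w `^ s / s * c)%:E.
  move=> s0 c0; under eq_integral do rewrite EFinM.
  rewrite ge0_integralZr ?integral_powR//.
  - by apply/measurable_EFinP; exact: mpow.
  - by move=> y _; rewrite lee_fin powR_ge0.
have r10 : 0 < r + 1 by rewrite addr_gt0.
have r20 : 0 < r + 2 by rewrite addr_gt0.
have y20 (y : R) : 0 < y -> 0 <= y / 2 by move=> /ltW y0; rewrite divr_ge0.
have pw1 y : 0 < y -> y `^ (r + 1 - 1) = y `^ (r - 1) * y.
  by move=> y0; rewrite -[X in _ * X]powRr1 ?(ltW y0)// -powRD_pos// subrK addrK.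
have pw2 y : 0 < y -> y `^ (r + 2 - 1) = y `^ (r - 1) * y ^+ 2.
  move=> y0; rewrite -powR_mulrn ?(ltW y0)// -powRD_pos//; congr powR; ring.
have sumE (s c : R) : 0 < s -> 0 <= c -> (I + (w `^ s / s * c)%:E =
    \int[mu]_(y in D) (f r y + y `^ (s - 1) * c)%:E)%E.
  move=> s0 c0; rewrite -int2// -ge0_integralD//=.
  - by move=> y _; rewrite lee_fin.
  - by apply/measurable_EFinP; exact: mf.
  - by move=> y _; rewrite lee_fin mulr_ge0// powR_ge0.
  - by apply/measurable_EFinP; apply: measurable_funM => //; exact: mpow.
have lo : ((w `^ r / r)%:E <= I + (w `^ (r + 1) / (r + 1) * 2^-1)%:E)%E.
  rewrite sumE// -integral_powR//; apply: ge0_le_integral => //=.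
  - by move=> y _; rewrite lee_fin powR_ge0.
  - by apply/measurable_EFinP; exact: mpow.
  - apply/measurable_EFinP; apply: measurable_funD; first exact: mf.
    by apply: measurable_funM => //; exact: mpow.
  - move=> y /D0 y0; rewrite lee_fin pw1// /f -mulrA -mulrDr.
    rewrite -[leLHS]mulr1 ler_wpM2l ?powR_ge0// -lerBlDr.
    by have /andP[] := @expRN_bounds (y / 2) (y20 y y0).
have hi : (I + (w `^ (r + 1) / (r + 1) * 2^-1)%:E <=
    (w `^ r / r)%:E + (w `^ (r + 2) / (r + 2) * 4^-1)%:E)%E.
  rewrite sumE// -int2// -integral_powR// -ge0_integralD//=; last 4 first.
  - by move=> y _; rewrite lee_fin powR_ge0.
  - by apply/measurable_EFinP; exact: mpow.
  - by move=> y _; rewrite lee_fin mulr_ge0// powR_ge0.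
  - by apply/measurable_EFinP; apply: measurable_funM => //; exact: mpow.
  apply: ge0_le_integral => //=.
  - by move=> y _; rewrite lee_fin addr_ge0// mulr_ge0// powR_ge0.
  - apply/measurable_EFinP; apply: measurable_funD; first exact: mf.
    by apply: measurable_funM => //; exact: mpow.
  - apply/measurable_EFinP; apply: measurable_funD; first exact: mpow.
    by apply: measurable_funM => //; exact: mpow.
  - move=> y /D0 y0; rewrite lee_fin pw1// pw2// /f -!mulrA -mulrDr.
    rewrite -[X in _ <= X + _]mulr1 -mulrDr ler_wpM2l ?powR_ge0//.
    have /andP[_] := @expRN_bounds (y / 2) (y20 y y0).
    rewrite le_min => /andP[_]; lra.
have law : chi2_law nu `](0:R), w[ = (fine I / C)%:E.
  rewrite /chi2_law.
  have -> : `](0:R), w[ `&` `]0%R, +oo[ = `](0:R), w[.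
    by apply/seteqP; split => y /=; rewrite !in_itv/= andbT; [case|move=> /andP[-> ->]].
  (* The right end point is Lebesgue-null; the integrals of powers are taken over the closed
     interval. *)
  rewrite integral_itv_bndo_bndc; last first.
    apply/measurable_EFinP; apply: measurable_funS (mD) _ _.
      by move=> y; rewrite /D /= !in_itv/= => /andP[-> /ltW].
    by apply: measurable_funM => //; exact: mf.
  rewrite EFinM -IE -ge0_integralZr//=.
  - by apply/measurable_EFinP; exact: mf.
  - by move=> y _; rewrite lee_fin.
  - by rewrite lee_fin invr_ge0 ltW.
have rE : radial_cdf x = fine I / C by rewrite /radial_cdf -/w law.
split.
- by rewrite law rE.
- by rewrite rE ler_pM2r ?invr_gt0// -lee_fin -IE.
- by rewrite rE -mulrDl ler_pM2r ?invr_gt0// -lee_fin EFinD -IE.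
- by rewrite rE -!mulrDl ler_pM2r ?invr_gt0// -lee_fin !EFinD -IE.
Qed.

Definition third_coef : R := (nu `^ (r + 2) / (r + 2) / 4) / (2 `^ r * Gamma r).

(** With r = nu/2, the powers r, r + 1, r + 2 of nu x^(2/nu) become x, x^(1+2/nu), x^(1+4/nu) up to
    constants, and Gamma(r+1) = r Gamma(r) identifies the first two coefficients as [a] and
    [a * b]. *)
Lemma radial_cdf_expansion (x : R) : 0 < x ->
  [/\ chi2_law nu `](0:R), nu * x `^ (2 / nu)[ = (radial_cdf x)%:E,
   radial_cdf x <= a_coef nu * x,
   a_coef nu * x - a_coef nu * b_coef nu * x `^ (1 + 2 / nu) <= radial_cdf x &
   radial_cdf x <= a_coef nu * x - a_coef nu * b_coef nu * x `^ (1 + 2 / nu)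
     + third_coef * x `^ (1 + 4 / nu)].
Proof.
move=> x0; have [h1 h2 h3 h4] := radial_cdf_bounds x0.
have C0 : 0 < 2 `^ r * Gamma r by rewrite mulr_gt0 ?powR_gt0// Gamma_gt0.
have G0 : 0 < Gamma r by rewrite Gamma_gt0.
have T0 : 0 < 2 `^ r :> R by rewrite powR_gt0.
have pw s : (nu * x `^ (2 / nu)) `^ s = nu `^ s * x `^ (2 / nu * s).
  by rewrite powRM ?powR_ge0 ?(ltW nu0)// -powRrM.
have e1 : 2 / nu * r = 1 by rewrite /r; field; rewrite gt_eqF.
have e2 : 2 / nu * (r + 1) = 1 + 2 / nu by rewrite mulrDr e1 mulr1.
have e3 : 2 / nu * (r + 2) = 1 + 4 / nu by rewrite mulrDr e1; field; rewrite gt_eqF.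
have aE : a_coef nu = nu `^ r / r / (2 `^ r * Gamma r).
  rewrite /a_coef -/r Gamma_add1//; field; by rewrite !gt_eqF.
have E1 : (nu * x `^ (2 / nu)) `^ r / r / (2 `^ r * Gamma r) = a_coef nu * x.
  by rewrite pw e1 (powRr1 (ltW x0)) aE; ring.
have E2 : (nu * x `^ (2 / nu)) `^ (r + 1) / (r + 1) / 2 / (2 `^ r * Gamma r) =
    a_coef nu * b_coef nu * x `^ (1 + 2 / nu).
  rewrite pw e2 aE /b_coef (powRD_pos _ _ nu0) (powRr1 (ltW nu0)).
  set X := x `^ _; set V := nu `^ r; set U := 2 `^ r in T0 *.
  have nu2 : nu = 2 * r by rewrite /r; field.
  have r10 : 0 < r + 1 by rewrite addr_gt0.
  rewrite nu2; field.
  rewrite !gt_eqF//; lra.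
have E3 : (nu * x `^ (2 / nu)) `^ (r + 2) / (r + 2) / 4 / (2 `^ r * Gamma r) =
    third_coef * x `^ (1 + 4 / nu).
  rewrite pw e3 /third_coef; ring.
rewrite E1 in h2 h3 h4; rewrite E2 in h3 h4; rewrite E3 in h4.
split => //; clear -h3 h4; lra.
Qed.

Lemma a_coef_gt0 : 0 < a_coef nu.
Proof. by rewrite divr_gt0 ?powR_gt0// mulr_gt0 ?powR_gt0// Gamma_gt0// addr_gt0// divr_gt0. Qed.

Lemma b_coef_gt0 : 0 < b_coef nu.
Proof. by rewrite divr_gt0 ?exprn_gt0// mulr_gt0// addr_gt0. Qed.

Lemma k_coef_gt0 : 0 < k_coef nu.
Proof.
rewrite divr_gt0// mulr_gt0 ?powR_gt0 ?Gamma_gt0 ?divr_gt0 ?sqrtr_gt0 ?pi_gt0//.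
exact: addr_gt0.
Qed.

Lemma half_moment_nu : a_coef nu * half_moment nu = k_coef nu.
Proof.
rewrite /a_coef /half_moment /k_coef Gamma_add1 ?divr_gt0//.
have G1 : 0 < Gamma ((nu + 1) / 2) by rewrite Gamma_gt0// divr_gt0// addr_gt0.
have G0 : 0 < Gamma (nu / 2) by rewrite Gamma_gt0.
have T0 : 0 < 2 `^ (nu / 2) :> R by rewrite powR_gt0.
rewrite sqrtrM//.
have s2 : 0 < Num.sqrt 2 :> R by rewrite sqrtr_gt0.
have sp : 0 < Num.sqrt pi :> R by rewrite sqrtr_gt0 pi_gt0.
have -> : 2 `^ ((nu - 1) / 2) = 2 `^ (nu / 2) / Num.sqrt 2 :> R.
  rewrite -powR12_sqrt// -powRN -powRD_pos//; by congr powR; field.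
have -> : nu `^ (nu / 2 - 1) = nu `^ (nu / 2) / nu.
  by rewrite powRD_pos// powR_inv1// ltW.
have ss : Num.sqrt 2 * Num.sqrt 2 = 2 :> R by rewrite -expr2 sqr_sqrtr.
set V := nu `^ _; set U := 2 `^ _ in T0 *; set S := Num.sqrt 2 in s2 ss *.
set p := Num.sqrt pi in sp *; set g1 := Gamma _ in G1 *; set g0 := Gamma _ in G0 *.
transitivity (2 * V * g1 / (S * S) / (p * g0 * nu)).
  by field; rewrite !gt_eqF.
by rewrite ss; field; rewrite !gt_eqF.
Qed.

End chi2.

(** * Conditioning on the Gaussian vector *)

Section powR_sums.
Context {R : realType}.

Lemma powR_add_le (r x y : R) : 0 <= r -> 0 <= x -> 0 <= y ->
  (x + y) `^ r <= 2 `^ r * (x `^ r + y `^ r).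
Proof.
move=> r0 x0 y0; wlog xy : x y x0 y0 / x <= y.
  by move=> h; have [/h|/ltW/h] := leP x y; [exact|rewrite addrC [x `^ r + _]addrC; exact].
apply: (@le_trans _ _ ((2 * y) `^ r)).
  by apply: le_powR => //; [exact: addr_ge0|rewrite mulr_natl mulr2n lerD2r].
by rewrite powRM// ler_wpM2l ?powR_ge0// lerDr powR_ge0.
Qed.

(** Bounding a sum of two terms by twice the larger one avoids convexity, so exponents below and
    above 1 are treated alike. *)
Lemma powR_sum_le m (r : R) : 0 < r -> exists2 C, 0 <= C &
  forall x : 'I_m -> R, (forall i, 0 <= x i) ->
  (\sum_i x i) `^ r <= C * \sum_i x i `^ r.
Proof.
move=> r0; elim: m => [|m [C C0 IH]].
  by exists 0 => // x _; rewrite !big_ord0 mul0r powR0 ?gt_eqF.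
exists (2 `^ r * (1 + C)); first by rewrite mulr_ge0 ?powR_ge0 ?addr_ge0.
move=> x x0; rewrite !big_ord_recl.
apply: le_trans (powR_add_le (ltW r0) (x0 _) _) _; first by apply: sumr_ge0.
rewrite -mulrA ler_wpM2l ?powR_ge0// mulrDl mul1r; apply: lerD.
  by rewrite lerDl sumr_ge0// => i _; exact: powR_ge0.
apply: le_trans (IH (fun i => x (lift ord0 i)) (fun i => x0 _)) _.
by rewrite ler_wpM2l// lerDr powR_ge0.
Qed.

Lemma young_powR (e s x y p q : R) : 0 <= x -> 0 <= y -> 1 <= p -> 1 <= q ->
  p^-1 + q^-1 = 1 -> x `^ e * y `^ s <= x `^ (e * p) + y `^ (s * q).
Proof.
move=> x0 y0 p1 q1 pq.
have p0 : 0 < p by exact: lt_le_trans p1.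
have q0 : 0 < q by exact: lt_le_trans q1.
apply: le_trans (conjugate_powR (powR_ge0 _ _) (powR_ge0 _ _) p0 q0 pq) _.
rewrite -!powRrM; apply: lerD.
  by rewrite ler_pdivrMr// ler_peMr// powR_ge0.
by rewrite ler_pdivrMr// ler_peMr// powR_ge0.
Qed.

End powR_sums.

Section gaussian_vector_moments.
Context {R : realType} {m : nat} (Rho : 'M[R]_m).
Hypothesis hRho : correlation_matrix Rho.
Context {d : measure_display} {Om : measurableType d} (Q : probability Om R).
Variable G : {RV Q >-> m.-tuple R}.
Hypothesis hG : gaussian_vector Rho G.

Definition coords (x : Om) : 'I_m -> R := fun i => tnth (G x) i.

Lemma measurable_coord i : measurable_fun setT (fun x => coords x i).
Proof. by apply: (measurableT_comp (measurable_tnth i)). Qed.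

(** Taking c = 1 and c = -1 gives the laws of a coordinate and of its opposite, hence the moments of
    both of its parts. *)
Lemma coord_law (c : R) i (A : set R) : c ^+ 2 = 1 -> measurable A ->
  Q ((fun x => c * coords x i) @^-1` A) = normal_prob 0 1 A.
Proof.
move=> c1 mA; have [_ Rii _] := hRho.
pose a : 'rV[R]_m := \row_j (c * (j == i)%:R).
have ai : a 0 i = c by rewrite mxE eqxx mulr1.
have aj j : j != i -> a 0 j = 0 by move=> /negbTE ji; rewrite mxE ji mulr0.
have := hG a mA.
have -> : (a *m Rho *m a^T) 0 0 = 1.
  rewrite mxE (bigD1 i)//= big1 ?addr0; last first.
    by move=> j /aj; rewrite [a^T _ _]mxE => ->; rewrite mulr0.
  rewrite [a^T _ _]mxE ai mxE (bigD1 i)//= big1 ?addr0; last first.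
    by move=> j /aj ->; rewrite mul0r.
  by rewrite ai Rii mulr1 -expr2.
rewrite /centered_normal oner_eq0 sqrtr1 => <-.
congr (Q _); apply/seteqP; split => x /=.
  by rewrite (bigD1 i)//= big1 ?addr0 ?ai// => j /aj ->; rewrite mul0r.
by rewrite (bigD1 i)//= big1 ?addr0 ?ai// => j /aj ->; rewrite mul0r.
Qed.

Lemma measurable_signed_coord (c : R) i : measurable_fun setT (fun x => c * coords x i).
Proof. by apply: measurable_funM => //; exact: measurable_coord. Qed.

Lemma integral_signed_moment (c s : R) i : c ^+ 2 = 1 -> -1 < s ->
  (\int[Q]_x (pos_powR s (c * coords x i))%:E)%E = (half_moment s)%:E.
Proof.
move=> c1 s1; apply: (ge0_integral_std_normal (measurable_signed_coord c i) s1).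
by move=> A mA; exact: coord_law.
Qed.

Lemma integrable_signed_moment (c s : R) i : c ^+ 2 = 1 -> -1 < s ->
  Q.-integrable setT (fun x => (pos_powR s (c * coords x i))%:E).
Proof.
move=> c1 s1; apply: (integrable_pos_powR (measurable_signed_coord c i) s1).
by move=> A mA; exact: coord_law.
Qed.

Lemma coord_neq0 : {ae Q, forall x, forall i, coords x i != 0}.
Proof.
apply: (@filter_forall _ _ (fun i => [set x | coords x i != 0])
  (almost_everywhere Q) (ae_filter_ringOfSetsType Q)) => i.
have m0 : measurable [set (0:R)] by exact: measurable_set1.
exists [set x | coords x i = 0]; split.
- have := measurable_coord i; move=> /(_ measurableT _ m0); rewrite setTI.
  by congr measurable.
- have := @coord_law 1 i _ (expr1n _ _) m0.
  rewrite (_ : _ @^-1` _ = [set x | coords x i = 0]); last first.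
    by apply/seteqP; split => x /=; rewrite mul1r.
  by move=> ->; rewrite /normal_prob integral_set1.
- by move=> x /= /negP; rewrite negbK => /eqP.
Qed.

Lemma integrable_abs_powR (s : R) i : -1 < s ->
  Q.-integrable setT (fun x => (`|coords x i| `^ s)%:E).
Proof.
move=> s1; have i1 := @integrable_signed_moment 1 s i (expr1n _ _) s1.
have i2 := @integrable_signed_moment (-1) s i (sqrr_sign _ 1%N) s1.
(* The constant is there for s = 0, where |x|^s is 1 at x = 0 while both one-sided powers vanish. *)
have i3 : Q.-integrable setT (fun=> 1%:E) by exact: finite_measure_integrable_cst.
apply: le_integrable (integrableD measurableT (integrableD measurableT i1 i2) i3) => //.
  apply/measurable_EFinP; apply: (measurableT_comp (measurable_powR s)).
  by apply: measurableT_comp => //; exact: measurable_coord.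
move=> x _; rewrite /= lee_fin [leLHS]ger0_norm ?powR_ge0// [X in _ <= X]ger0_norm; last first.
  by rewrite !addr_ge0// pos_powR_ge0.
rewrite mul1r mulN1r /pos_powR oppr_gt0.
have [x0|x0|->] := ltgtP (coords x i) 0.
- by rewrite mul0r add0r mul1r ltr0_norm// lerDl.
- by rewrite mul1r mul0r addr0 gtr0_norm// lerDl.
- rewrite normr0 !mul0r !add0r; have [->|s0] := eqVneq s 0.
    by rewrite powRr0.
  by rewrite powR0.
Qed.

(** Young's inequality separates the two coordinates, so only one-dimensional moments occur; no
    joint density is involved and a singular [Rho] causes no difficulty. *)
Lemma integrable_powR_prod (e s : R) i j : -1 < e -> 0 <= s ->
  Q.-integrable setT (fun x => (`|coords x i| `^ e * `|coords x j| `^ s)%:E).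
Proof.
move=> e1 s0.
(* For e < 0 the exponent [p] must stay below -1/e. The choice p = 2/(1-e) gives e p = 2e/(1-e),
   which exceeds -1 exactly when e does, with conjugate q = 2/(1+e). *)
have [p [q [p1 q1 pq ep]]] : exists p q : R, [/\ 1 <= p, 1 <= q, p^-1 + q^-1 = 1 & -1 < e * p].
  have [e0|e0] := leP 0 e.
    exists 2, 2; split; rewrite ?ler1n//; first by field.
    by rewrite (lt_le_trans (ltrN10 _))// mulr_ge0.
  exists (2 / (1 - e)), (2 / (1 + e)).
  have h1 : 0 < 1 - e by rewrite subr_gt0 (lt_trans e0).
  have h2 : 0 < 1 + e by rewrite -ltrBlDl sub0r.
  split.
  - by rewrite ler_pdivlMr// mul1r; lra.
  - by rewrite ler_pdivlMr// mul1r; lra.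
  - by field; rewrite !gt_eqF.
  - by rewrite mulrA ltr_pdivlMr//; lra.
have sq : -1 < s * q by rewrite (lt_le_trans (ltrN10 _))// mulr_ge0// (le_trans _ q1).
have I1 := integrable_abs_powR i ep; have I2 := integrable_abs_powR j sq.
apply: le_integrable (integrableD measurableT I1 I2) => //.
  apply/measurable_EFinP; apply: measurable_funM.
    apply: (measurableT_comp (measurable_powR e)).
    by apply: measurableT_comp => //; exact: measurable_coord.
  apply: (measurableT_comp (measurable_powR s)).
  by apply: measurableT_comp => //; exact: measurable_coord.
move=> x _; rewrite /= lee_fin [leLHS]ger0_norm ?mulr_ge0 ?powR_ge0//.
by rewrite [X in _ <= X]ger0_norm ?addr_ge0 ?powR_ge0// young_powR.
Qed.

End gaussian_vector_moments.

(** * The Gaussian scale mixture conditioned on its Gaussian part *)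

Section mixture.
Context {R : realType} {m : nat}.
Context {d : measure_display} {Om : measurableType d} (Q : probability Om R).
Variables (G : {RV Q >-> m.-tuple R}) (W : {RV Q >-> R}) (nu : R).
Hypothesis hW : chi2_variable nu W.
Hypothesis hGW : independent_RV G W.
Hypothesis nu0 : 0 < nu.
Variables (w : 'I_m -> R) (phi : R -> R).
Hypothesis hw : simplex_weights w.
Hypothesis mphi : measurable_fun setT phi.

Definition mix_score (g : 'I_m -> R) (y : R) : R :=
  wsum w (fun z => phi (Num.sqrt (nu / y) * z)) g.

Definition cond_tail (g : 'I_m -> R) (t : R) : R :=
  fine (Q [set x | t < mix_score g (W x)]).

Lemma measurable_mix_score :
  measurable_fun setT (fun z : m.-tuple R * R => mix_score (tnth z.1) z.2).
Proof.
apply: measurable_sum => i; apply: measurable_funM => //.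
apply: measurableT_comp => //; apply: measurable_funM; last first.
  apply: (measurableT_comp (measurable_tnth i)); exact: measurable_fst.
apply: (@measurableT_comp _ _ _ _ _ _ (fun y : R => Num.sqrt (nu / y))) => //.
  apply: measurableT_comp.
    apply: continuous_measurable_fun; exact: sqrt_continuous.
  apply: measurable_funM => //.
  (* Splitting the inverse by sign expresses it, including its default 0 at 0, through measurable
     one-sided powers. *)
  rewrite (_ : GRing.inv = fun y : R => (0 < y)%R%:R * y `^ (-1) - (0 < - y)%R%:R * (- y) `^ (-1)).
    apply: measurable_funB; first exact: measurable_pos_powR.
    by apply: (measurableT_comp (measurable_pos_powR (-1))).
  apply/funext => y; rewrite oppr_gt0; have [y0|y0|->] := ltgtP y 0.
  - by rewrite mul0r sub0r mul1r powR_inv1 ?oppr_ge0 ?(ltW y0)// invrN opprK.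
  - by rewrite mul1r mul0r subr0 powR_inv1// ltW.
  - by rewrite !mul0r subr0 invr0.
Qed.

Lemma measurable_mix_event (g : 'I_m -> R) t :
  measurable [set x | t < mix_score g (W x)].
Proof.
have mf : measurable_fun setT (fun x => mix_score g (W x)).
  rewrite (_ : (fun x => _) = (fun z : m.-tuple R * R => mix_score (tnth z.1) z.2)
     \o (fun x => ([tuple g i | i < m], W x))).
    apply: measurableT_comp; first exact: measurable_mix_score.
    exact: measurable_fun_pair.
  apply/funext => x; apply: eq_bigr => i _ /=; by rewrite tnth_mktuple.
have := mf measurableT `]t, +oo[%classic (measurable_itv _).
rewrite setTI; congr measurable; apply/seteqP.
by split => x /=; rewrite in_itv/= andbT.
Qed.

Lemma cond_tailE g t : Q [set x | t < mix_score g (W x)] = (cond_tail g t)%:E.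
Proof. by rewrite fineK// fin_num_measure//; exact: measurable_mix_event. Qed.

Lemma cond_tail_ge0 g t : 0 <= cond_tail g t.
Proof. exact: fine_ge0. Qed.

Lemma cond_tail_le1 g t : cond_tail g t <= 1.
Proof. by rewrite -lee_fin -cond_tailE probability_le1//; exact: measurable_mix_event. Qed.

Definition joint_event t : set (m.-tuple R * R) :=
  [set z | t < mix_score (tnth z.1) z.2].

Lemma measurable_joint_event t : measurable (joint_event t).
Proof.
have mf := measurable_mix_score.
have := mf measurableT `]t, +oo[%classic (measurable_itv _).
rewrite setTI; congr measurable; apply/seteqP.
by split => x /=; rewrite in_itv/= andbT.
Qed.

Lemma cond_tail_xsection t (g : m.-tuple R) :
  distribution Q W (xsection (joint_event t) g) = (cond_tail (tnth g) t)%:E.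
Proof.
rewrite -cond_tailE /distribution/= /pushforward; congr (Q _).
by apply/seteqP; split => x /=; rewrite /xsection/= inE.
Qed.

Lemma measurable_cond_tail t :
  measurable_fun setT (fun x => cond_tail (coords G x) t).
Proof.
have h := @measurable_fun_xsection _ _ _ _ _ (distribution Q W) _ (measurable_joint_event t).
have h2 : measurable_fun setT (fun g : m.-tuple R => (cond_tail (tnth g) t)%:E).
  apply: eq_measurable_fun h => g _ /=; exact: cond_tail_xsection.
have /measurable_EFinP h3 := h2.
by apply: (measurableT_comp h3).
Qed.

(** By independence the law of the pair agrees with the product of the two laws on rectangles, hence
    everywhere by uniqueness of the product measure; the sections of the event give the conditional
    tails. *)
Lemma tail_fubini t :
  Q [set x | t < mix_score (coords G x) (W x)] =
  (\int[Q]_x (cond_tail (coords G x) t)%:E)%E.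
Proof.
have mGW : measurable_fun setT (fun x => (G x, W x)) by exact: measurable_fun_pair.
pose GW : {mfun Om >-> (m.-tuple R * R)%type} :=
  HB.pack (fun x => (G x, W x)) (isMeasurableFun.Build _ _ _ _ _ mGW).
have E := @product_measure_unique _ _ _ _ _ (distribution Q G) (distribution Q W)
  (distribution Q GW).
have E' := E (fun A B mA mB => hGW mA mB) _ (measurable_joint_event t).
rewrite -[LHS]E'.
rewrite /product_measure1.
rewrite (@ge0_integral_distribution _ _ _ _ _ Q G
  (fun g => (distribution Q W \o xsection (joint_event t)) g)).
- by apply: eq_integral => x _ /=; rewrite cond_tail_xsection.
- exact: (measurable_fun_xsection (distribution Q W) (measurable_joint_event t)).
- by move=> g; exact: measure_ge0.
Qed.

Lemma sqrt_radius (y q : R) : 0 < y -> q = (y / nu) `^ (nu / 2) ->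
  Num.sqrt (nu / y) = q `^ (- nu^-1).
Proof.
move=> y0 ->; rewrite -powRrM.
have -> : nu / 2 * - nu^-1 = - 2^-1 by field; rewrite gt_eqF.
rewrite -powRV ?divr_gt0// invf_div powR12_sqrt//.
by rewrite divr_ge0// ltW.
Qed.

Lemma mix_score_radial g (y : R) : 0 < y ->
  mix_score g y = radial_score nu phi w g ((y / nu) `^ (nu / 2)).
Proof. by move=> y0; rewrite /mix_score (sqrt_radius y0 erefl). Qed.

(** For y <= 0 the square root takes its default value 0. Such values of W therefore never exceed a
    level t >= [phi 0], which is why [phi 0] plays the role of [t0] in the conditional estimates. *)
Lemma mix_score_nonpos g (y : R) : y <= 0 -> mix_score g y = phi 0.
Proof.
move=> y0; rewrite /mix_score ler0_sqrtr; last first.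
  by rewrite mulr_ge0_le0 ?(ltW nu0)// invr_le0.
rewrite -[RHS](wsum_const hw (phi 0) g).
by apply: eq_bigr => i _; rewrite mul0r.
Qed.

Lemma radius_lt (y x : R) : 0 < y -> 0 < x ->
  ((y / nu) `^ (nu / 2) < x) = (y < nu * x `^ (2 / nu)).
Proof.
move=> y0 x0; have h : nu / 2 * (2 / nu) = 1 by field; rewrite gt_eqF.
have yn : 0 < y / nu by rewrite divr_gt0.
have p2 : 0 < 2 / nu by rewrite divr_gt0.
have p3 : 0 < nu / 2 by rewrite divr_gt0.
apply/idP/idP => hlt.
  have := lt_powR p2 (powR_ge0 _ _) hlt.
  by rewrite -powRrM h powRr1 ?(ltW yn)// ltr_pdivrMr// mulrC.
have : y / nu < x `^ (2 / nu) by rewrite ltr_pdivrMr// mulrC.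
move=> /(lt_powR p3 (ltW yn)).
by rewrite -powRrM mulrC -(mulrC (nu / 2)) h powRr1 ?(ltW x0).
Qed.

Lemma chi2_interval (x : R) : 0 < x ->
  Q [set y | 0 < W y < nu * x `^ (2 / nu)] = (radial_cdf nu x)%:E.
Proof.
move=> x0; have [<- _ _ _] := radial_cdf_expansion nu0 x0.
rewrite -hW; last exact: measurable_itv.
by congr (Q _); apply/seteqP; split => y /=; rewrite in_itv.
Qed.

Lemma measurable_chi2_interval (x : R) :
  measurable [set y | 0 < W y < nu * x `^ (2 / nu)].
Proof.
have mW : measurable_fun setT W by [].
have := mW measurableT `](0:R), (nu * x `^ (2 / nu))[%classic (measurable_itv _).
by rewrite setTI; congr measurable.
Qed.

Lemma cond_tail_upper g t x : phi 0 <= t -> 0 < x ->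
  (forall q, 0 < q -> t < radial_score nu phi w g q -> q < x) ->
  cond_tail g t <= radial_cdf nu x.
Proof.
move=> t0 x0 h; rewrite -lee_fin -cond_tailE -chi2_interval//.
apply: le_measure; rewrite ?inE.
- exact: measurable_mix_event.
- exact: measurable_chi2_interval.
- move=> y /= ty; have [y0|y0] := leP (W y) 0.
    by move: ty; rewrite mix_score_nonpos// ltNge t0.
  rewrite /= -radius_lt//; apply: h; last by rewrite -mix_score_radial.
  by rewrite powR_gt0// divr_gt0.
Qed.

Lemma cond_tail_lower g t x : phi 0 <= t -> 0 < x ->
  (forall q, 0 < q -> q < x -> t < radial_score nu phi w g q) ->
  radial_cdf nu x <= cond_tail g t.
Proof.
move=> t0 x0 h; rewrite -lee_fin -cond_tailE -chi2_interval//.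
apply: le_measure; rewrite ?inE.
- exact: measurable_chi2_interval.
- exact: measurable_mix_event.
- move=> y /= /andP[y0 yx]; rewrite mix_score_radial//; apply: h.
    by rewrite powR_gt0// divr_gt0.
  by rewrite radius_lt.
Qed.

Lemma cond_tail_empty g t : phi 0 <= t ->
  (forall q, 0 < q -> radial_score nu phi w g q <= t) -> cond_tail g t = 0.
Proof.
move=> t0 h; rewrite /cond_tail (_ : [set _ | _] = set0) ?measure0//.
apply/seteqP; split => // y /=; apply/negP; rewrite -leNgt.
have [y0|y0] := leP (W y) 0; first by rewrite mix_score_nonpos.
by rewrite mix_score_radial//; apply: h; rewrite powR_gt0// divr_gt0.
Qed.

End mixture.

(** A function homogeneous under positive scalings is determined by its values at 1, -1 and 0. *)
Lemma homogeneous_bound {R : realType} (f : R -> R) (r : R) :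
  (forall u z, 0 < u -> f (u * z) = u `^ r * f z) ->
  exists2 C, 0 <= C & forall z, `|f z| <= C * `|z| `^ r.
Proof.
move=> hf; exists (`|f 1| + `|f (-1)| + `|f 0|); first by rewrite !addr_ge0.
move=> z; have [z0|z0|->] := ltgtP z 0.
- have -> : f z = `|z| `^ r * f (-1).
    by rewrite -hf ?normr_gt0 ?lt_eqF// ltr0_norm// mulrN1 opprK.
  rewrite normrM ger0_norm ?powR_ge0// mulrC ler_wpM2r ?powR_ge0//.
  by rewrite [X in X + _]addrC -addrA lerDl addr_ge0.
- have -> : f z = `|z| `^ r * f 1 by rewrite -hf ?normr_gt0 ?gt_eqF// gtr0_norm// mulr1.
  rewrite normrM ger0_norm ?powR_ge0// mulrC ler_wpM2r ?powR_ge0//.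
  by rewrite -addrA lerDl addr_ge0.
- have [->|r0] := eqVneq r 0.
    by rewrite powRr0 mulr1 lerDr addr_ge0.
  (* Scaling by 2 gives f 0 = 2^r f 0, and 2^r differs from 1 when r is nonzero. *)
  have -> : f 0 = 0.
    have := hf 2 0 (ltr0Sn R 1); rewrite mulr0 => /eqP.
    rewrite -subr_eq0 -[X in X - _]mul1r -mulrBl mulf_eq0 => /orP[|/eqP//].
    rewrite subr_eq0 eq_sym powR_eq1 (negbTE r0) orbF => /orP[].
      by rewrite gt_eqF// ltr1n.
    by rewrite ltNge ler0n.
  by rewrite normr0 mulr_ge0 ?powR_ge0// !addr_ge0.
Qed.

Section integrable_functions.
Context {R : realType} {d : measure_display} {Om : measurableType d} (Q : probability Om R).

Definition intble (h : Om -> R) := Q.-integrable setT (EFin \o h).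

Lemma intbleD h1 h2 : intble h1 -> intble h2 -> intble (fun x => h1 x + h2 x).
Proof. by move=> i1 i2; apply: eq_integrable (integrableD measurableT i1 i2). Qed.

Lemma intbleZ c h : intble h -> intble (fun x => c * h x).
Proof. by move=> i1; apply: eq_integrable (integrableZl measurableT c i1). Qed.

Lemma intbleB h1 h2 : intble h1 -> intble h2 -> intble (fun x => h1 x - h2 x).
Proof. by move=> i1 i2; apply: eq_integrable (integrableB measurableT i1 i2). Qed.

Lemma intble_sum m (h : 'I_m -> Om -> R) : (forall i, intble (h i)) ->
  intble (fun x => \sum_i h i x).
Proof.
move=> hi; apply: eq_integrable (integrable_sum measurableT (index_enum 'I_m) (P := xpredT) (fun i _ => hi i)) => //.
by move=> x _; rewrite /= sumEFin.
Qed.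

Lemma intble_le (h1 h2 : Om -> R) : measurable_fun setT h1 -> (forall x, `|h1 x| <= h2 x) ->
  intble h2 -> intble h1.
Proof.
move=> mh h12; apply: le_integrable => //; first exact/measurable_EFinP.
by move=> x _; rewrite /= lee_fin (le_trans (h12 x))// ler_norm.
Qed.

Lemma intble_fin h : intble h -> (\int[Q]_x (h x)%:E)%E = (fine 'E_Q[h])%:E.
Proof.
move=> hi; rewrite unlock fineK//.
exact: integrable_fin_num hi.
Qed.

Lemma expB h1 h2 : intble h1 -> intble h2 ->
  fine 'E_Q[fun x => h1 x - h2 x] = fine 'E_Q[h1] - fine 'E_Q[h2].
Proof. by move=> i1 i2; rewrite unlock; exact: RintegralB. Qed.

Lemma expD h1 h2 : intble h1 -> intble h2 ->
  fine 'E_Q[fun x => h1 x + h2 x] = fine 'E_Q[h1] + fine 'E_Q[h2].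
Proof. by move=> i1 i2; rewrite unlock; exact: RintegralD. Qed.

Lemma expZ c h : intble h -> fine 'E_Q[fun x => c * h x] = c * fine 'E_Q[h].
Proof. by move=> i1; rewrite unlock; exact: RintegralZl. Qed.

Lemma exp_sum m (h : 'I_m -> Om -> R) : (forall i, intble (h i)) ->
  fine 'E_Q[fun x => \sum_i h i x] = \sum_i fine 'E_Q[h i].
Proof.
move=> hi; apply: EFin_inj; rewrite -intble_fin; last exact: intble_sum.
under eq_integral do rewrite -sumEFin.
rewrite integral_sum//=.
by rewrite -sumEFin; apply: eq_bigr => i _; rewrite intble_fin.
Qed.

End integrable_functions.

(** * Integration of the conditional expansion over the Gaussian vector *)

Section tail_expansion.
Context {R : realType} {m : nat} (Rho : 'M[R]_m).
Hypothesis hRho : correlation_matrix Rho.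
Context {d : measure_display} {Om : measurableType d} (Q : probability Om R).
Variables (G : {RV Q >-> m.-tuple R}) (W : {RV Q >-> R}) (nu : R).
Hypothesis hG : gaussian_vector Rho G.
Hypothesis hW : chi2_variable nu W.
Hypothesis hGW : independent_RV G W.
Variables (w : 'I_m -> R) (kap : R) (phi N M : R -> R).
Hypothesis hw : simplex_weights w.
Hypothesis se : score_expansion nu kap phi N M.
Notation rho := (nu * (1 - kap)).
Notation e1 := (Num.min 0 (nu * (1 - kap))).

Let nu0 : 0 < nu := se_nu se.
Let A x := wsum w N (coords G x).
Let B x := wsum w M (coords G x).

Lemma measurable_wsum (f : R -> R) : measurable_fun setT f ->
  measurable_fun setT (fun x => wsum w f (coords G x)).
Proof.
move=> mf; apply: measurable_sum => i; apply: measurable_funM => //.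
by apply: (measurableT_comp mf); exact: measurable_coord.
Qed.

Let A0 x : 0 <= A x. Proof. by apply: (wsum_ge0 hw); exact: se_N0 se. Qed.

Let mA : measurable_fun setT A.
Proof. by apply: measurable_wsum; exact: se_mN se. Qed.

Let mB : measurable_fun setT B.
Proof. by apply: measurable_wsum; exact: se_mM se. Qed.

Let mAr r : measurable_fun setT (fun x => A x `^ r).
Proof. by apply: (measurableT_comp (measurable_powR r)). Qed.

Let mcr (r : R) i : measurable_fun setT (fun x => `|coords G x i| `^ r).
Proof.
apply: (measurableT_comp (measurable_powR r)).
by apply: measurableT_comp => //; exact: measurable_coord.
Qed.

Let w_le1 i : w i <= 1.
Proof. by rewrite -hw.2 (bigD1 i)//= lerDl sumr_ge0// => j _; exact: hw.1. Qed.

Lemma wsumN_powR_le r : 0 < r -> exists2 C, 0 <= C & forall x,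
  A x `^ r <= C * \sum_j `|coords G x j| `^ (nu * r).
Proof.
move=> r0; have [CN CN0 hN] := homogeneous_bound (se_homN se).
have [C C0 hC] := powR_sum_le m r0.
exists (C * CN `^ r); first by rewrite mulr_ge0// powR_ge0.
move=> x; apply: (@le_trans _ _ ((\sum_j CN * `|coords G x j| `^ nu) `^ r)).
  apply: le_powR => //; first exact: ltW.
  apply: ler_sum => j _; apply: (@le_trans _ _ (N (coords G x j))).
    by rewrite ler_piMl// (se_N0 se).
  by apply: le_trans (hN _); exact: ler_norm.
apply: le_trans (hC _ _) _; first by move=> j; rewrite mulr_ge0// powR_ge0.
rewrite -mulrA ler_wpM2l// mulr_sumr; apply: ler_sum => j _.
by rewrite powRM ?powR_ge0// -powRrM.
Qed.

Lemma intble_A r : 0 < r -> intble Q (fun x => A x `^ r).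
Proof.
move=> r0; have [C C0 hC] := wsumN_powR_le r0.
apply: (intble_le (mAr r) (h2 := fun x => C * \sum_j `|coords G x j| `^ (nu * r))).
  by move=> x; rewrite ger0_norm ?powR_ge0.
apply: intbleZ; apply: intble_sum => j.
apply: (integrable_abs_powR hRho hG).
by rewrite (lt_trans (ltrN10 _))// mulr_gt0.
Qed.

Lemma intble_coord_A e r i : -1 < e -> 0 < r ->
  intble Q (fun x => `|coords G x i| `^ e * A x `^ r).
Proof.
move=> e10 r0; have [C C0 hC] := wsumN_powR_le r0.
apply: (intble_le (h2 := fun x => C * \sum_j `|coords G x i| `^ e * `|coords G x j| `^ (nu * r))).
- by apply: measurable_funM; [exact: mcr|exact: mAr].
- move=> x; rewrite ger0_norm ?mulr_ge0 ?powR_ge0//.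
  by rewrite -mulr_sumr mulrCA ler_wpM2l ?powR_ge0.
apply: intbleZ; apply: intble_sum => j.
by apply: (integrable_powR_prod hRho hG) => //; rewrite mulr_ge0// ltW.
Qed.

Lemma intble_AB r : 0 < r -> intble Q (fun x => A x `^ r * B x).
Proof.
move=> r0; have [CM CM0 hM] := homogeneous_bound (se_homM se).
apply: (intble_le (h2 := fun x => CM * \sum_i `|coords G x i| `^ rho * A x `^ r)).
- by apply: measurable_funM; [exact: mAr|exact: mB].
- move=> x; rewrite normrM ger0_norm ?powR_ge0// mulrC -mulr_suml mulrA.
  rewrite ler_wpM2r ?powR_ge0// mulr_sumr.
  apply: le_trans (ler_norm_sum _ _ _) _; apply: ler_sum => i _.
  rewrite normrM ger0_norm ?hw.1//; apply: le_trans (hM _).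
  by rewrite ler_piMl.
apply: intbleZ; apply: intble_sum => i; apply: intble_coord_A => //.
exact: se_rho se.
Qed.

Let a := a_coef nu.
Let b := b_coef nu.
Let F := cond_tail W nu w phi.

Let dom K x := a * gap nu kap w K (2 * K * A x) (coords G x) + a * b * A x `^ (1 + 2 / nu).

Let intble_dom K : 1 <= K -> intble Q (dom K).
Proof.
move=> K1; have K0 : 0 <= 2 * K by rewrite mulr_ge0// (le_trans _ K1).
have r0 : 0 < 1 + 2 / nu by rewrite addr_gt0// divr_gt0.
apply: intbleD; last by apply: intbleZ; exact: intble_A.
apply: intbleZ; apply: intbleZ; apply: intble_sum => i; apply: intbleZ.
have key e r : -1 < e -> 0 < r -> intble Q (fun x => `|coords G x i| `^ e * (2 * K * A x) `^ r).
  move=> e0 r00; have := intbleZ ((2 * K) `^ r) (intble_coord_A i e0 r00).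
  apply: eq_integrable => // x _ /=.
  by congr EFin; rewrite [in RHS]powRM// [in RHS]mulrCA.
apply: intbleD; apply: key.
- exact: e1_gtN1 se.
- by rewrite (lt_le_trans (se_kap0 se))// (kap_le_e1 se).
- exact: se_rho se.
- exact: se_kap0 se.
Qed.

Let intble_F t : intble Q (fun x => F (coords G x) t).
Proof.
apply: (intble_le (h2 := fun=> 1)).
- exact: measurable_cond_tail (se_mphi se) _.
- move=> x; rewrite ger0_norm ?cond_tail_ge0//.
  apply: cond_tail_le1; exact: se_mphi se.
- exact: finite_measure_integrable_cst.
Qed.

Let intble_A1 : intble Q A.
Proof.
have := @intble_A 1 ltr01; apply: eq_integrable => // x _ /=.
by rewrite powRr1.
Qed.

Definition score_tail t : R := fine (Q [set x | t < mix_score nu w phi (coords G x) (W x)]).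

Lemma score_tailE t : score_tail t = fine 'E_Q[fun x => F (coords G x) t].
Proof. by rewrite /score_tail (tail_fubini nu hGW w (se_mphi se)) unlock. Qed.

Lemma exp_scaled_tail t :
  (\int[Q]_x (scaled_tail kap a N w F (coords G x) t)%:E)%E =
  (t `^ (1 + kap) * (score_tail t - a * fine 'E_Q[A] / t))%:E.
Proof.
have I1 := intbleZ (a / t) intble_A1.
have I2 := intbleZ (t `^ (1 + kap)) (intbleB (intble_F t) I1).
rewrite -[LHS](_ : (\int[Q]_x (t `^ (1 + kap) * (F (coords G x) t - a / t * A x))%:E)%E = _); last first.
  by apply: eq_integral => x _; rewrite /scaled_tail -/(A x) (mulrAC a).
rewrite (intble_fin I2) expZ; last exact: (intbleB (intble_F t) I1).
rewrite (expB (intble_F t) I1) (expZ _ intble_A1).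
by rewrite score_tailE (mulrAC a).
Qed.

Theorem score_tail_expansion :
  t `^ (1 + kap) * (score_tail t - a_coef nu * fine 'E_Q[A] / t) @[t --> +oo] -->
  a_coef nu * fine 'E_Q[fun x => A x `^ kap *
     (B x - second_coef nu kap (b_coef nu) * A x `^ (1 + 2 / nu - kap))].
Proof.
(* Dominated convergence applies to sequences, so the limit at +oo is tested along an arbitrary
   sequence tending to +oo. *)
apply/cvg_pinftyP => u hu.
have a0 : 0 <= a by rewrite ltW// a_coef_gt0.
have b0 : 0 <= b by rewrite ltW// b_coef_gt0.
have mphi := se_mphi se.
have H_lo x : 0 < x -> a * x - a * b * x `^ (1 + 2 / nu) <= radial_cdf nu x.
  by move=> /(radial_cdf_expansion nu0)[].
have H_hi x : 0 < x -> radial_cdf nu x <= a * x.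
  by move=> /(radial_cdf_expansion nu0)[].
have H_hi2 x : 0 < x -> radial_cdf nu x <= a * x - a * b * x `^ (1 + 2 / nu) + third_coef nu * x `^ (1 + 4 / nu).
  by move=> /(radial_cdf_expansion nu0)[].
have Fhi := @cond_tail_upper _ _ _ _ _ W nu hW nu0 w phi hw mphi.
have Flo := @cond_tail_lower _ _ _ _ _ W nu hW nu0 w phi mphi.
have Fem := @cond_tail_empty _ _ _ _ _ W nu nu0 w phi hw.
have F0 := @cond_tail_ge0 _ _ _ _ _ W nu w phi.
have [K [K1 _ hdom]] := scaled_tail_dominated se hw a0 b0 H_lo H_hi F0 Fhi Flo Fem.
(* The truncation makes the domination valid for every [n]; it changes only finitely many terms. *)
pose v n := Num.max (u n) (2 * K).
have hv : v n @[n --> \oo] --> +oo.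
  apply/cvgryPge => M0; move/cvgryPge : hu => /(_ M0); apply: filterS => n h.
  by rewrite le_max h.
pose f_ n x := (scaled_tail kap a N w F (coords G x) (v n))%:E.
pose f x := (a * (A x `^ kap * (B x - second_coef nu kap b * A x `^ (1 + 2 / nu - kap))))%:E.
have mf_ n : measurable_fun setT (f_ n).
  apply/measurable_EFinP; apply: measurable_funM => //.
  apply: measurable_funB; first exact: measurable_cond_tail.
  by apply: measurable_funM => //; apply: measurable_funM.
have mf : measurable_fun setT f.
  apply/measurable_EFinP; apply: measurable_funM => //; apply: measurable_funM => //.
  by apply: measurable_funB => //; apply: measurable_funM.
have f_f : {ae Q, forall x, [set: Om] x -> f_ ^~ x @ \oo --> f x}.
  apply: filterS (coord_neq0 hRho hG) => x gx _.
  have := scaled_tail_cvg se hw a0 H_lo H_hi2 Fhi Flo Fem gx.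
  move=> /cvg_pinftyP/(_ v hv) h.
  by apply: cvg_EFin; [exact: nearW|exact: h].
have idom : Q.-integrable setT (EFin \o dom K) by exact: intble_dom.
have f_g : {ae Q, forall x n, [set: Om] x -> (`|f_ n x| <= (EFin \o dom K) x)%E}.
  apply: filterS (coord_neq0 hRho hG) => x gx n _.
  by rewrite /f_ /= lee_fin hdom// /v le_max lexx orbT.
have [If _ cv] := dominated_convergence measurableT mf_ mf f_f idom f_g.
have IL : intble Q (fun x => A x `^ kap * (B x - second_coef nu kap b * A x `^ (1 + 2 / nu - kap))).
  have := intbleZ a^-1 If; apply: eq_integrable => // x _ /=.
  by rewrite mulrA mulVf ?mul1r// gt_eqF// a_coef_gt0.
rewrite -(expZ _ IL).
have h : fine (\int[Q]_x f_ n x)%E @[n --> \oo] --> fine (\int[Q]_x f x)%E.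
  apply: fine_cvg; rewrite fineK; last exact: integrable_fin_num If.
  exact: cv.
have -> : fine 'E_Q[fun x => a_coef nu *
   (A x `^ kap * (B x - second_coef nu kap (b_coef nu) * A x `^ (1 + 2 / nu - kap)))] =
   fine (\int[Q]_x f x)%E by rewrite unlock.
apply: cvg_trans h; apply: near_eq_cvg; near=> n.
rewrite exp_scaled_tail/= /v max_l//.
by near: n; move/cvgryPge : hu; exact.
Unshelve. all: by end_near. Qed.

End tail_expansion.

(** * The tail of the t distribution *)

Section t_distribution.
Context {R : realType}.
Notation mu := (@lebesgue_measure R).
Variable nu : R.
Hypothesis nu0 : 0 < nu.

Let s := (nu + 1) / 2.
Let s0 : 0 < s. Proof. by rewrite divr_gt0// addr_gt0. Qed.

Lemma t_base_gt0 (x : R) : 0 < 1 + x ^+ 2 / nu.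
Proof. by rewrite ltr_pwDl// divr_ge0 ?sqr_ge0// ltW. Qed.

Definition t_const : R := Gamma s / (Num.sqrt (nu * pi) * Gamma (nu / 2)).

Lemma t_const_gt0 : 0 < t_const.
Proof.
rewrite divr_gt0 ?Gamma_gt0// mulr_gt0 ?Gamma_gt0 ?divr_gt0//.
by rewrite sqrtr_gt0 mulr_gt0// pi_gt0.
Qed.

Lemma t_pdf_gt0 x : 0 < t_pdf nu x.
Proof. by rewrite mulr_gt0 ?t_const_gt0// powR_gt0// t_base_gt0. Qed.

Lemma t_pdf_even x : t_pdf nu (- x) = t_pdf nu x.
Proof. by rewrite /t_pdf sqrrN. Qed.

Lemma continuous_t_pdf : continuous (t_pdf nu).
Proof.
move=> x; have h : {for x, continuous (fun x : R => 1 + x ^+ 2 / nu)}.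
  apply: continuousD; first exact: cvg_cst.
  by apply: continuousM; [exact: exprn_continuous|exact: cvg_cst].
have h2 := continuous_comp h (@continuous_powR_pos _ (- s) _ (t_base_gt0 x)).
have h3 : {for x, continuous (fun=> t_const)} by exact: cvg_cst.
exact: (continuousM h3 h2).
Qed.

Lemma measurable_t_pdf : measurable_fun setT (t_pdf nu).
Proof. by apply: continuous_measurable_fun; exact: continuous_t_pdf. Qed.

(** The unnormalised joint density of a t variable and its chi-square mixing variable. *)
Let mix (z : R * R) : R := pos_powR (s - 1) z.2 * expR (- (z.2 * ((1 + z.1 ^+ 2 / nu) / 2))).

Let mix0 z : 0 <= mix z. Proof. by rewrite mulr_ge0 ?pos_powR_ge0 ?expR_ge0. Qed.

Let mmix : measurable_fun setT mix.
Proof.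
apply: measurable_funM.
  by apply: (measurableT_comp (measurable_pos_powR _)); exact: measurable_snd.
apply: measurableT_comp => //; apply: measurableT_comp => //.
apply: measurable_funM; first exact: measurable_snd.
apply: measurable_funM => //; apply: measurable_funD => //.
apply: measurable_funM => //; apply: measurable_funX; exact: measurable_fst.
Qed.

Let integral_posE (f : R -> R) (r : R) :
  (\int[mu]_x (pos_powR r x * f x)%:E = \int[mu]_(x in `]0%R, +oo[) (x `^ r * f x)%:E)%E.
Proof.
rewrite [RHS]integral_mkcond; apply: eq_integral => x _; rewrite patchE.
case: ifPn => [|/negP h].
  by rewrite inE/= in_itv/= andbT /pos_powR => ->; rewrite mul1r.
rewrite /pos_powR; case: ltP => [x0|]; last by rewrite !mul0r.
by exfalso; apply: h; rewrite inE/= in_itv/= x0.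
Qed.

Let mix_w (x : R) : (\int[mu]_y (mix (x, y))%:E)%E =
  (Gamma s * 2 `^ s / t_const * t_pdf nu x)%:E.
Proof.
rewrite integral_posE.
have p0 : 0 < (1 + x ^+ 2 / nu) / 2 by rewrite divr_gt0// t_base_gt0.
rewrite -[LHS](_ : (\int[mu]_(y in `]0%R, +oo[) (y `^ (s - 1) * expR (- ((1 + x ^+ 2 / nu) / 2 * y)))%:E)%E = _); last first.
  by apply: eq_integral => y _; rewrite [_ * y]mulrC.
rewrite integral_gamma_scale//; congr EFin.
rewrite powRM ?invr_ge0 ?(ltW (t_base_gt0 x))// powRV// opprK /t_pdf -/s -/t_const.
by field; rewrite gt_eqF// t_const_gt0.
Qed.

(** For fixed y > 0 the integrand is a multiple of the normal density of variance nu/y; its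
    normalisation lowers the power of y from s - 1 to nu/2 - 1, the chi-square exponent. *)
Let mix_x (y : R) : (\int[mu]_x (mix (x, y))%:E)%E =
  (Num.sqrt (2 * pi * nu) * (pos_powR (nu / 2 - 1) y * expR (- (2^-1 * y))))%:E.
Proof.
rewrite /mix /pos_powR; have [y0|y0] := ltP 0 y; last first.
  rewrite !mul0r mulr0; under eq_integral do rewrite !mul0r.
  by rewrite integral0.
have sg : Num.sqrt (nu / y) != 0 by rewrite gt_eqF// sqrtr_gt0 divr_gt0.
have ss : Num.sqrt (nu / y) ^+ 2 = nu / y by rewrite sqr_sqrtr// divr_ge0// ltW.
have pk0 := normal_peak_gt0 sg.
have E x : y `^ (s - 1) * expR (- (y * ((1 + x ^+ 2 / nu) / 2))) =
   (y `^ (s - 1) * expR (- (2^-1 * y)) / normal_peak (Num.sqrt (nu / y))) * normal_pdf 0 (Num.sqrt (nu / y)) x.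
  rewrite normal_pdfE//.
  rewrite (_ : - (y * ((1 + x ^+ 2 / nu) / 2)) = - (2^-1 * y) + (- (x - 0) ^+ 2 / (Num.sqrt (nu / y) ^+ 2 *+ 2))).
    rewrite expRD /normal_fun -!mulrA; congr (_ * (_ * _)).
    by rewrite mulrA mulVf ?mul1r// gt_eqF.
  rewrite ss subr0 -mulr_natr; field; by rewrite !gt_eqF.
under eq_integral do rewrite /= mul1r E EFinM.
rewrite ge0_integralZl//=; last 3 first.
- by apply/measurable_EFinP; exact: measurable_normal_pdf.
- by move=> x _; rewrite lee_fin normal_pdf_ge0.
- by rewrite lee_fin !mulr_ge0 ?invr_ge0 ?powR_ge0 ?expR_ge0// ltW.
rewrite integral_normal_pdf mule1; congr EFin.
rewrite /normal_peak ss invrK.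
have -> : Num.sqrt (nu / y * pi *+ 2) = Num.sqrt (2 * pi * nu) * y `^ (- 2^-1).
  rewrite -powR12_sqrt; last by rewrite mulrn_wge0// mulr_ge0 ?pi_ge0// divr_ge0// ltW.
  rewrite -powR12_sqrt; last by rewrite !mulr_ge0 ?pi_ge0// ltW.
  rewrite -powRV// -powRM ?invr_ge0 ?(ltW y0)//; last by rewrite !mulr_ge0 ?pi_ge0// ltW.
  by congr powR; rewrite -mulr_natr; ring.
have -> : y `^ (nu / 2 - 1) = y `^ (s - 1) * y `^ (- 2^-1).
  by rewrite -powRD_pos//; congr powR; rewrite /s; field.
by ring.
Qed.

Let LT (c : R) : 0 <= c -> (\int[mu]_x (c%:E * (t_pdf nu x)%:E) =
  c%:E * \int[mu]_x (t_pdf nu x)%:E)%E.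
Proof.
move=> c0; rewrite ge0_integralZl//=.
- by apply/measurable_EFinP; exact: measurable_t_pdf.
- by move=> x _; rewrite lee_fin ltW// t_pdf_gt0.
Qed.

Let LG (c r : R) : 0 <= c ->
  (\int[mu]_y (c%:E * (pos_powR r y * expR (- (2^-1 * y)))%:E) =
   c%:E * \int[mu]_y (pos_powR r y * expR (- (2^-1 * y)))%:E)%E.
Proof.
move=> c0; rewrite ge0_integralZl//=.
- apply/measurable_EFinP; apply: measurable_funM; first exact: measurable_pos_powR.
  by apply: continuous_measurable_fun; exact: continuous_expRN.
- by move=> x _; rewrite lee_fin mulr_ge0 ?pos_powR_ge0 ?expR_ge0.
Qed.

(** Tonelli for [mix]: integrating in y first gives a multiple of the t density, in x first an
    explicit Gamma integral, and that multiple has the same value. *)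
Lemma integral_t_pdf : (\int[mu]_x (t_pdf nu x)%:E)%E = 1%E.
Proof.
have p2 : 0 < nu / 2 by rewrite divr_gt0.
have G1 : 0 < Gamma (nu / 2) by exact: Gamma_gt0.
have G0 : 0 < Gamma s by exact: Gamma_gt0.
have c0 := t_const_gt0.
have T0 : 0 < 2 `^ s :> R by rewrite powR_gt0.
have C10 : 0 < Gamma s * 2 `^ s / t_const by rewrite divr_gt0// mulr_gt0.
have F : (\int[mu]_x \int[mu]_y (mix (x, y))%:E = \int[mu]_y \int[mu]_x (mix (x, y))%:E)%E.
  apply: (@fubini_tonelli _ _ _ _ _ mu mu (fun z => (mix z)%:E)).
  - exact/measurable_EFinP.
  - by move=> z; rewrite lee_fin.
have L : (\int[mu]_x \int[mu]_y (mix (x, y))%:E =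
    (Gamma s * 2 `^ s / t_const)%:E * \int[mu]_x (t_pdf nu x)%:E)%E.
  under eq_integral do rewrite mix_w EFinM.
  exact: LT (ltW C10).
have h2i : 0 < 2^-1 :> R by rewrite invr_gt0.
have L2 : (\int[mu]_y \int[mu]_x (mix (x, y))%:E =
    (Num.sqrt (2 * pi * nu) * (2^-1 `^ (- (nu / 2)) * Gamma (nu / 2)))%:E)%E.
  under eq_integral do rewrite mix_x EFinM.
  rewrite (LG _ (sqrtr_ge0 _)).
  by rewrite integral_posE (integral_gamma_scale p2 h2i) EFinM.
rewrite L L2 in F.
have CE : Num.sqrt (2 * pi * nu) * (2^-1 `^ (- (nu / 2)) * Gamma (nu / 2)) = Gamma s * 2 `^ s / t_const.
  rewrite powRV// opprK /t_const.
  have -> : Num.sqrt (2 * pi * nu) = Num.sqrt 2 * Num.sqrt (nu * pi).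
    by rewrite -sqrtrM//; congr Num.sqrt; ring.
  have -> : 2 `^ s = 2 `^ (nu / 2) * Num.sqrt 2 :> R.
    by rewrite -powR12_sqrt// -powRD_pos//; congr powR; rewrite /s; field.
  have sp : 0 < Num.sqrt (nu * pi) by rewrite sqrtr_gt0 mulr_gt0// pi_gt0.
  by field; rewrite (gt_eqF sp) (gt_eqF G1) (gt_eqF G0).
rewrite CE in F.
have := congr1 (fun z => ((Gamma s * 2 `^ s / t_const)^-1%:E * z)%E) F.
by rewrite muleA -!EFinM mulVf ?gt_eqF// mul1e.
Qed.

Lemma integrable_t_pdf : mu.-integrable setT (EFin \o t_pdf nu).
Proof.
apply/integrableP; split; first by apply/measurable_EFinP; exact: measurable_t_pdf.
under eq_integral do rewrite /= (ger0_norm (ltW (t_pdf_gt0 _))).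
by rewrite integral_t_pdf ltry.
Qed.

Lemma t_cdfE z : (\int[mu]_(x in `]-oo, z]) (t_pdf nu x)%:E)%E = (t_cdf nu z)%:E.
Proof.
rewrite /t_cdf /Rintegral fineK//; apply: integrable_fin_num => //.
by apply: integrableS integrable_t_pdf.
Qed.

Lemma is_derive_t_cdf (z : R) : is_derive z 1 (t_cdf nu) (t_pdf nu z).
Proof.
have zz : z < z + 1 by rewrite ltrDl.
have I : mu.-integrable [set` Interval -oo%O (BRight (z + 1))] (EFin \o t_pdf nu).
  by apply: integrableS integrable_t_pdf.
have [h1 h2] := continuous_FTC1 zz I (ltNyr _) (continuous_t_pdf (x := z)).
by apply: DeriveDef; [exact: h1|rewrite -derive1E; exact: h2].
Qed.

Lemma t_cdf_nondecreasing : nondecreasing_fun (t_cdf nu).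
Proof.
move=> x y xy; rewrite -lee_fin -!t_cdfE; apply: ge0_subset_integral => //=.
- by apply/measurable_EFinP; apply: measurable_funTS; exact: measurable_t_pdf.
- by move=> u _; rewrite lee_fin ltW// t_pdf_gt0.
- by apply: subset_itvl; rewrite bnd_simp.
Qed.

Lemma t_cdf_le1 z : t_cdf nu z <= 1.
Proof.
rewrite -lee_fin -t_cdfE -integral_t_pdf; apply: ge0_subset_integral => //=.
- by apply/measurable_EFinP; exact: measurable_t_pdf.
- by move=> u _; rewrite lee_fin ltW// t_pdf_gt0.
Qed.

Lemma t_cdf_ge0 z : 0 <= t_cdf nu z.
Proof. by apply: Rintegral_ge0 => x _; rewrite ltW// t_pdf_gt0. Qed.

Lemma cvg_t_cdf_y : t_cdf nu z @[z --> +oo] --> (1:R).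
Proof.
have h : (\int[mu]_(x in `]-oo, n%:R]) (t_pdf nu x)%:E)%E @[n --> \oo] --> 1%E.
  rewrite -integral_t_pdf.
  have -> : [set: R] = \bigcup_n `]-oo, n%:R]%classic.
    apply/seteqP; split => // x _; exists (Num.trunc `|x|).+1 => //=.
    by rewrite in_itv/= (le_trans (ler_norm x))// ltW// truncnS_gt.
  apply: ge0_nondecreasing_set_cvg_integral.
  - by move=> m n mn; apply/subsetPset; apply: subset_itvl; rewrite bnd_simp ler_nat.
  - by move=> n; exact: measurable_itv.
  - by move=> n; apply/measurable_EFinP; apply: measurable_funTS; exact: measurable_t_pdf.
  - by move=> n x _; rewrite lee_fin ltW// t_pdf_gt0.
have h2 : t_cdf nu n%:R @[n --> \oo] --> (1:R).
  by apply: cvg_trans (fine_cvg h); apply: near_eq_cvg; apply: nearW => n /=; rewrite t_cdfE.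
apply/cvgrPdist_le => e e0.
have /cvgrPdist_le/(_ _ e0)[n _ /(_ n (leqnn n)) hn] := h2.
near=> z; have zn : n%:R <= z by near: z; apply: nbhs_pinfty_ge; rewrite num_real.
rewrite ger0_norm ?subr_ge0 ?t_cdf_le1//.
rewrite ger0_norm ?subr_ge0 ?t_cdf_le1// in hn.
by apply: le_trans hn; rewrite lerD2l lerN2 t_cdf_nondecreasing.
Unshelve. all: by end_near. Qed.

Lemma t_cdf_compl z : (\int[mu]_(x in `]z, +oo[) (t_pdf nu x)%:E)%E = (1 - t_cdf nu z)%:E.
Proof.
have := integral_t_pdf.
have -> : [set: R] = `]-oo, z]%classic `|` `]z, +oo[%classic.
  by apply/seteqP; split => // x _ /=; rewrite !in_itv/= andbT; case: leP; [left|right].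
rewrite ge0_integral_setU//=.
- by rewrite t_cdfE => h; rewrite EFinB -[1%:E]h addeAC subee// add0e.
- by apply/measurable_EFinP; apply: measurable_funTS; exact: measurable_t_pdf.
- by move=> x _; rewrite lee_fin ltW// t_pdf_gt0.
- apply/disj_setPS => x /= []; rewrite !in_itv/= andbT => h1 h2.
  by move: (lt_le_trans h2 h1); rewrite ltxx.
Qed.

Lemma cvg_t_cdf_Ny : t_cdf nu (- z) @[z --> +oo] --> (0:R).
Proof.
have h : (\int[mu]_(x in `](- n%:R)%R, +oo[) (t_pdf nu x)%:E)%E @[n --> \oo] --> 1%E.
  rewrite -integral_t_pdf.
  have -> : [set: R] = \bigcup_n `]- n%:R, +oo[%classic.
    apply/seteqP; split => // x _; exists (Num.trunc `|x|).+1 => //=.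
    rewrite in_itv/= andbT ltrNl; apply: le_lt_trans (truncnS_gt _).
    by rewrite -normrN ler_norm.
  apply: ge0_nondecreasing_set_cvg_integral.
  - by move=> m n mn; apply/subsetPset; apply: subset_itvr; rewrite bnd_simp lerN2 ler_nat.
  - by move=> n; exact: measurable_itv.
  - by move=> n; apply/measurable_EFinP; apply: measurable_funTS; exact: measurable_t_pdf.
  - by move=> n x _; rewrite lee_fin ltW// t_pdf_gt0.
have h2 : 1 - t_cdf nu (- n%:R) @[n --> \oo] --> (1:R).
  by apply: cvg_trans (fine_cvg h); apply: near_eq_cvg; apply: nearW => n /=; rewrite t_cdf_compl.
apply/cvgrPdist_le => e e0.
have /cvgrPdist_le/(_ _ e0)[n _ /(_ n (leqnn n)) hn] := h2.
near=> z; have zn : n%:R <= z by near: z; apply: nbhs_pinfty_ge; rewrite num_real.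
rewrite sub0r normrN ger0_norm ?t_cdf_ge0//.
rewrite opprB addrC subrK ger0_norm ?t_cdf_ge0// in hn.
by apply: le_trans hn; rewrite t_cdf_nondecreasing// lerN2.
Unshelve. all: by end_near. Qed.

(** The sum of the two values has zero derivative because the density is even, and tends to 1 at
    +oo. *)
Lemma t_cdfN z : t_cdf nu (- z) = 1 - t_cdf nu z.
Proof.
pose S (z : R) := t_cdf nu (- z) + t_cdf nu z.
have dS (x : R) : is_derive x 1 S 0.
  have h1 : is_derive x 1 (fun z : R => t_cdf nu (- z)) (t_pdf nu (- x) * -1).
    exact: (is_derive_compose (is_derive_t_cdf (- x)) (is_deriveNid x 1)).
  apply: is_derive_conv (is_derive_add h1 (is_derive_t_cdf x)) _.
  by rewrite t_pdf_even mulrN1 addNr.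
have cS : S x @[x --> +oo] --> (1:R).
  by rewrite -[X in _ --> X]add0r; apply: cvgD; [exact: cvg_t_cdf_Ny|exact: cvg_t_cdf_y].
have SE x : S x = S z by exact: is_derive_0_is_cst.
have : S z = 1.
  have cS2 : S x @[x --> +oo] --> S z.
    under eq_fun do rewrite SE.
    exact: cvg_cst.
  exact: (cvg_unique (@Rhausdorff R) cS2 cS).
by rewrite /S; lra.
Qed.

End t_distribution.

(** * Elementary inequalities for powers and the cotangent *)

Section real_bounds.
Context {R : realType}.

Lemma is_derive_ext (f g : R -> R) (x a b : R) :
  is_derive x 1 f a -> (forall y, f y = g y) -> a = b -> is_derive x 1 g b.
Proof. by move=> + /funext <- <-. Qed.

(** This compares a tail with its candidate expansion through their derivatives, without an improper
    integral of the expansion. *)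
Lemma ge0_of_derive_le0 (f df : R -> R) :
  (forall x : R, 0 < x -> is_derive x 1 f (df x)) ->
  (forall x, 0 < x -> df x <= 0) ->
  f x @[x --> +oo] --> (0:R) -> forall x, 0 < x -> 0 <= f x.
Proof.
move=> hf df0 f0 x x0; rewrite leNgt; apply/negP => fx.
have /cvgrPdist_lt/(_ (- f x)) := f0; rewrite oppr_gt0 => /(_ fx) h.
near (pinfty_nbhs R) => y.
have xy : x < y by near: y; apply: nbhs_pinfty_gt; rewrite num_real.
have : `|0 - f y| < - f x by near: y.
rewrite sub0r normrN => /ltr_normlP[]; rewrite ltrN2 => + _.
rewrite ltNge => /negP; apply.
rewrite -subr_le0.
have [| |c cxy ->] := @MVT R f df _ _ xy.
- by move=> z; rewrite in_itv/= => /andP[xz _]; apply: hf; exact: lt_trans xz.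
- apply: derivable_within_continuous => z; rewrite in_itv/= => /andP[xz _].
  exact: (@ex_derive _ _ _ _ _ _ _ (hf z (lt_le_trans x0 xz))).
- move: cxy; rewrite in_itv/= => /andP[xc _].
  by rewrite mulr_le0_ge0 ?subr_ge0 ?(ltW xy)// df0// (lt_trans x0).
Unshelve. all: by end_near. Qed.

Lemma ge0_of_derive_ge0 (f df : R -> R) (b : R) :
  (forall x : R, is_derive x 1 f (df x)) ->
  (forall x, 0 <= x <= b -> 0 <= df x) -> f 0 = 0 ->
  forall x, 0 <= x <= b -> 0 <= f x.
Proof.
move=> hf df0 f0 x /andP[x0 xb]; move: x0; rewrite le_eqVlt => /predU1P[<-|x0].
  by rewrite f0.
rewrite -f0 -subr_ge0.
have [|c cxy ->] := MVT x0 (fun z _ => hf z).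
- apply: derivable_within_continuous => z _.
  exact: (@ex_derive _ _ _ _ _ _ _ (hf z)).
- move: cxy; rewrite in_itv/= => /andP[c0 cx].
  by rewrite mulr_ge0 ?subr_ge0 ?(ltW x0)// df0// (ltW c0) (le_trans (ltW cx)).
Qed.

Lemma ln_le_sub1 (y : R) : 0 <= y -> ln (1 + y) <= y.
Proof.
move=> y0; have y1 : 0 < 1 + y by rewrite ltr_wpDr.
by rewrite -ler_expR lnK ?posrE// expR_ge1Dx.
Qed.

Lemma powRN_bernoulli_lo (s y : R) : 0 <= s -> 0 <= y -> 1 - s * y <= (1 + y) `^ (- s).
Proof.
move=> s0 y0; have y1 : 0 < 1 + y by rewrite ltr_wpDr.
rewrite /powR gt_eqF//; apply: (@le_trans _ _ (expR (- (s * y)))).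
  exact: expR_ge1Dx.
by rewrite ler_expR mulNr lerN2 ler_wpM2l// ln_le_sub1.
Qed.

(** Young's inequality for the product of 1 + y and 1, with exponents s and s/(s-1); the case s = 1,
    without a finite conjugate, is an equality. *)
Lemma powR_bernoulli (s y : R) : 1 <= s -> 0 <= y -> 1 + s * y <= (1 + y) `^ s.
Proof.
move=> s1 y0; have s0 : 0 < s by exact: lt_le_trans s1.
have [->|sn1] := eqVneq s 1; first by rewrite mul1r powRr1// addr_ge0.
have s11 : 0 < s - 1 by rewrite subr_gt0 lt_neqAle eq_sym sn1.
have q0 : 0 < s / (s - 1) by rewrite divr_gt0.
have y1 : 0 <= 1 + y by rewrite addr_ge0.
have pq : s^-1 + (s / (s - 1))^-1 = 1 by field; rewrite !gt_eqF.
have := conjugate_powR y1 ler01 s0 q0 pq.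
rewrite powR1 mulr1 -(ler_pM2l s0).
have -> : s * ((1 + y) `^ s / s + 1 / (s / (s - 1))) = (1 + y) `^ s + (s - 1).
  by field; rewrite !gt_eqF.
lra.
Qed.

Lemma powRN_bernoulli_hi (s y : R) : 1 <= s -> 0 <= y ->
  (1 + y) `^ (- s) <= 1 - s * y + (s * y) ^+ 2.
Proof.
move=> s1 y0; have s0 : 0 < s by exact: lt_le_trans s1.
have u0 : 0 <= s * y by rewrite mulr_ge0// ltW.
have h : 0 < 1 + s * y by rewrite ltr_wpDr.
rewrite powRN; apply: (@le_trans _ _ (1 + s * y)^-1).
  have := powR_bernoulli s1 y0 => hb.
  by rewrite lef_pV2 ?posrE// (lt_le_trans h).
rewrite -[leLHS]div1r ler_pdivrMr//.
have : 0 <= (s * y) ^+ 3 by rewrite exprn_ge0.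
rewrite (_ : (1 - s * y + (s * y) ^+ 2) * (1 + s * y) = 1 + (s * y) ^+ 3); last by ring.
by rewrite lerDl.
Qed.

Lemma sin_le_id (x : R) : 0 <= x -> sin x <= x.
Proof.
move=> x0; rewrite -subr_ge0.
apply: (@ge0_of_derive_ge0 (fun x => x - sin x) (fun x => 1 - cos x) x).
- by move=> z _; rewrite subr_ge0 cos_le1.
- by rewrite sin0 subr0.
- by rewrite x0 lexx.
Qed.

Lemma cos_ge (x : R) : 0 <= x -> 1 - x ^+ 2 / 2 <= cos x.
Proof.
move=> x0; rewrite -subr_ge0.
apply: (@ge0_of_derive_ge0 (fun x => cos x - (1 - x ^+ 2 / 2)) (fun x => x - sin x) x).
- move=> z; have h2 := is_derive_mull (2^-1) (is_derive_mul (is_derive_id z 1) (is_derive_id z 1)).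
  have h := is_derive_add (is_derive_cos z) (is_derive_add h2 (is_derive_cst (-1 : R) z 1)).
  apply: is_derive_ext h _ _.
  + by move=> y /=; rewrite /cst expr2; ring.
  + by rewrite /=; field.
- by move=> z /andP[z0 _]; rewrite subr_ge0 sin_le_id.
- by rewrite cos0 expr0n mul0r subr0 subrr.
- by rewrite x0 lexx.
Qed.

Lemma mul_cos_le_sin (x : R) : 0 <= x <= pi -> x * cos x <= sin x.
Proof.
move=> xpi; rewrite -subr_ge0.
apply: (@ge0_of_derive_ge0 (fun x => sin x - x * cos x) (fun x => x * sin x) pi) => //.
- move=> z; have h2 := is_derive_mull (-1) (is_derive_mul (is_derive_id z 1) (is_derive_cos z)).
  apply: is_derive_ext (is_derive_add (is_derive_sin z) h2) _ _.
  + by move=> y /=; rewrite mulN1r.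
  + by rewrite /=; ring.
- by move=> z /andP[z0 zp]; rewrite mulr_ge0// sin_ge0_pi// z0 zp.
- by rewrite sin0 mul0r subr0.
Qed.

Lemma cot_bounds (x : R) : 0 < x <= pi / 2 -> 0 <= cot x <= x^-1.
Proof.
move=> /andP[x0 xp]; have pi0 := @pi_gt0 R.
have xpi : x < pi by apply: le_lt_trans xp _; lra.
have sx : 0 < sin x by rewrite sin_gt0_pi// x0 xpi.
rewrite /cot divr_ge0 ?(ltW sx)//=; last by rewrite cos_ge0_pihalf//; lra.
rewrite ler_pdivrMr// -ler_pdivrMl ?invr_gt0// invrK.
by apply: mul_cos_le_sin; rewrite (ltW x0) (ltW xpi).
Qed.

(** The difference is (sin x - x cos x) / (x sin x). Its numerator is at most x^3/2, since sin x <=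
    x and cos x >= 1 - x^2/2; its denominator is at least x^2/2, since sin x >= x cos x >= x/2. *)
Lemma cot_approx (x : R) : 0 < x <= 1 -> `|cot x - x^-1| <= x.
Proof.
move=> /andP[x0 x1]; have pi2 := @pi_ge2 R.
have xpi : 0 <= x <= pi by rewrite (ltW x0)/=; lra.
have hc := cos_ge (ltW x0); have hs := sin_le_id (ltW x0).
have hm := mul_cos_le_sin xpi.
have x2 : x ^+ 2 <= 1 by rewrite expr_le1// ltW.
have c2 : 2^-1 <= cos x by lra.
have sx : x / 2 <= sin x.
  by apply: le_trans hm; rewrite ler_pM2l.
have sx0 : 0 < sin x by apply: lt_le_trans sx; rewrite divr_gt0.
have h0 : 0 <= x^-1 - cot x.
  by rewrite subr_ge0 /cot ler_pdivrMr// -ler_pdivrMl ?invr_gt0// invrK.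
rewrite distrC ger0_norm// /cot.
have -> : x^-1 - cos x / sin x = (sin x - x * cos x) / (x * sin x).
  by field; rewrite !gt_eqF.
rewrite ler_pdivrMr ?mulr_gt0//.
apply: (@le_trans _ _ (x * (x * (x / 2)))); last first.
  by rewrite ler_pM2l// ler_pM2l.
have : x * (1 - x ^+ 2 / 2) <= x * cos x by rewrite ler_pM2l.
have -> : x * (x * (x / 2)) = x - x * (1 - x ^+ 2 / 2) by ring.
lra.
Qed.

(** The quotient is sin y / cos y, where sin y <= y and cos y >= 1/2. *)
Lemma cot_pihalf_sub (y : R) : 0 <= y <= 1 -> 0 <= cot (pi / 2 - y) <= 2 * y.
Proof.
move=> /andP[y0 y1]; have pi2 := @pi_ge2 R.
have hc := cos_ge y0; have hs := sin_le_id y0.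
have y2 : y ^+ 2 <= 1 by rewrite expr_le1.
have c2 : 2^-1 <= cos y by lra.
have c0 : 0 < cos y by apply: lt_le_trans c2; rewrite invr_gt0.
rewrite /cot cosB sinB cos_pihalf sin_pihalf !mul0r !mul1r add0r subr0.
rewrite divr_ge0 ?(ltW c0)//=; last by rewrite sin_ge0_pi// y0/=; lra.
rewrite ler_pdivrMr//; apply: le_trans hs _.
have : y * 1 <= y * (2 * cos y) by rewrite ler_wpM2l//; lra.
lra.
Qed.

End real_bounds.

(** * Expansion of the upper tail of the t distribution and of its inverse *)

Section t_tail.
Context {R : realType}.
Variable nu : R.
Hypothesis nu1 : 1 < nu.
Let nu0 : 0 < nu. Proof. exact: lt_trans nu1. Qed.

Definition tau (z : R) : R := 1 - t_cdf nu z.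

Let s := (nu + 1) / 2.
Let s1 : 1 <= s. Proof. by rewrite /s ler_pdivlMr// mul1r; move: nu1; lra. Qed.
Let k := k_coef nu.
Let dd := d_coef nu.
Let k0 : 0 < k. Proof. exact: k_coef_gt0. Qed.

Lemma d_coef_gt0 : 0 < d_coef nu.
Proof. by rewrite divr_gt0 ?mulr_gt0 ?exprn_gt0 ?addr_gt0. Qed.

Lemma t_pdf_powR (x : R) : 0 < x ->
  t_pdf nu x = k * nu * x `^ (- nu - 1) * (1 + nu / x ^+ 2) `^ (- s).
Proof.
move=> x0; rewrite /t_pdf -/s.
have x20 : 0 < x ^+ 2 by rewrite exprn_gt0.
have b0 : 0 < 1 + nu / x ^+ 2 by rewrite addr_gt0// divr_gt0.
have -> : 1 + x ^+ 2 / nu = x ^+ 2 * nu^-1 * (1 + nu / x ^+ 2).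
  by field; rewrite !gt_eqF.
have -> : (x ^+ 2 * nu^-1 * (1 + nu / x ^+ 2)) `^ (- s) =
    x `^ (- nu - 1) * nu `^ s * (1 + nu / x ^+ 2) `^ (- s).
  have n0 : 0 <= nu^-1 by rewrite invr_ge0 ltW.
  rewrite (powRM _ (mulr_ge0 (ltW x20) n0) (ltW b0)) (powRM _ (ltW x20) n0).
  rewrite (powRV _ nu0) opprK -(powR_mulrn _ (ltW x0)) -powRrM.
  by congr (_ `^ _ * _ * _); rewrite /s; field.
have G1 : 0 < Gamma (nu / 2) by apply: Gamma_gt0; rewrite divr_gt0.
have sp : 0 < Num.sqrt pi :> R by rewrite sqrtr_gt0 pi_gt0.
have sn : 0 < Num.sqrt nu by rewrite sqrtr_gt0.
have sn2 : Num.sqrt nu * Num.sqrt nu = nu by rewrite -expr2 sqr_sqrtr// ltW.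
rewrite /k /k_coef -/s sqrtrM ?(ltW nu0)//.
have -> : nu `^ s = nu `^ (nu / 2 - 1) * nu * Num.sqrt nu.
  rewrite -[X in _ * X * _]powRr1 ?(ltW nu0)// -powR12_sqrt ?(ltW nu0)// -!powRD_pos//.
  by congr powR; rewrite /s; field.
by field; rewrite (gt_eqF sp) (gt_eqF sn) (gt_eqF G1).
Qed.

Let pw (r x : R) : 0 < x -> x `^ r / x ^+ 2 = x `^ (r - 2).
Proof. by move=> x0; rewrite -powR_invn ?(ltW x0)// -powRD_pos. Qed.

Let pw4 (r x : R) : 0 < x -> x `^ r / x ^+ 2 / x ^+ 2 = x `^ (r - 4).
Proof. by move=> x0; rewrite !pw//; congr powR; ring. Qed.

(** The quadratic Bernoulli remainder in the density, of degree -nu - 5, integrates to this multiple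
    of z^(-(nu+4)). In the same way d (nu + 2) = s nu^2 is the origin of [d_coef]. *)
Definition tail_coef : R := k * nu * (s * nu) ^+ 2 / (nu + 4).

Lemma t_pdf_bounds (x : R) : 0 < x ->
  [/\ t_pdf nu x <= k * nu * x `^ (- nu - 1),
      k * nu * x `^ (- nu - 1) - k * dd * (nu + 2) * x `^ (- nu - 3) <= t_pdf nu x &
      t_pdf nu x <= k * nu * x `^ (- nu - 1) - k * dd * (nu + 2) * x `^ (- nu - 3)
        + tail_coef * (nu + 4) * x `^ (- nu - 5)].
Proof.
move=> x0; rewrite t_pdf_powR//.
have x20 : 0 < x ^+ 2 by rewrite exprn_gt0.
have y0 : 0 <= nu / x ^+ 2 by rewrite divr_ge0 ?ltW.
have C0 : 0 <= k * nu * x `^ (- nu - 1) by rewrite mulr_ge0 ?powR_ge0// mulr_ge0 ?ltW.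
have s0 : 0 <= s by exact: le_trans s1.
have nu2 : 0 < nu + 2 by rewrite addr_gt0.
have nu4 : 0 < nu + 4 by rewrite addr_gt0.
have e3 : x `^ (- nu - 3) = x `^ (- nu - 1) / x ^+ 2 by rewrite pw//; congr powR; ring.
have e5 : x `^ (- nu - 5) = x `^ (- nu - 1) / x ^+ 2 / x ^+ 2 by rewrite pw4//; congr powR; ring.
have E1 : k * dd * (nu + 2) * x `^ (- nu - 3) = k * nu * x `^ (- nu - 1) * (s * (nu / x ^+ 2)).
  rewrite e3 /dd /d_coef /s; field; by rewrite !gt_eqF.
have E2 : tail_coef * (nu + 4) * x `^ (- nu - 5) = k * nu * x `^ (- nu - 1) * (s * (nu / x ^+ 2)) ^+ 2.
  rewrite e5 /tail_coef; field; by rewrite !gt_eqF.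
rewrite E1 E2; split.
- rewrite -[leRHS]mulr1 ler_wpM2l//.
  by rewrite -[leRHS](powRr0 (1 + nu / x ^+ 2)) ler_powR ?oppr_le0// lerDl.
- by rewrite -[X in X - _]mulr1 -mulrBr ler_wpM2l// powRN_bernoulli_lo.
- rewrite -[X in X - _ + _]mulr1 -mulrBr -mulrDr ler_wpM2l//.
  exact: powRN_bernoulli_hi.
Qed.

Lemma is_derive_powRN (r x : R) : 0 < x ->
  is_derive x 1 (fun x => x `^ (- r)) (- r * x `^ (- r - 1)).
Proof. by move=> x0; exact: is_derive1_powR. Qed.

Lemma is_derive_tau (x : R) : is_derive x 1 tau (- t_pdf nu x).
Proof.
have h := is_derive_add (is_derive_cst (1 : R) x 1) (is_derive_mull (-1) (is_derive_t_cdf nu0 x)).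
apply: is_derive_ext h _ _; last by rewrite add0r mulN1r.
by move=> y; rewrite mulN1r.
Qed.

Lemma cvg_tau : tau z @[z --> +oo] --> (0:R).
Proof. by rewrite -(subrr 1); apply: cvgB; [exact: cvg_cst|exact: cvg_t_cdf_y]. Qed.

(** Each difference vanishes at +oo and is nonincreasing by the matching bound on the density, hence
    is nonnegative. *)
Lemma tau_bounds (z : R) : 0 < z ->
  [/\ tau z <= k * z `^ (- nu),
      k * z `^ (- nu) - k * dd * z `^ (- (nu + 2)) <= tau z &
      tau z <= k * z `^ (- nu) - k * dd * z `^ (- (nu + 2)) + tail_coef * z `^ (- (nu + 4))].
Proof.
move=> z0.
have n2 : 0 < nu + 2 by rewrite addr_gt0.
have n4 : 0 < nu + 4 by rewrite addr_gt0.
have cz (c r : R) : 0 < r -> c * z `^ (- r) @[z --> +oo] --> (0:R).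
  by move=> r0; rewrite -(mulr0 c); apply: cvgMr; exact: cvgy_powRN.
have cT : (-1) * tau z @[z --> +oo] --> (0:R).
  by rewrite -(mulr0 (-1)); apply: cvgMr; exact: cvg_tau.
have dp (c r x : R) : 0 < x -> is_derive x 1 (fun x => c * x `^ (- r)) (c * (- r * x `^ (- r - 1))).
  by move=> x0; exact: is_derive_mull (is_derive_powRN r x0).
have e3 : - (nu + 2) - 1 = - nu - 3 by ring.
have e5 : - (nu + 4) - 1 = - nu - 5 by ring.
have dt x := is_derive_mull (-1) (is_derive_tau x).
have h1 : forall z : R, 0 < z -> 0 <= k * z `^ (- nu) + (-1) * tau z.
  apply: (ge0_of_derive_le0 (df := fun x => k * (- nu * x `^ (- nu - 1)) + (-1) * - t_pdf nu x)).
  + by move=> x x0; exact: is_derive_add (dp k nu x x0) (dt x).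
  + by move=> x /t_pdf_bounds[h _ _]; move: h; lra.
  + by rewrite -[X in _ --> X](addr0 0); apply: cvgD; [exact: cz|exact: cT].
have h2 : forall z : R, 0 < z -> 0 <= tau z + (- k * z `^ (- nu) + k * dd * z `^ (- (nu + 2))).
  apply: (ge0_of_derive_le0 (df := fun x => - t_pdf nu x +
    (- k * (- nu * x `^ (- nu - 1)) + k * dd * (- (nu + 2) * x `^ (- (nu + 2) - 1))))).
  + by move=> x x0; exact: is_derive_add (is_derive_tau x) (is_derive_add (dp (- k) nu x x0) (dp (k * dd) (nu + 2) x x0)).
  + by move=> x /t_pdf_bounds[_ h _]; move: h; rewrite e3; lra.
  + rewrite -[X in _ --> X](addr0 0) -[X in _ --> _ + X](addr0 0).
    apply: cvgD; first exact: cvg_tau.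
    by apply: cvgD; exact: cz.
have h3 : forall z : R, 0 < z -> 0 <= (-1) * tau z + (k * z `^ (- nu) +
    (- (k * dd) * z `^ (- (nu + 2)) + tail_coef * z `^ (- (nu + 4)))).
  apply: (ge0_of_derive_le0 (df := fun x => (-1) * - t_pdf nu x + (k * (- nu * x `^ (- nu - 1)) +
    (- (k * dd) * (- (nu + 2) * x `^ (- (nu + 2) - 1)) +
     tail_coef * (- (nu + 4) * x `^ (- (nu + 4) - 1)))))).
  + move=> x x0; exact: is_derive_add (dt x) (is_derive_add (dp k nu x x0)
      (is_derive_add (dp (- (k * dd)) (nu + 2) x x0) (dp tail_coef (nu + 4) x x0))).
  + by move=> x /t_pdf_bounds[_ _ h]; move: h; rewrite e3 e5; lra.
  + rewrite -[X in _ --> X](addr0 0) -[X in _ --> _ + X](addr0 0) -[X in _ --> _ + (_ + X)](addr0 0).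
    apply: cvgD; first exact: cT.
    apply: cvgD; first exact: cz.
    by apply: cvgD; exact: cz.
have := h1 z z0; have := h2 z z0; have := h3 z z0; by move=> ? ? ?; split; lra.
Qed.

Lemma tau_nonincreasing (x y : R) : x <= y -> tau y <= tau x.
Proof. by move=> xy; rewrite lerD2l lerN2 t_cdf_nondecreasing. Qed.

Lemma tau_le1 x : tau x <= 1.
Proof. by rewrite gerBl t_cdf_ge0. Qed.

Lemma tau_gt0 x : 0 < tau x.
Proof.
(* The lower bound of [tau_bounds] is positive as soon as z^2 > d; monotonicity brings positivity
   back to x. *)
pose z := Num.max (Num.max x 1) (2 * dd + 1).
have z1 : 1 <= z by rewrite !le_max lexx orbT.
have zx : x <= z by rewrite !le_max lexx.
have zd : 2 * dd + 1 <= z by rewrite le_max lexx orbT.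
have z0 : 0 < z by exact: lt_le_trans z1.
apply: lt_le_trans (tau_nonincreasing zx).
have [_ h _] := tau_bounds z0; apply: lt_le_trans h.
have -> : z `^ (- (nu + 2)) = z `^ (- nu) / z ^+ 2.
  by rewrite pw//; congr powR; ring.
have p0 : 0 < z `^ (- nu) by rewrite powR_gt0.
have -> : k * z `^ (- nu) - k * dd * (z `^ (- nu) / z ^+ 2) =
  k * z `^ (- nu) / z ^+ 2 * (z ^+ 2 - dd) by field; rewrite gt_eqF.
rewrite mulr_gt0//; first by rewrite divr_gt0 ?exprn_gt0// mulr_gt0.
have d0 := d_coef_gt0; rewrite -/dd in d0; rewrite subr_gt0 expr2.
have : z * 1 <= z * z by rewrite ler_pM2l.
lra.
Qed.

Lemma tau0 : tau 0 = 2^-1.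
Proof. by have := t_cdfN nu0 0; rewrite oppr0 /tau; lra. Qed.

(** With eta = z^(-2), the normalised tail [th] lies between 1 - d eta and 1 - d eta + K' eta^2, and
    inversion costs only a further multiple of eta^2. The threshold on z ensures d eta <= 1/2. *)
Lemma tau_inv_asymp : exists2 C, 0 <= C & exists2 z0, 1 <= z0 & forall z, z0 <= z ->
  `|(tau z)^-1 - k^-1 * z `^ nu - dd * k^-1 * z `^ (nu - 2)| <= C * z `^ (nu - 4).
Proof.
pose K' := tail_coef / k.
have K'0 : 0 <= K'.
  by rewrite divr_ge0 ?(ltW k0)// divr_ge0 ?addr_ge0 ?(ltW nu0)// mulr_ge0 ?sqr_ge0// mulr_ge0 ?ltW.
have d0 : 0 < dd := d_coef_gt0.
exists (k^-1 * (2 * dd ^+ 2 + K')).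
  by rewrite mulr_ge0 ?invr_ge0 ?(ltW k0)// addr_ge0// mulr_ge0// sqr_ge0.
exists (1 + 2 * dd + K'); first by rewrite -addrA lerDl; lra.
move=> z hz; have z1 : 1 <= z by lra.
have z0 : 0 < z by lra.
have z20 : 0 < z ^+ 2 by rewrite exprn_gt0.
pose eta := (z ^+ 2)^-1.
have eta0 : 0 < eta by rewrite invr_gt0.
have zz2 : z <= z ^+ 2 by rewrite expr2 ler_peMl// ltW.
have de : dd * eta <= 2^-1.
  by rewrite /eta ler_pdivrMr//; lra.
have eta1 : eta <= 1 by rewrite invf_le1//; lra.
have [h1 h2 h3] := tau_bounds z0.
have e2 : z `^ (- (nu + 2)) = z `^ (- nu) * eta by rewrite /eta pw//; congr powR; ring.
have e4 : z `^ (- (nu + 4)) = z `^ (- nu) * eta * eta by rewrite /eta pw4//; congr powR; ring.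
have p0 : 0 < z `^ (- nu) by rewrite powR_gt0.
have kp : 0 < k * z `^ (- nu) by rewrite mulr_gt0.
pose th := tau z / (k * z `^ (- nu)).
have tE : tau z = k * z `^ (- nu) * th by rewrite /th mulrC divfK// gt_eqF.
have th1 : 1 - dd * eta <= th.
  rewrite /th ler_pdivlMr//; move: h2; rewrite e2; lra.
have th2 : th <= 1 - dd * eta + K' * eta ^+ 2.
  rewrite /th ler_pdivrMr//; move: h3; rewrite e2 e4.
  have -> : tail_coef = K' * k by rewrite /K' divfK// gt_eqF.
  by rewrite expr2; lra.
have th0 : 0 < th by lra.
have key : `|th^-1 - 1 - dd * eta| <= (2 * dd ^+ 2 + K') * eta ^+ 2.
  have u0 : 0 <= dd * eta by rewrite mulr_ge0// ltW.
  have K'e : 0 <= K' * eta ^+ 2 by rewrite mulr_ge0// sqr_ge0.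
  (* For u <= 1/2, (1 + u + 2u^2)(1 - u) = 1 + u^2 (1 - 2u) >= 1; this is where the factor 2 in the
     constant comes from. *)
  have up : th^-1 <= 1 + dd * eta + 2 * (dd * eta) ^+ 2.
    apply: (@le_trans _ _ (1 - dd * eta)^-1).
      by rewrite lef_pV2 ?posrE//; lra.
    rewrite -[leLHS]div1r ler_pdivrMr; last by lra.
    have : 0 <= (dd * eta) ^+ 2 * (1 - 2 * (dd * eta)) by rewrite mulr_ge0 ?sqr_ge0//; lra.
    move: (dd * eta) => u hu; rewrite !expr2 in hu *; lra.
  (* With v = d eta - K' eta^2, the upper bound on [th] reads th <= 1 - v, and (1 + v)(1 - v) <= 1;
     multiplying by 1 + v requires its sign. *)
  have lo : 1 + dd * eta - K' * eta ^+ 2 <= th^-1.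
    rewrite -[leRHS]div1r ler_pdivlMr//.
    have [n|n] := ltP (1 + dd * eta - K' * eta ^+ 2) 0.
      by apply: (@le_trans _ _ 0); [rewrite mulr_le0_ge0 ?ltW|exact: ler01].
    apply: le_trans (ler_wpM2l n th2) _.
    have : 0 <= (dd * eta - K' * eta ^+ 2) ^+ 2 by rewrite sqr_ge0.
    rewrite [X in 0 <= X -> _]expr2; lra.
  rewrite ler_norml; apply/andP; split.
    have := mulr_ge0 (mulr_ge0 (ler0n R 2) (sqr_ge0 dd)) (sqr_ge0 eta).
    by rewrite mulrDl; lra.
  rewrite mulrDl -[2 * dd ^+ 2 * _]mulrA -exprMn; lra.
have zn : z `^ nu = (z `^ (- nu))^-1 by rewrite powRN invrK.
have -> : (tau z)^-1 - k^-1 * z `^ nu - dd * k^-1 * z `^ (nu - 2) =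
   k^-1 * z `^ nu * (th^-1 - 1 - dd * eta).
  rewrite -pw// -/eta tE zn; field.
  by rewrite !gt_eqF.
have -> : z `^ (nu - 4) = z `^ nu * eta ^+ 2 by rewrite -pw4// /eta; ring.
rewrite normrM ger0_norm ?mulr_ge0 ?invr_ge0 ?powR_ge0 ?(ltW k0)//.
have -> : k^-1 * (2 * dd ^+ 2 + K') * (z `^ nu * eta ^+ 2) =
    k^-1 * z `^ nu * ((2 * dd ^+ 2 + K') * eta ^+ 2) by ring.
by rewrite ler_wpM2l// mulr_ge0 ?powR_ge0// invr_ge0 ltW.
Qed.

End t_tail.

(** * Expansions of the scores *)

Section builder.
Context {R : realType}.
Variables (nu kap r : R) (phi N M : R -> R).
Local Notation rho := (nu * (1 - kap)).

(** A remainder of degree r < rho beyond [z0] and a crude bound everywhere suffice. Large arguments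
    are handled by homogeneity of [M]; for |z| < z0 both [phi] and [N] are bounded, and |z|^e1 is
    bounded below because e1 <= 0. *)
Lemma score_expansion_of_rate :
  0 < nu -> 0 < kap -> kap <= 2 / nu -> -1 < rho -> r < rho ->
  (forall z, 0 <= N z) ->
  (forall u z, 0 < u -> N (u * z) = u `^ nu * N z) ->
  (forall u z, 0 < u -> M (u * z) = u `^ rho * M z) ->
  (exists2 K, 0 <= K & forall z, `|phi z| <= K * (1 + N z)) ->
  (exists2 C, 0 <= C & exists2 z0, 1 <= z0 & forall z, z0 <= `|z| ->
    `|phi z - N z - M z| <= C * `|z| `^ r) ->
  measurable_fun setT phi -> measurable_fun setT N -> measurable_fun setT M ->
  score_expansion nu kap phi N M.
Proof.
move=> nu0 kap0 kap2 rho1 rrho N0 hN hM [K K0 hK] [C C0 [z0 z01 hC]] mphi mN mM.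
have [CN CN0 hCN] := homogeneous_bound hN.
have [CM CM0 hCM] := homogeneous_bound hM.
have z00 : 0 < z0 by exact: lt_le_trans z01.
split => //.
- pose e1 := Num.min 0 rho.
  have e10 : e1 <= 0 by rewrite ge_min lexx.
  (* The bound of [phi - N] on |z| < z0, divided by z0^e1, the lower bound of |z|^e1 there. *)
  pose K0' := (K + (K + 1) * (CN * z0 `^ nu)) * z0 `^ (- e1).
  have K0'0 : 0 <= K0'.
    by rewrite mulr_ge0 ?powR_ge0// addr_ge0// mulr_ge0 ?addr_ge0// mulr_ge0 ?powR_ge0.
  exists (K0' + (CM + C)); first by rewrite !addr_ge0.
  move=> z zn0; have az : 0 < `|z| by rewrite normr_gt0.
  have p1 : 0 <= `|z| `^ e1 by exact: powR_ge0.
  have p2 : 0 <= `|z| `^ rho by exact: powR_ge0.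
  have [zz|zz] := leP z0 `|z|.
    apply: (@le_trans _ _ ((CM + C) * `|z| `^ rho)); last first.
      rewrite [leRHS]mulrDr; apply: (@le_trans _ _ ((K0' + (CM + C)) * `|z| `^ rho)).
        by rewrite ler_wpM2r// lerDr.
      by rewrite lerDr mulr_ge0// !addr_ge0.
    rewrite (_ : phi z - N z = (phi z - N z - M z) + M z); last by rewrite subrK.
    apply: le_trans (ler_normD _ _) _; rewrite addrC [leRHS]mulrDl lerD//.
    apply: le_trans (hC _ zz) _; rewrite ler_wpM2l// ler_powR//; last exact: ltW.
    exact: le_trans zz.
  apply: (@le_trans _ _ (K0' * `|z| `^ e1)); last first.
    rewrite [leRHS]mulrDr; apply: (@le_trans _ _ ((K0' + (CM + C)) * `|z| `^ e1)).
      by rewrite ler_wpM2r// lerDl addr_ge0.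
    by rewrite lerDl mulr_ge0// !addr_ge0.
  have hNz : N z <= CN * z0 `^ nu.
    apply: le_trans (ler_norm _) _; apply: le_trans (hCN z) _; rewrite ler_wpM2l//.
    by apply: le_powR; rewrite ?ltW.
  apply: (@le_trans _ _ (K + (K + 1) * (CN * z0 `^ nu))).
    apply: le_trans (ler_normB _ _) _; rewrite [`|N z|]ger0_norm//.
    apply: le_trans (lerD (hK z) (lexx _)) _.
    rewrite (_ : K * (1 + N z) + N z = K + (K + 1) * N z); last by ring.
    by rewrite lerD2l ler_wpM2l// addr_ge0.
  rewrite /K0' -mulrA ler_peMr//.
    by rewrite addr_ge0// mulr_ge0 ?addr_ge0// mulr_ge0 ?powR_ge0.
  rewrite -(powRVM e1 z00) ler_wpM2l ?powR_ge0//.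
  exact: le_powRN (ltW zz).
- by exists K => // z; apply: le_trans (hK z); exact: ler_norm.
- move=> e e0; have dr : 0 < rho - r by rewrite subr_gt0.
  (* The second value solves C z^r = e z^rho for nonzero [C]. *)
  exists (Num.max z0 ((C / e) `^ (rho - r)^-1)); first by rewrite lt_max z00.
  move=> z; rewrite ge_max => /andP[zz hz].
  have az : 0 < `|z| by exact: lt_le_trans zz.
  apply: le_trans (hC z zz) _.
  rewrite (_ : rho = r + (rho - r)); last by ring.
  rewrite powRD_pos// mulrCA [leLHS]mulrC ler_wpM2l ?powR_ge0//.
  rewrite -ler_pdivrMl// mulrC.
  have Ce : 0 <= C / e by rewrite divr_ge0// ltW.
  have -> : C / e = ((C / e) `^ (rho - r)^-1) `^ (rho - r).
    by rewrite -powRrM mulVf ?powRr1// gt_eqF.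
  by apply: le_powR => //; [exact: ltW|exact: powR_ge0].
Qed.

End builder.

Section pos_powR_facts.
Context {R : realType}.
Implicit Types s u z : R.

Lemma pos_powRZ s u z : 0 < u -> pos_powR s (u * z) = u `^ s * pos_powR s z.
Proof.
move=> u0; rewrite /pos_powR pmulr_rgt0//; case: ltP => z0; last by rewrite !mul0r mulr0.
by rewrite !mul1r powRM ?ltW.
Qed.

Lemma pos_powR_pos s z : 0 < z -> pos_powR s z = z `^ s.
Proof. by move=> z0; rewrite /pos_powR z0 mul1r. Qed.

Lemma pos_powR_neg s z : z <= 0 -> pos_powR s z = 0.
Proof. by move=> z0; rewrite /pos_powR ltNge z0 mul0r. Qed.

Lemma measurable_abs_powR s : measurable_fun setT (fun z : R => `|z| `^ s).
Proof.
apply: (@measurableT_comp _ _ _ _ _ _ (@powR R ^~ s)); first exact: measurable_powR.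
exact: normr_measurable.
Qed.

End pos_powR_facts.

Section families.
Context {R : realType}.
Variables (nu kap r : R) (phi : R -> R).
Local Notation rho := (nu * (1 - kap)).
Hypotheses (nu0 : 0 < nu) (kap0 : 0 < kap) (kap2 : kap <= 2 / nu) (rho1 : -1 < rho)
  (rrho : r < rho) (mphi : measurable_fun setT phi).

(** The coefficient [gam] records the behaviour at -oo on the scale of the second term; it is the
    source of C_- when rho = 0. *)
Lemma one_sided_expansion (alpha beta gam : R) : 0 <= alpha ->
  (exists2 K, 0 <= K & forall z, `|phi z| <= K * (1 + alpha * pos_powR nu z)) ->
  (exists2 C, 0 <= C & exists2 z0, 1 <= z0 & forall z, z0 <= z ->
    `|phi z - alpha * z `^ nu - beta * z `^ rho| <= C * z `^ r /\
    `|phi (- z) - gam * z `^ rho| <= C * z `^ r) ->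
  score_expansion nu kap phi (fun z => alpha * pos_powR nu z)
    (fun z => beta * pos_powR rho z + gam * pos_powR rho (- z)).
Proof.
move=> alpha0 hK [C C0 [z0 z01 hC]]; apply: (score_expansion_of_rate (r := r)) => //.
- by move=> z; rewrite mulr_ge0// pos_powR_ge0.
- by move=> u z u0; rewrite pos_powRZ// mulrCA.
- by move=> u z u0; rewrite -mulrN !pos_powRZ// [RHS]mulrDr; congr (_ + _); rewrite mulrCA.
- exists C => //; exists z0 => // z; have [zp|zn] := leP 0 z.
    rewrite ger0_norm// => zz; have zp1 : 0 < z by apply: lt_le_trans zz; exact: lt_le_trans z01.
    rewrite !(pos_powR_pos _ zp1) (@pos_powR_neg _ _ (- z)) ?oppr_le0// mulr0 addr0.
    by have [] := hC _ zz.
  rewrite ltr0_norm// => zz; have zp1 : 0 < - z by rewrite oppr_gt0.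
  rewrite !(pos_powR_neg _ (ltW zn)) (pos_powR_pos _ zp1) !mulr0 add0r subr0.
  by have [_] := hC _ zz; rewrite opprK.
- by apply: measurable_funM => //; exact: measurable_pos_powR.
- apply: measurable_funD; apply: measurable_funM => //; first exact: measurable_pos_powR.
  by apply: (measurableT_comp (measurable_pos_powR rho)).
Qed.

Lemma two_sided_expansion (alpha beta : R) : 0 <= alpha ->
  (forall z, phi `|z| = phi z) ->
  (exists2 K, 0 <= K & forall z, `|phi z| <= K * (1 + alpha * `|z| `^ nu)) ->
  (exists2 C, 0 <= C & exists2 z0, 1 <= z0 & forall z, z0 <= z ->
    `|phi z - alpha * z `^ nu - beta * z `^ rho| <= C * z `^ r) ->
  score_expansion nu kap phi (fun z => alpha * `|z| `^ nu)
    (fun z => beta * `|z| `^ rho).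
Proof.
move=> alpha0 hphi hK [C C0 [z0 z01 hC]]; apply: (score_expansion_of_rate (r := r)) => //.
- by move=> z; rewrite mulr_ge0// powR_ge0.
- by move=> u z u0; rewrite normrM (gtr0_norm u0) powRM ?(ltW u0)// mulrCA.
- by move=> u z u0; rewrite normrM (gtr0_norm u0) powRM ?(ltW u0)// mulrCA.
- by exists C => //; exists z0 => // z zz; rewrite -hphi; exact: hC.
- by apply: measurable_funM => //; exact: measurable_abs_powR.
- by apply: measurable_funM => //; exact: measurable_abs_powR.
Qed.

End families.

Section scores.
Context {R : realType}.
Variable nu : R.
Hypothesis nu1 : 1 < nu.
Let nu0 : 0 < nu. Proof. exact: lt_trans nu1. Qed.
Local Notation tau := (@tau R nu).
Let k := k_coef nu.
Let dd := d_coef nu.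
Let c : R := 2 / pi.
Let k0 : 0 < k. Proof. exact: k_coef_gt0. Qed.
Let dd0 : 0 < dd. Proof. exact: d_coef_gt0. Qed.
Let pi0 : 0 < pi :> R. Proof. exact: pi_gt0. Qed.
Let c0 : 0 < c. Proof. by rewrite divr_gt0. Qed.

Lemma tauN z : tau (- z) = 1 - tau z.
Proof. by rewrite -[tau (- z)]/(1 - t_cdf nu (- z)) t_cdfN. Qed.

Lemma Y_oneE z : Y_one nu z = (tau z)^-1. Proof. by []. Qed.

Lemma Y_twoE z : Y_two nu z = 2^-1 * Y_one nu `|z|.
Proof. by rewrite /Y_two invfM. Qed.

Definition half_cot (p : R) := cot (pi / 2 * p).

Lemma H_oneE z : H_one nu z = half_cot (tau z).
Proof. by rewrite /H_one Y_oneE invfM invrK mulrA. Qed.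

Lemma H_twoE z : H_two nu z = half_cot (2 * tau `|z|).
Proof. by rewrite /H_two /Y_two invfM invrK mulrA. Qed.

Lemma half_cot_bounds p : 0 < p <= 1 -> 0 <= half_cot p <= c * p^-1.
Proof.
move=> /andP[p0 p1].
have -> : c * p^-1 = (pi / 2 * p)^-1 by rewrite invfM invf_div.
by apply: cot_bounds; rewrite mulr_gt0 ?divr_gt0//= ler_piMr// divr_ge0// ltW.
Qed.

Lemma half_cot_approx p : 0 < p -> pi / 2 * p <= 1 -> `|half_cot p - c * p^-1| <= pi / 2 * p.
Proof.
move=> p0 p1.
have -> : c * p^-1 = (pi / 2 * p)^-1 by rewrite invfM invf_div.
by apply: cot_approx; rewrite p1 mulr_gt0// divr_gt0.
Qed.

Lemma half_cot_sub q : 0 <= q -> pi / 2 * q <= 1 -> 0 <= half_cot (1 - q) <= pi * q.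
Proof.
move=> q0 q1; rewrite /half_cot mulrBr mulr1.
have -> : pi * q = 2 * (pi / 2 * q) by field.
by apply: cot_pihalf_sub; rewrite q1 andbT mulr_ge0// divr_ge0// ltW.
Qed.

Lemma two_tau_abs (z : R) : 0 < 2 * tau `|z| <= 1.
Proof.
rewrite mulr_gt0 ?tau_gt0//=; have := tau_nonincreasing nu1 (normr_ge0 z).
by rewrite tau0//; lra.
Qed.

Lemma tau_le_powR z : 0 < z -> tau z <= k * z `^ (- nu).
Proof. by move=> z0; have [] := tau_bounds nu1 z0. Qed.

Lemma tau_small z : 1 + pi * k <= z -> pi * tau z <= 1.
Proof.
move=> hz; have pk : 0 < pi * k by rewrite mulr_gt0.
have z1 : 1 <= z by apply: le_trans hz; rewrite lerDl ltW.
have z0 : 0 < z by exact: lt_le_trans z1.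
apply: (@le_trans _ _ (pi * (k * z^-1))).
  rewrite ler_pM2l//; apply: le_trans (tau_le_powR z0) _; rewrite ler_pM2l//.
  by rewrite -powR_inv1 ?(ltW z0)// ler_powR// lerN2 ltW.
by rewrite mulrA ler_pdivrMr// mul1r; apply: le_trans hz; rewrite lerDr.
Qed.

Lemma Y_one_crude : exists2 K, 0 <= K & forall z, `|Y_one nu z| <= K * (1 + pos_powR nu z).
Proof.
have [C C0 [z0 z01 h]] := tau_inv_asymp nu1.
have z00 : 0 < z0 by exact: lt_le_trans z01.
have iY z : 0 < (tau z)^-1 by rewrite invr_gt0 tau_gt0.
have K0 : 0 <= k^-1 + dd * k^-1 + C.
  by have ki := ltW (eqbRL (invr_gt0 k) k0); exact: (addr_ge0 (addr_ge0 ki (mulr_ge0 (ltW dd0) ki)) C0).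
exists ((tau z0)^-1 + (k^-1 + dd * k^-1 + C)); first by rewrite addr_ge0 ?(ltW (iY _)).
move=> z; rewrite Y_oneE gtr0_norm//.
have pz := pos_powR_ge0 nu z.
have [zz|zz] := leP z0 z; last first.
  apply: (@le_trans _ _ (tau z0)^-1).
    by rewrite lef_pV2 ?posrE ?tau_gt0// tau_nonincreasing// ltW.
  apply: (@le_trans _ _ ((tau z0)^-1 * (1 + pos_powR nu z))).
    by rewrite ler_peMr ?(ltW (iY _))// lerDl.
  by rewrite ler_wpM2r ?addr_ge0// lerDl.
have z1 : 1 <= z by exact: le_trans zz.
have zp : 0 < z by exact: lt_le_trans z1.
apply: (@le_trans _ _ ((k^-1 + dd * k^-1 + C) * z `^ nu)); last first.
  rewrite pos_powR_pos//; apply: ler_pM => //; first exact: powR_ge0.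
    by rewrite lerDr ltW.
  by rewrite lerDr.
have /ler_normlP[_] := h _ zz.
have p1 : z `^ (nu - 2) <= z `^ nu by rewrite ler_powR// gerBl.
have p2 : z `^ (nu - 4) <= z `^ nu by rewrite ler_powR// gerBl.
have q1 := ler_wpM2l (mulr_ge0 (ltW dd0) (ltW (eqbRL (invr_gt0 k) k0))) p1.
have q2 := ler_wpM2l C0 p2.
move: q1 q2; rewrite -/k -/dd !mulrDl; lra.
Qed.

Lemma measurable_tau : measurable_fun setT tau.
Proof.
apply: measurable_funB => //.
by apply: nondecreasing_measurable => //; exact: t_cdf_nondecreasing.
Qed.

Lemma measurable_Y_one : measurable_fun setT (Y_one nu).
Proof.
apply: nondecreasing_measurable => // x y xy; rewrite !Y_oneE.
by rewrite lef_pV2 ?posrE ?tau_gt0// tau_nonincreasing.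
Qed.

Lemma measurable_Y_two : measurable_fun setT (Y_two nu).
Proof.
rewrite (_ : Y_two nu = fun z => 2^-1 * Y_one nu `|z|); last by apply/funext => z; exact: Y_twoE.
apply: measurable_funM => //; apply: (measurableT_comp measurable_Y_one).
exact: normr_measurable.
Qed.

(* On [0 < p <= 1] the sine is positive, so that its inverse is the measurable function [pos_powR (-1)] of it. *)
Lemma measurable_half_cot (f : R -> R) : measurable_fun setT f ->
  (forall z, 0 < f z <= 1) -> measurable_fun setT (fun z => half_cot (f z)).
Proof.
move=> mf hf.
have mg : measurable_fun setT (fun z => pi / 2 * f z) by apply: measurable_funM.
rewrite (_ : (fun _ => _) =
  fun z => cos (pi / 2 * f z) * pos_powR (-1) (sin (pi / 2 * f z))).
  apply: measurable_funM.
    apply: (measurableT_comp _ mg); apply: continuous_measurable_fun.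
    exact: continuous_cos.
  apply: (measurableT_comp (measurable_pos_powR (-1))).
  apply: (measurableT_comp _ mg); apply: continuous_measurable_fun.
  exact: continuous_sin.
apply/funext => z; have /andP[f0 f1] := hf z.
have s0 : 0 < sin (pi / 2 * f z).
  apply: sin_gt0_pi; rewrite mulr_gt0 ?divr_gt0//=.
  by apply: (@le_lt_trans _ _ (pi / 2)); [rewrite ler_piMr// divr_ge0// ltW|rewrite ltr_pdivrMr// ltr_pMr// ltr1n].
by rewrite pos_powR_pos// powR_inv1// ltW.
Qed.

Lemma tau_itv z : 0 < tau z <= 1.
Proof. by rewrite tau_gt0//= tau_le1. Qed.

Lemma measurable_H_one : measurable_fun setT (H_one nu).
Proof.
rewrite (_ : H_one nu = fun z => half_cot (tau z)); last by apply/funext => z; exact: H_oneE.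
by apply: measurable_half_cot; [exact: measurable_tau|exact: tau_itv].
Qed.

Lemma measurable_H_two : measurable_fun setT (H_two nu).
Proof.
rewrite (_ : H_two nu = fun z => half_cot (2 * tau `|z|)); last by apply/funext => z; exact: H_twoE.
apply: measurable_half_cot; last exact: two_tau_abs.
apply: measurable_funM => //; apply: (measurableT_comp measurable_tau).
exact: normr_measurable.
Qed.

Let e_kap : nu * (1 - 2 / nu) = nu - 2.
Proof. by field; rewrite gt_eqF. Qed.

Let k_kap : 0 < 2 / nu. Proof. by rewrite divr_gt0. Qed.

Let rho1 : -1 < nu * (1 - 2 / nu).
Proof. by rewrite e_kap; move: nu1; lra. Qed.

Lemma crude_scale (alpha : R) (phi g : R -> R) : 0 < alpha -> (forall z, 0 <= g z) ->
  (exists2 K, 0 <= K & forall z, `|phi z| <= K * (1 + g z)) ->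
  exists2 K, 0 <= K & forall z, `|phi z| <= K * (1 + alpha * g z).
Proof.
move=> a0 g0 [K K0 h]; exists (K * (1 + alpha^-1)).
  by rewrite mulr_ge0// addr_ge0// invr_ge0 ltW.
move=> z; apply: le_trans (h z) _; rewrite -mulrA ler_wpM2l//.
have := g0 z => gz.
have -> : (1 + alpha^-1) * (1 + alpha * g z) = 1 + g z + (alpha^-1 + alpha * g z).
  by field; rewrite gt_eqF.
by rewrite lerDl addr_ge0 ?invr_ge0 ?(ltW a0)// mulr_ge0// ltW.
Qed.

Let ki0 : 0 < k^-1. Proof. by rewrite invr_gt0. Qed.
Let pkz z : 1 + pi * k <= z -> 1 <= z.
Proof. by apply: le_trans; rewrite lerDl mulr_ge0// ltW. Qed.

Lemma Y_one_neg z : 1 + pi * k <= z -> `|Y_one nu (- z) - 1| <= 2 * k * z `^ (- nu).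
Proof.
move=> hz; have zp : 0 < z by apply: lt_le_trans (pkz hz).
have h := tau_small hz; have t0 := tau_gt0 nu1 z; have tk := tau_le_powR zp.
have t2 : tau z <= 2^-1.
  have : 2 * tau z <= pi * tau z by rewrite ler_wpM2r ?(ltW t0)// pi_ge2.
  lra.
rewrite Y_oneE tauN.
have d0 : 0 < 1 - tau z by lra.
have -> : (1 - tau z)^-1 - 1 = tau z / (1 - tau z) by field; rewrite gt_eqF.
rewrite ger0_norm ?divr_ge0 ?(ltW t0) ?(ltW d0)// ler_pdivrMr// -mulrA.
apply: (@le_trans _ _ (2 * tau z * (1 - tau z))).
  rewrite [2 * _]mulrC -mulrA ler_peMr ?(ltW t0)//; lra.
by rewrite ler_wpM2r ?(ltW d0)// ler_pM2l.
Qed.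

(** At -oo the cotangent is taken near pi/2, where it vanishes: this is why no C_- term appears for
    Half-Cauchy scores. *)
Lemma H_one_neg z : 1 + pi * k <= z -> `|H_one nu (- z)| <= pi * k * z `^ (- nu).
Proof.
move=> hz; have zp : 0 < z by apply: lt_le_trans (pkz hz).
have h := tau_small hz; have t0 := tau_gt0 nu1 z; have tk := tau_le_powR zp.
rewrite H_oneE tauN.
have /andP[h1 h2] : 0 <= half_cot (1 - tau z) <= pi * tau z.
  apply: half_cot_sub; first exact: ltW.
  apply: le_trans h; rewrite ler_wpM2r ?(ltW t0)//; move: pi0; lra.
by rewrite ger0_norm// (le_trans h2)// -mulrA ler_pM2l.
Qed.

Lemma powR_rate (C r s z : R) : 0 <= C -> 1 <= z -> s <= r -> C * z `^ s <= C * z `^ r.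
Proof. by move=> C0 z1 sr; rewrite ler_wpM2l// ler_powR. Qed.

Lemma Y_one_crude_scaled : exists2 K, 0 <= K &
  forall z, `|Y_one nu z| <= K * (1 + k^-1 * pos_powR nu z).
Proof. exact: (crude_scale ki0 (pos_powR_ge0 nu) Y_one_crude). Qed.

(** For nu > 2 the limit 1 at -oo has degree 0 < nu - 2 and is part of the remainder, hence the 0 in
    the rate. *)
Lemma Y_one_expansion_gt2 : 2 < nu ->
  score_expansion nu (2 / nu) (Y_one nu) (fun z => k^-1 * pos_powR nu z)
    (fun z => dd * k^-1 * pos_powR (nu * (1 - 2 / nu)) z + 0 * pos_powR (nu * (1 - 2 / nu)) (- z)).
Proof.
move=> nu2; apply: (one_sided_expansion (r := Num.max (nu - 4) 0)) => //.
- by rewrite e_kap gt_max; apply/andP; split; move: nu2; lra.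
- exact: measurable_Y_one.
- exact: ltW.
- exact: Y_one_crude_scaled.
have [C C0 [z0 z01 h]] := tau_inv_asymp nu1.
have kk : 0 <= 2 * k by rewrite mulr_ge0 ?(ltW k0).
exists (C + 1 + 2 * k); first by rewrite !addr_ge0.
exists (Num.max z0 (1 + pi * k)); first by rewrite le_max z01.
move=> z; rewrite ge_max => /andP[zz zk]; have z1 := pkz zk.
have p0 (s : R) : 0 <= z `^ s := powR_ge0 z s.
rewrite e_kap; split.
  apply: le_trans (h _ zz) _; apply: (@le_trans _ _ (C * z `^ Num.max (nu - 4) 0)).
    by apply: powR_rate => //; rewrite le_max lexx.
  by rewrite ler_wpM2r// -addrA lerDl addr_ge0.
rewrite mul0r subr0.
have hY : `|Y_one nu (- z)| <= 1 + 2 * k * z `^ (- nu).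
  rewrite -[Y_one nu (- z)](subrK 1); apply: le_trans (ler_normD _ _) _.
  by rewrite normr1 addrC lerD2l Y_one_neg.
apply: le_trans hY _; apply: (@le_trans _ _ ((1 + 2 * k) * z `^ Num.max (nu - 4) 0)).
  rewrite [leRHS]mulrDl; apply: lerD.
    by rewrite -[leLHS](mulr1) -(powRr0 z); apply: powR_rate => //; rewrite le_max lexx orbT.
  by apply: powR_rate => //; rewrite le_max oppr_le0 (ltW nu0) orbT.
by rewrite ler_wpM2r// -addrA lerDr.
Qed.

(** At nu = 2 the second term on the right and the limit 1 on the left both have degree 0, so both
    enter [M]; the remainders agree too, as nu - 4 = -nu. *)
Lemma Y_one_expansion_eq2 : nu = 2 ->
  score_expansion nu (2 / nu) (Y_one nu) (fun z => k^-1 * pos_powR nu z)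
    (fun z => dd * k^-1 * pos_powR (nu * (1 - 2 / nu)) z + 1 * pos_powR (nu * (1 - 2 / nu)) (- z)).
Proof.
move=> nu2; apply: (one_sided_expansion (r := - nu)) => //.
- by rewrite e_kap; lra.
- exact: measurable_Y_one.
- exact: ltW.
- exact: Y_one_crude_scaled.
have [C C0 [z0 z01 h]] := tau_inv_asymp nu1.
have kk : 0 <= 2 * k by rewrite mulr_ge0 ?(ltW k0).
exists (C + 2 * k); first by rewrite !addr_ge0.
exists (Num.max z0 (1 + pi * k)); first by rewrite le_max z01.
move=> z; rewrite ge_max => /andP[zz zk]; have z1 := pkz zk.
have p0 (s : R) : 0 <= z `^ s := powR_ge0 z s.
rewrite e_kap; split.
  apply: le_trans (h _ zz) _; have -> : nu - 4 = - nu by lra.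
  by rewrite ler_wpM2r// lerDl.
have -> : nu - 2 = 0 by lra.
rewrite powRr0 mulr1; apply: le_trans (Y_one_neg zk) _.
by rewrite ler_wpM2r// lerDr.
Qed.

(** For nu < 2 the order is reversed: z^(nu-2) decays and joins the remainder, leaving only the
    limit 1 at -oo in [M]. *)
Lemma Y_one_expansion_lt2 : nu < 2 ->
  score_expansion nu 1 (Y_one nu) (fun z => k^-1 * pos_powR nu z)
    (fun z => 0 * pos_powR (nu * (1 - 1)) z + 1 * pos_powR (nu * (1 - 1)) (- z)).
Proof.
move=> nu2; have e0 : nu * (1 - 1) = 0 by rewrite subrr mulr0.
apply: (one_sided_expansion (r := nu - 2)) => //.
- by rewrite ler_pdivlMr// mul1r ltW.
- by rewrite e0 oppr_lt0.
- by rewrite e0; move: nu2; lra.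
- exact: measurable_Y_one.
- exact: ltW.
- exact: Y_one_crude_scaled.
have [C C0 [z0 z01 h]] := tau_inv_asymp nu1.
have kk : 0 <= 2 * k by rewrite mulr_ge0 ?(ltW k0).
have dk : 0 <= dd * k^-1 := mulr_ge0 (ltW dd0) (ltW ki0).
exists (C + dd * k^-1 + 2 * k); first exact: (addr_ge0 (addr_ge0 C0 dk) kk).
exists (Num.max z0 (1 + pi * k)); first by rewrite le_max z01.
move=> z; rewrite ge_max => /andP[zz zk]; have z1 := pkz zk.
have p0 (s : R) : 0 <= z `^ s := powR_ge0 z s.
rewrite e0 powRr0 mul0r subr0 mulr1; split.
  rewrite (_ : _ - _ = (Y_one nu z - k^-1 * z `^ nu - dd * k^-1 * z `^ (nu - 2)) + dd * k^-1 * z `^ (nu - 2)); last by rewrite subrK.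
  apply: le_trans (ler_normD _ _) _.
  rewrite [X in _ + X](ger0_norm (mulr_ge0 dk (p0 _))).
  apply: (@le_trans _ _ ((C + dd * k^-1) * z `^ (nu - 2))); last first.
    by rewrite ler_wpM2r// lerDl.
  rewrite [leRHS]mulrDl lerD2r; apply: le_trans (h _ zz) _; apply: powR_rate => //.
  by rewrite lerD2l lerN2; lra.
apply: le_trans (Y_one_neg zk) _.
apply: (@le_trans _ _ (2 * k * z `^ (nu - 2))).
  by apply: powR_rate => //; move: nu1; lra.
by rewrite ler_wpM2r// lerDr (addr_ge0 C0 dk).
Qed.

Lemma Y_two_crude : exists2 K, 0 <= K & forall z, `|Y_two nu z| <= K * (1 + `|z| `^ nu).
Proof.
have [K K0 h] := Y_one_crude; exists K => // z.
rewrite Y_twoE normrM ger0_norm ?invr_ge0//.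
have hz : `|Y_one nu `|z| | <= K * (1 + `|z| `^ nu).
  have [->|z0] := eqVneq z 0; last by apply: le_trans (h _) _; rewrite pos_powR_pos// normr_gt0.
  by apply: le_trans (h _) _; rewrite normr0 pos_powR_neg// ler_wpM2l// lerD2l powR_ge0.
apply: le_trans hz; rewrite ler_piMl//; lra.
Qed.

Lemma Y_two_expansion :
  score_expansion nu (2 / nu) (Y_two nu) (fun z => (2 * k)^-1 * `|z| `^ nu)
    (fun z => dd * (2 * k)^-1 * `|z| `^ (nu * (1 - 2 / nu))).
Proof.
apply: (two_sided_expansion (r := nu - 4)) => //.
- by rewrite e_kap; lra.
- exact: measurable_Y_two.
- by rewrite invr_ge0 mulr_ge0// ltW.
- by move=> z; rewrite !Y_twoE normr_id.
- apply: (crude_scale _ _ Y_two_crude); first by rewrite invr_gt0 mulr_gt0.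
  by move=> z; exact: powR_ge0.
have [C C0 [z0 z01 h]] := tau_inv_asymp nu1; exists C => //; exists z0 => // z zz.
have z0' : 0 <= z by apply: le_trans zz; exact: le_trans z01.
rewrite Y_twoE (ger0_norm z0') e_kap.
rewrite (_ : _ - _ - _ = 2^-1 * ((tau z)^-1 - k^-1 * z `^ nu - dd * k^-1 * z `^ (nu - 2))).
  rewrite normrM ger0_norm ?invr_ge0//; apply: le_trans (h _ zz).
  by rewrite ler_piMl//; lra.
by rewrite Y_oneE invfM; ring.
Qed.

Lemma H_one_crude : exists2 K, 0 <= K & forall z, `|H_one nu z| <= K * (1 + pos_powR nu z).
Proof.
have [K K0 h] := Y_one_crude; exists (c * K); first by rewrite mulr_ge0// ltW.
move=> z; have /andP[h1 h2] := half_cot_bounds (tau_itv z).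
rewrite H_oneE ger0_norm//; apply: le_trans h2 _; rewrite -(mulrA c) ler_wpM2l ?(ltW c0)//.
by apply: le_trans (h z); exact: ler_norm.
Qed.

Lemma H_two_crude : exists2 K, 0 <= K & forall z, `|H_two nu z| <= K * (1 + `|z| `^ nu).
Proof.
have [K K0 h] := Y_two_crude; exists (c * K); first by rewrite mulr_ge0// ltW.
move=> z; have /andP[h1 h2] := half_cot_bounds (two_tau_abs z).
rewrite H_twoE ger0_norm//; apply: le_trans h2 _; rewrite -(mulrA c) ler_wpM2l ?(ltW c0)//.
by apply: le_trans (h z); exact: ler_norm.
Qed.

(** The rate -nu comes from the cotangent error, of the order of the tail itself; it lies below nu -
    2 exactly because nu > 1. *)
Lemma H_one_expansion :
  score_expansion nu (2 / nu) (H_one nu) (fun z => c * k^-1 * pos_powR nu z)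
    (fun z => c * (dd * k^-1) * pos_powR (nu * (1 - 2 / nu)) z + 0 * pos_powR (nu * (1 - 2 / nu)) (- z)).
Proof.
apply: (one_sided_expansion (r := Num.max (nu - 4) (- nu))) => //.
- by rewrite e_kap gt_max; apply/andP; split; move: nu1; lra.
- exact: measurable_H_one.
- by rewrite mulr_ge0// ltW.
- by apply: (crude_scale _ (pos_powR_ge0 nu) H_one_crude); rewrite mulr_gt0.
have [C C0 [z0 z01 h]] := tau_inv_asymp nu1.
have pk : 0 <= pi * k by rewrite mulr_ge0// ltW.
have cC : 0 <= c * C by rewrite mulr_ge0// ltW.
exists (c * C + pi * k); first by rewrite !addr_ge0.
exists (Num.max z0 (1 + pi * k)); first by rewrite le_max z01.
move=> z; rewrite ge_max => /andP[zz zk]; have z1 := pkz zk.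
have zp : 0 < z by exact: lt_le_trans z1.
have p0 (s : R) : 0 <= z `^ s := powR_ge0 z s.
rewrite e_kap mul0r subr0; split.
  rewrite (_ : _ - _ - _ = (H_one nu z - c * (tau z)^-1) +
      c * ((tau z)^-1 - k^-1 * z `^ nu - dd * k^-1 * z `^ (nu - 2))); last by ring.
  apply: le_trans (ler_normD _ _) _; rewrite addrC [leRHS]mulrDl; apply: lerD.
    rewrite normrM (gtr0_norm c0) -(mulrA c) ler_wpM2l ?(ltW c0)//.
    apply: le_trans (h _ zz) _; apply: powR_rate => //; by rewrite le_max lexx.
  have t0 := tau_gt0 nu1 z.
  have pt : pi / 2 * tau z <= pi * tau z by rewrite ler_wpM2r ?(ltW t0)//; move: pi0; lra.
  rewrite H_oneE; apply: le_trans (half_cot_approx t0 (le_trans pt (tau_small zk))) _.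
  apply: le_trans pt _; apply: (@le_trans _ _ (pi * k * z `^ (- nu))).
    by rewrite -mulrA ler_pM2l// tau_le_powR.
  by apply: powR_rate => //; rewrite le_max lexx orbT.
apply: le_trans (H_one_neg zk) _; apply: (@le_trans _ _ (pi * k * z `^ Num.max (nu - 4) (- nu))).
  by apply: powR_rate => //; rewrite le_max lexx orbT.
by rewrite ler_wpM2r// lerDr.
Qed.

Lemma H_two_expansion :
  score_expansion nu (2 / nu) (H_two nu) (fun z => c * (2 * k)^-1 * `|z| `^ nu)
    (fun z => c * (dd * (2 * k)^-1) * `|z| `^ (nu * (1 - 2 / nu))).
Proof.
apply: (two_sided_expansion (r := Num.max (nu - 4) (- nu))) => //.
- by rewrite e_kap gt_max; apply/andP; split; move: nu1; lra.
- exact: measurable_H_two.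
- by apply: mulr_ge0; [exact: ltW|rewrite invr_ge0; apply: mulr_ge0 => //; exact: ltW].
- by move=> z; rewrite !H_twoE normr_id.
- apply: (crude_scale _ _ H_two_crude); first by rewrite mulr_gt0// invr_gt0 mulr_gt0.
  by move=> z; exact: powR_ge0.
have [C C0 [z0 z01 h]] := tau_inv_asymp nu1.
have pk : 0 <= pi * k by rewrite mulr_ge0// ltW.
have cC : 0 <= c * C by rewrite mulr_ge0// ltW.
exists (c * C + pi * k); first by rewrite !addr_ge0.
exists (Num.max z0 (1 + pi * k)); first by rewrite le_max z01.
move=> z; rewrite ge_max => /andP[zz zk]; have z1 := pkz zk.
have zp : 0 < z by exact: lt_le_trans z1.
have p0 (s : R) : 0 <= z `^ s := powR_ge0 z s.
rewrite e_kap.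
rewrite (_ : _ - _ - _ = (H_two nu z - c * (2 * tau z)^-1) +
    c * 2^-1 * ((tau z)^-1 - k^-1 * z `^ nu - dd * k^-1 * z `^ (nu - 2))); last by rewrite !invfM; ring.
apply: le_trans (ler_normD _ _) _; rewrite addrC [leRHS]mulrDl; apply: lerD.
  have c2 : 0 <= c * 2^-1 by rewrite divr_ge0// ltW.
  rewrite normrM (ger0_norm c2); apply: (@le_trans _ _ (c * (C * z `^ Num.max (nu - 4) (- nu)))); last by rewrite mulrA.
  apply: ler_pM => //.
    by rewrite ler_piMr ?(ltW c0)//; lra.
  by apply: le_trans (h _ zz) _; apply: powR_rate => //; rewrite le_max lexx.
have t0 := tau_gt0 nu1 z.
have pt : pi / 2 * (2 * tau z) = pi * tau z by field.
rewrite H_twoE (gtr0_norm zp).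
have t20 : 0 < 2 * tau z by rewrite mulr_gt0.
apply: le_trans (half_cot_approx t20 _) _; rewrite pt; first exact: tau_small.
apply: (@le_trans _ _ (pi * k * z `^ (- nu))).
  by rewrite -mulrA ler_pM2l// tau_le_powR.
by apply: powR_rate => //; rewrite le_max lexx orbT.
Qed.

End scores.

(** * Tails of the weighted scores *)

Lemma littleo_of_cvg {R : realType} (f g h : R -> R) (p L : R) :
  t `^ p * f t @[t --> +oo] --> L ->
  (forall t, 0 < t -> g t = t `^ (- p)) ->
  (forall t, 0 < t -> h t = f t - L * g t) ->
  (h : R -> R^o) =o_ (+oo_R) (g : R -> R^o).
Proof.
move=> hf hg hh; apply/eqoP => e e0.
have /cvgrPdist_le/(_ e e0) he := hf.
near=> t.
have t0 : 0 < t by near: t; apply: nbhs_pinfty_gt; rewrite num_real.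
have -> : h t = (t `^ p * f t - L) * g t.
  by rewrite hh// hg// mulrBl mulrAC [t `^ p * _]mulrC powRVM// mul1r.
rewrite normrM ler_wpM2r// distrC; near: t; exact: he.
Unshelve. all: by end_near. Qed.

Section coefficients.
Context {R : realType} {m : nat} (Rho : 'M[R]_m).
Hypothesis hRho : correlation_matrix Rho.
Context {d : measure_display} {Om : measurableType d} (Q : probability Om R).
Variables (G : {RV Q >-> m.-tuple R}) (nu : R).
Hypothesis hG : gaussian_vector Rho G.
Hypothesis nu1 : 1 < nu.
Variable w : 'I_m -> R.
Hypothesis hw : simplex_weights w.
Let nu0 : 0 < nu. Proof. exact: lt_trans nu1. Qed.
Let k := k_coef nu.
Let dd := d_coef nu.
Let b := b_coef nu.
Let c : R := 2 / pi.
Let k0 : 0 < k. Proof. exact: k_coef_gt0. Qed.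
Let c0 : 0 < c. Proof. by rewrite divr_gt0// pi_gt0. Qed.
Let e_kap : nu * (1 - 2 / nu) = nu - 2.
Proof. by field; rewrite gt_eqF. Qed.
Let r0 : 0 < 2 / nu. Proof. by rewrite divr_gt0. Qed.
Implicit Types (g : m.-tuple R).

Lemma wsum_scale (u : R) (f : R -> R) (h : 'I_m -> R) :
  wsum w (fun z => u * f z) h = u * \sum_i w i * f (h i).
Proof. exact: wsumZ. Qed.

Lemma A_plusE g : A_plus nu w g = wsum w (fun z => k^-1 * pos_powR nu z) (tnth g).
Proof.
rewrite wsum_scale; congr (_ * _); apply: eq_bigr => i _; congr (_ * _).
have [z0|z0] := leP (tnth g i) 0; last by rewrite pos_powR_pos.
by rewrite pos_powR_neg// powR0// gt_eqF.
Qed.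

Lemma B_plusE g : B_plus nu w g = wsum w (fun z => dd * k^-1 * pos_powR (nu - 2) z) (tnth g).
Proof.
by rewrite wsum_scale; congr (_ * _); apply: eq_bigr => i _; rewrite -mulrA.
Qed.

Lemma C_minusE g : C_minus w g = wsum w (fun z => pos_powR 0 (- z)) (tnth g).
Proof. by apply: eq_bigr => i _; rewrite /pos_powR powRr0 mulr1 oppr_gt0. Qed.

Lemma A_absE g : A_abs nu w g = wsum w (fun z => (2 * k)^-1 * `|z| `^ nu) (tnth g).
Proof. by rewrite wsum_scale. Qed.

Lemma B_absE g : B_abs nu w g = wsum w (fun z => dd * (2 * k)^-1 * `|z| `^ (nu - 2)) (tnth g).
Proof. by rewrite wsum_scale. Qed.

Lemma A_plus_ge0 g : 0 <= A_plus nu w g.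
Proof.
rewrite A_plusE; apply: wsum_ge0 hw _ _ _ => z.
by rewrite mulr_ge0 ?invr_ge0 ?(ltW k0)// pos_powR_ge0.
Qed.

Lemma A_abs_ge0 g : 0 <= A_abs nu w g.
Proof.
rewrite A_absE; apply: wsum_ge0 hw _ _ _ => z.
by rewrite mulr_ge0 ?powR_ge0// invr_ge0 mulr_ge0// ltW.
Qed.

Lemma abs_powR_split (s z : R) : s != 0 -> `|z| `^ s = pos_powR s (1 * z) + pos_powR s (-1 * z).
Proof.
move=> s0; rewrite mul1r mulN1r; have [z0|z0|->] := ltgtP z 0.
- by rewrite ltr0_norm// (pos_powR_neg _ (ltW z0)) add0r pos_powR_pos ?oppr_gt0.
- by rewrite gtr0_norm// pos_powR_pos// pos_powR_neg ?addr0// oppr_le0 ltW.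
- by rewrite oppr0 normr0 powR0// !pos_powR_neg// addr0.
Qed.

Lemma exp_pos_powR (u s : R) i : u ^+ 2 = 1 -> -1 < s ->
  fine 'E_Q[fun x => pos_powR s (u * coords G x i)] = half_moment s.
Proof.
by move=> u2 s1; rewrite unlock (integral_signed_moment hRho hG i u2 s1).
Qed.

Lemma intble_pos_powR (u s : R) i : u ^+ 2 = 1 -> -1 < s ->
  intble Q (fun x => pos_powR s (u * coords G x i)).
Proof. exact: (integrable_signed_moment hRho hG). Qed.

Let nuN1 : -1 < nu. Proof. by apply: lt_trans nu0; rewrite oppr_lt0. Qed.
Let sq1 : (1 : R) ^+ 2 = 1. Proof. by rewrite expr1n. Qed.
Let sqN1 : (-1 : R) ^+ 2 = 1. Proof. by rewrite sqrrN expr1n. Qed.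

Lemma intble_abs_powR (s : R) i : -1 < s -> s != 0 -> intble Q (fun x => `|coords G x i| `^ s).
Proof.
move=> s1 s0; have := intbleD (intble_pos_powR i sq1 s1) (intble_pos_powR i sqN1 s1).
by apply: eq_integrable => // x _; rewrite /= abs_powR_split.
Qed.

Lemma exp_abs_powR (s : R) i : -1 < s -> s != 0 ->
  fine 'E_Q[fun x => `|coords G x i| `^ s] = 2 * half_moment s.
Proof.
move=> s1 s0.
rewrite (_ : (fun x => _) =
  fun x => pos_powR s (1 * coords G x i) + pos_powR s (-1 * coords G x i)); last first.
  by apply/funext => x; rewrite abs_powR_split.
rewrite (expD (intble_pos_powR i sq1 s1) (intble_pos_powR i sqN1 s1)).
by rewrite !exp_pos_powR// -mulr2n mulr_natl.
Qed.

Lemma exp_wsum (f : R -> R) (v : R) : (forall i, intble Q (fun x => f (coords G x i))) ->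
  (forall i, fine 'E_Q[fun x => f (coords G x i)] = v) ->
  fine 'E_Q[fun x => wsum w f (coords G x)] = v.
Proof.
move=> fi fv; rewrite /wsum exp_sum; last by move=> i; exact: intbleZ.
rewrite -[RHS]mul1r -hw.2 mulr_suml; apply: eq_bigr => i _.
by rewrite expZ ?fv.
Qed.

(** The factor [u] is 1 for reciprocal scores and 2/pi for Half-Cauchy scores. *)
Lemma exp_A_plus (u : R) :
  a_coef nu * fine 'E_Q[fun x => wsum w (fun z => u * k^-1 * pos_powR nu z) (coords G x)] = u.
Proof.
have e i : (fun x => pos_powR nu (coords G x i)) = fun x => pos_powR nu (1 * coords G x i).
  by apply/funext => x; rewrite mul1r.
have ii i : intble Q (fun x => pos_powR nu (coords G x i)).
  by rewrite e; exact: intble_pos_powR.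
rewrite (@exp_wsum _ (u * k^-1 * half_moment nu)).
- by rewrite mulrCA half_moment_nu// -/k -mulrA mulVf ?mulr1// gt_eqF.
- by move=> i; exact: intbleZ.
- by move=> i; rewrite expZ// e exp_pos_powR.
Qed.

Lemma exp_A_abs (u : R) :
  a_coef nu * fine 'E_Q[fun x => wsum w (fun z => u * (2 * k)^-1 * `|z| `^ nu) (coords G x)] = u.
Proof.
have n0 : nu != 0 by rewrite gt_eqF.
rewrite (@exp_wsum _ (u * (2 * k)^-1 * (2 * half_moment nu))).
- rewrite (_ : a_coef nu * _ = u * (2 * k)^-1 * 2 * (a_coef nu * half_moment nu)); last by ring.
  by rewrite half_moment_nu// -/k; field; rewrite gt_eqF.
- by move=> i; apply: intbleZ; exact: intble_abs_powR.
- by move=> i; rewrite expZ ?exp_abs_powR//; exact: intble_abs_powR.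
Qed.

(** The origin of the factor c^(1+2/nu) of the Half-Cauchy expansions. *)
Lemma powR_second (A B u r : R) : 0 < u -> 0 < r -> 0 <= A ->
  (u * A) `^ r * (u * B - b * (u * A)) = u `^ (1 + r) * (A `^ r * (B - b * A)).
Proof.
by move=> u0 rr A0; rewrite powRM ?(ltW u0)// powRD_pos// powRr1 ?(ltW u0)//; ring.
Qed.

Lemma intble_second (kap' : R) (phi N M : R -> R) : score_expansion nu kap' phi N M ->
  intble Q (fun x => wsum w N (coords G x) `^ (2 / nu) *
    (wsum w M (coords G x) - b * wsum w N (coords G x))).
Proof.
move=> se; have i1 := intble_AB hRho hG hw se r0.
have i2 := intbleZ b (intble_A hRho hG hw se (addr_gt0 ltr01 r0)).
apply: eq_integrable (intbleB i1 i2) => // x _ /=; congr EFin.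
have A0 : 0 <= wsum w N (coords G x) by apply: wsum_ge0 hw _ _ _; exact: se_N0 se.
rewrite mulrBr; congr (_ - _); rewrite powRD ?powRr1//; first by ring.
by rewrite (gt_eqF (addr_gt0 ltr01 r0)).
Qed.

Lemma half_cauchy_A_plusE x :
  wsum w (fun z => c * k^-1 * pos_powR nu z) (coords G x) = c * A_plus nu w (G x).
Proof. by rewrite A_plusE !wsum_scale mulrA. Qed.

Lemma half_cauchy_B_plusE x :
  wsum w (fun z => c * (dd * k^-1) * pos_powR (nu * (1 - 2 / nu)) z
    + 0 * pos_powR (nu * (1 - 2 / nu)) (- z)) (coords G x) = c * B_plus nu w (G x).
Proof.
rewrite wsumD [X in _ + X]wsum_scale mul0r addr0 B_plusE e_kap !wsum_scale.
by rewrite !mulrA.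
Qed.

(** Deduced from the Half-Cauchy score, whose second term is a multiple of [B_plus] for every nu >
    1, whereas that of the reciprocal score also involves C_- at nu = 2. *)
Lemma intble_D_plus : intble Q (fun x => A_plus nu w (G x) `^ (2 / nu) *
  (B_plus nu w (G x) - b * A_plus nu w (G x))).
Proof.
have := intbleZ (c `^ (1 + 2 / nu))^-1 (intble_second (H_one_expansion nu1)).
apply: eq_integrable => // x _ /=; congr EFin.
rewrite -/c -/k -/dd half_cauchy_A_plusE half_cauchy_B_plusE powR_second ?A_plus_ge0//.
by rewrite mulrA mulVf ?mul1r// gt_eqF// powR_gt0.
Qed.

Lemma wsum_B_absE x : wsum w (fun z => dd * (2 * k)^-1 * `|z| `^ (nu * (1 - 2 / nu))) (coords G x) =
  B_abs nu w (G x).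
Proof. by rewrite B_absE e_kap. Qed.

Lemma intble_D_abs : intble Q (fun x => A_abs nu w (G x) `^ (2 / nu) *
  (B_abs nu w (G x) - b * A_abs nu w (G x))).
Proof.
have := intble_second (Y_two_expansion nu1).
apply: eq_integrable => // x _ /=; congr EFin.
by rewrite -/k -/dd wsum_B_absE A_absE.
Qed.

Let second_coef_eq : second_coef nu (2 / nu) b = b.
Proof. by rewrite /second_coef eqxx. Qed.

Let kap_eq : 1 + 2 / nu - 2 / nu = 1. Proof. by rewrite addrK. Qed.

Let bE : dd = b * (nu + 1).
Proof. by rewrite /dd /b /d_coef /b_coef; field; rewrite gt_eqF// addr_gt0. Qed.

(** The moment recurrence meets the identity d = b (nu + 1). *)
Lemma half_moment_cancel : dd * half_moment nu - b * half_moment (nu + 2) = 0.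
Proof. by rewrite half_moment_recurrence// bE; ring. Qed.

Section single_coordinate.
Variable i0 : 'I_m.
Hypothesis hi0 : forall i, (w i != 0) = (i == i0).

Lemma wsum_single (f : R -> R) h : wsum w f h = f (h i0).
Proof.
have w0 i : i != i0 -> w i = 0.
  by move=> ii; apply/eqP; rewrite -[_ == _]negbK hi0.
have w1 : w i0 = 1.
  rewrite -hw.2 (bigD1 i0)//= big1 ?addr0//.
by rewrite /wsum (bigD1 i0)//= w1 mul1r big1 ?addr0// => i ii; rewrite w0// mul0r.
Qed.

(** With one coordinate g, A_+^(2/nu) is a multiple of (g^+)^2, so the integrand is a multiple of d
    (g^+)^nu - b (g^+)^(nu+2), whose mean is zero by [half_moment_cancel]. *)
Lemma D_plus_single : D_plus nu w Q G = 0.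
Proof.
rewrite /D_plus /D_gen (_ : (fun x => _) = fun x => k^-1 `^ (2 / nu) * k^-1 *
  (dd * pos_powR nu (1 * coords G x i0) - b * pos_powR (nu + 2) (1 * coords G x i0))).
  have n2 : -1 < nu + 2 by apply: lt_trans nuN1 _; rewrite ltrDl.
  have i1 := intbleZ dd (intble_pos_powR i0 sq1 nuN1).
  have i2 := intbleZ b (intble_pos_powR i0 sq1 n2).
  rewrite (expZ _ (intbleB i1 i2)) (expB i1 i2).
  rewrite (expZ _ (intble_pos_powR i0 sq1 nuN1)) (expZ _ (intble_pos_powR i0 sq1 n2)).
  by rewrite !exp_pos_powR// half_moment_cancel !mulr0.
apply/funext => x; rewrite A_plusE B_plusE !wsum_single mul1r -/(coords G x i0).
have [z0|z0] := leP (coords G x i0) 0.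
  by rewrite !pos_powR_neg// !mulr0 powR0 ?mul0r ?subrr ?mulr0// gt_eqF.
rewrite !pos_powR_pos//.
have ki : 0 <= k^-1 by rewrite invr_ge0 ltW.
rewrite powRM ?powR_ge0// -powRrM (_ : nu * (2 / nu) = 2); last by field; rewrite gt_eqF.
have -> : coords G x i0 `^ (nu + 2) = coords G x i0 `^ nu * coords G x i0 `^ 2 by rewrite powRD_pos.
have -> : coords G x i0 `^ nu = coords G x i0 `^ (nu - 2) * coords G x i0 `^ 2.
  by rewrite -powRD_pos// subrK.
by rewrite -/b; ring.
Qed.

Lemma D_abs_single : D_abs nu w Q G = 0.
Proof.
have n0 : nu != 0 by rewrite gt_eqF.
have n2 : -1 < nu + 2 by apply: lt_trans nuN1 _; rewrite ltrDl.
have n20 : nu + 2 != 0 by rewrite gt_eqF// addr_gt0.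
rewrite /D_abs /D_gen (_ : (fun x => _) = fun x => (2 * k)^-1 `^ (2 / nu) * (2 * k)^-1 *
  (dd * `|coords G x i0| `^ nu - b * `|coords G x i0| `^ (nu + 2))).
  have i1 := intbleZ dd (intble_abs_powR i0 nuN1 n0).
  have i2 := intbleZ b (intble_abs_powR i0 n2 n20).
  rewrite (expZ _ (intbleB i1 i2)) (expB i1 i2).
  rewrite (expZ _ (intble_abs_powR i0 nuN1 n0)) (expZ _ (intble_abs_powR i0 n2 n20)).
  rewrite (exp_abs_powR i0 nuN1 n0) (exp_abs_powR i0 n2 n20).
  rewrite !(mulrCA _ 2) -mulrBr half_moment_cancel.
  by rewrite !mulr0.
apply/funext => x; rewrite A_absE B_absE !wsum_single -/(coords G x i0).
have [->|z0] := eqVneq (coords G x i0) 0.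
  by rewrite normr0 (powR0 n0) (powR0 n20) !mulr0 (powR0 (lt0r_neq0 r0)) mul0r subrr mulr0.
move: (coords G x i0) z0 => y; rewrite -normr_gt0 => z0.
have ki : 0 <= (2 * k)^-1 by rewrite invr_ge0 mulr_ge0// ltW.
rewrite powRM ?powR_ge0// -powRrM (_ : nu * (2 / nu) = 2); last by field; rewrite gt_eqF.
have -> : `|y| `^ (nu + 2) = `|y| `^ nu * `|y| `^ 2 by rewrite powRD_pos.
have -> : `|y| `^ nu = `|y| `^ (nu - 2) * `|y| `^ 2.
  by rewrite -powRD_pos// subrK.
by rewrite -/b; ring.
Qed.

(** The positive part of a coordinate and the indicator that it is negative have disjoint
    supports. *)
Lemma E_AC_single : E_AC nu w Q G = 0.
Proof.
rewrite /E_AC (_ : (fun x => _) = fun=> 0); first by rewrite expectation_cst.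
apply/funext => x; rewrite A_plusE C_minusE !wsum_single.
have [z0|z0] := leP (tnth (G x) i0) 0; first by rewrite pos_powR_neg// mulr0 mul0r.
by rewrite [X in _ * X]pos_powR_neg ?mulr0// oppr_le0 ltW.
Qed.

End single_coordinate.

(** * Assembly of the tail expansions *)

Section tails.
Variable W : {RV Q >-> R}.
Hypothesis hW : chi2_variable nu W.
Hypothesis hGW : independent_RV G W.
Context {d' : measure_display} {T : measurableType d'} (P : probability T R).
Variable Z : {RV P >-> m.-tuple R}.
Hypothesis hZ : forall A : set (m.-tuple R), measurable A ->
  P (Z @^-1` A) = Q (mvt_vector nu G W @^-1` A).

Let Pr (score : R -> R) (t : R) : R :=
  tail P (fun x => weighted_score w score (Z x)) t.

Lemma tail_score_tail (phi : R -> R) t : measurable_fun setT phi ->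
  Pr phi t = score_tail G W nu w phi t.
Proof.
move=> mphi.
have mf : measurable_fun setT (fun g : m.-tuple R => weighted_score w phi g).
  apply: measurable_sum => i; apply: measurable_funM => //.
  by apply: (measurableT_comp mphi); exact: measurable_tnth.
have mA : measurable [set g : m.-tuple R | t < weighted_score w phi g].
  have := mf measurableT `]t, +oo[%classic (measurable_itv _).
  rewrite setTI; congr measurable; apply/seteqP.
  by split => x /=; rewrite in_itv/= andbT.
rewrite /Pr /tail /score_tail; congr fine.
have -> : [set x | t < weighted_score w phi (Z x)] = Z @^-1` [set g | t < weighted_score w phi g] by [].
have e x : weighted_score w phi (mvt_vector nu G W x) = mix_score nu w phi (coords G x) (W x).
  by apply: eq_bigr => i _; rewrite /mvt_vector tnth_mktuple.
by rewrite hZ//; congr (Q _); apply/seteqP; split => x /=; rewrite e.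
Qed.

(** [g] and [h] are prescribed only for t > 0, where t^(-2) as an integer power and as a real power
    agree. *)
Lemma Pr_expansion (kap u L : R) (phi N M g h : R -> R) :
  score_expansion nu kap phi N M ->
  a_coef nu * fine 'E_Q[fun x => wsum w N (coords G x)] = u ->
  a_coef nu * fine 'E_Q[fun x => wsum w N (coords G x) `^ kap *
     (wsum w M (coords G x) - second_coef nu kap b *
      wsum w N (coords G x) `^ (1 + 2 / nu - kap))] = L ->
  (forall t, 0 < t -> g t = t `^ (-1 - kap)) ->
  (forall t, 0 < t -> h t = Pr phi t - (u / t + L * g t)) ->
  (h : R -> R^o) =o_ (+oo_R) (g : R -> R^o).
Proof.
move=> se hu hL hg hh; have := score_tail_expansion hRho hG hW hGW hw se.
rewrite hu -/b hL => /littleo_of_cvg; apply => t t0; first by rewrite opprD hg.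
by rewrite hh// (tail_score_tail _ (se_mphi se)) opprD addrA.
Qed.

Let D_integrand (A B : R) : 0 <= A ->
  A `^ (2 / nu) * (B - second_coef nu (2 / nu) b * A `^ (1 + 2 / nu - 2 / nu)) =
  A `^ (2 / nu) * (B - b * A).
Proof. by move=> A0; rewrite second_coef_eq kap_eq powRr1. Qed.

Let A1 x : wsum w (fun z => k^-1 * pos_powR nu z) (coords G x) = A_plus nu w (G x).
Proof. by rewrite A_plusE. Qed.

Lemma tail_Y_one_gt2 : 2 < nu ->
  (fun t => Pr (Y_one nu) t -
     (t^-1 + D_plus nu w Q G * t `^ (-1 - 2 / nu)) : R^o)
  =o_ (+oo_R) (fun t => t `^ (-1 - 2 / nu) : R^o).
Proof.
move=> nu2; apply: (Pr_expansion (u := 1) (L := D_plus nu w Q G) (Y_one_expansion_gt2 nu1 nu2)) => //.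
- by have := exp_A_plus 1; rewrite mul1r.
- rewrite /D_plus /D_gen; congr (_ * fine 'E_Q[_]); apply/funext => x.
  rewrite A1 D_integrand ?A_plus_ge0//; congr (_ * (_ - _)).
  by rewrite wsumD [X in _ + X]wsum_scale mul0r addr0 e_kap B_plusE.
- by move=> t t0; rewrite div1r.
Qed.

Lemma tail_Y_one_lt2 : nu < 2 ->
  (fun t => Pr (Y_one nu) t - (t^-1 + a_coef nu * E_AC nu w Q G * t ^- 2) : R^o)
  =o_ (+oo_R) (fun t => t ^- 2 : R^o).
Proof.
move=> nu2; apply: (Pr_expansion (u := 1) (L := a_coef nu * E_AC nu w Q G) (Y_one_expansion_lt2 nu1 nu2)) => //.
- by have := exp_A_plus 1; rewrite mul1r.
- rewrite /E_AC; congr (_ * fine 'E_Q[_]); apply/funext => x.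
  rewrite A1 powRr1 ?A_plus_ge0//; congr (_ * _).
  (* Here kap = 1 < 2/nu, so the curvature of the chi-square law does not contribute at this
     order. *)
  rewrite /second_coef lt_eqF; last by rewrite ltr_pdivlMr// mul1r.
  rewrite mul0r subr0 wsumD wsum_scale mul0r add0r subrr mulr0 C_minusE.
  by rewrite wsum_scale mul1r.
- by move=> t t0; rewrite -powR_invn ?ltW//; congr powR; ring.
- by move=> t t0; rewrite div1r.
Qed.

Lemma tail_Y_one_eq2 : nu = 2 ->
  (fun t => Pr (Y_one nu) t -
     (t^-1 + (D_plus nu w Q G + a_coef nu * E_AC nu w Q G) * t ^- 2) : R^o)
  =o_ (+oo_R) (fun t => t ^- 2 : R^o).
Proof.
move=> nu2; have k1 : 2 / nu = 1 by rewrite nu2 divff.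
have se := Y_one_expansion_eq2 nu1 nu2.
have split_sum x : A_plus nu w (G x) `^ (2 / nu) *
    (wsum w (fun z => dd * k^-1 * pos_powR (nu * (1 - 2 / nu)) z +
       1 * pos_powR (nu * (1 - 2 / nu)) (- z)) (coords G x) - b * A_plus nu w (G x)) =
    A_plus nu w (G x) `^ (2 / nu) * (B_plus nu w (G x) - b * A_plus nu w (G x)) +
    A_plus nu w (G x) * C_minus w (G x).
  rewrite wsumD (wsum_scale 1) mul1r e_kap -[wsum w _ _]B_plusE.
  have -> : nu - 2 = 0 by rewrite nu2 subrr.
  by rewrite C_minusE k1 powRr1 ?A_plus_ge0// /wsum; ring.
(* The full second-order integrand and the one of [D_plus] are integrable; their difference is A_+
   C_-. *)
have iAC : intble Q (fun x => A_plus nu w (G x) * C_minus w (G x)).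
  apply: eq_integrable (intbleB (intble_second se) intble_D_plus) => // x _ /=.
  by congr EFin; rewrite -/k -/dd A1 split_sum addrC addKr.
apply: (Pr_expansion (u := 1) (L := D_plus nu w Q G + a_coef nu * E_AC nu w Q G) se) => //.
- by have := exp_A_plus 1; rewrite mul1r.
- rewrite /D_plus /D_gen /E_AC -mulrDr -(expD intble_D_plus iAC).
  congr (_ * fine 'E_Q[_]); apply/funext => x.
  by rewrite A1 D_integrand ?A_plus_ge0// split_sum.
- by move=> t t0; rewrite k1 -powR_invn ?ltW//; congr powR; ring.
- by move=> t t0; rewrite div1r.
Qed.

Lemma tail_Y_two :
  (fun t => Pr (Y_two nu) t -
     (t^-1 + D_abs nu w Q G * t `^ (-1 - 2 / nu)) : R^o)
  =o_ (+oo_R) (fun t => t `^ (-1 - 2 / nu) : R^o).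
Proof.
apply: (Pr_expansion (u := 1) (L := D_abs nu w Q G) (Y_two_expansion nu1)) => //.
- by have := exp_A_abs 1; rewrite mul1r.
- rewrite /D_abs /D_gen; congr (_ * fine 'E_Q[_]); apply/funext => x.
  by rewrite -/k -/dd wsum_B_absE -A_absE D_integrand ?A_abs_ge0.
- by move=> t t0; rewrite div1r.
Qed.

Lemma tail_H_one :
  (fun t => Pr (H_one nu) t -
     (c / t + c `^ (1 + 2 / nu) * D_plus nu w Q G * t `^ (-1 - 2 / nu)) : R^o)
  =o_ (+oo_R) (fun t => t `^ (-1 - 2 / nu) : R^o).
Proof.
apply: (Pr_expansion (L := c `^ (1 + 2 / nu) * D_plus nu w Q G) (H_one_expansion nu1) (exp_A_plus c)) => //.
rewrite /D_plus /D_gen [RHS]mulrCA -(expZ (c `^ (1 + 2 / nu)) intble_D_plus).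
congr (_ * fine 'E_Q[_]); apply/funext => x.
rewrite -/c -/k -/dd half_cauchy_A_plusE half_cauchy_B_plusE D_integrand; last by rewrite mulr_ge0 ?A_plus_ge0 ?ltW.
by rewrite powR_second ?A_plus_ge0.
Qed.

Lemma tail_H_two :
  (fun t => Pr (H_two nu) t -
     (c / t + c `^ (1 + 2 / nu) * D_abs nu w Q G * t `^ (-1 - 2 / nu)) : R^o)
  =o_ (+oo_R) (fun t => t `^ (-1 - 2 / nu) : R^o).
Proof.
apply: (Pr_expansion (L := c `^ (1 + 2 / nu) * D_abs nu w Q G) (H_two_expansion nu1) (exp_A_abs c)) => //.
rewrite /D_abs /D_gen [RHS]mulrCA -(expZ (c `^ (1 + 2 / nu)) intble_D_abs).
congr (_ * fine 'E_Q[_]); apply/funext => x.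
have -> : wsum w (fun z => 2 / pi * (2 * k_coef nu)^-1 * `|z| `^ nu) (coords G x) =
    c * A_abs nu w (G x) by rewrite A_absE !wsum_scale mulrA.
have -> : wsum w (fun z => 2 / pi * (d_coef nu * (2 * k_coef nu)^-1) *
    `|z| `^ (nu * (1 - 2 / nu))) (coords G x) = c * B_abs nu w (G x).
  by rewrite B_absE e_kap !wsum_scale !mulrA.
rewrite D_integrand; last by rewrite mulr_ge0 ?A_abs_ge0 ?ltW.
by rewrite powR_second ?A_abs_ge0.
Qed.

End tails.

End coefficients.

Local Open Scope classical_set_scope.
Local Open Scope ring_scope.

Theorem mainTheorem11 (R : realType) (m : nat) (Rho : 'M[R]_m)
  (hRho : correlation_matrix Rho)
  (w : 'I_m -> R) (hw : simplex_weights w)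
  (nu : R) (hnu : 1 < nu)
  (dO : measure_display) (Om : measurableType dO) (Q : probability Om R)
  (G : {RV Q >-> m.-tuple R}) (W : {RV Q >-> R})
  (hG : gaussian_vector Rho G) (hW : chi2_variable nu W)
  (hGW : independent_RV G W)
  (d : measure_display) (T : measurableType d) (P : probability T R)
  (Z : {RV P >-> m.-tuple R})
  (hZ : forall A : set (m.-tuple R), measurable A ->
     P (Z @^-1` A) = Q (mvt_vector nu G W @^-1` A)) :
  let Pr (score : R -> R) (t : R) : R :=
    tail P (fun x => weighted_score w score (Z x)) t in
  let c : R := 2 / pi in
  (2 < nu ->
     (fun t => Pr (Y_one nu) t -
        (t^-1 + D_plus nu w Q G * t `^ (-1 - 2 / nu)) : R^o)
     =o_ (+oo_R) (fun t => t `^ (-1 - 2 / nu) : R^o)) /\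
  (nu = 2 ->
     (fun t => Pr (Y_one nu) t -
        (t^-1 + (D_plus 2 w Q G + a_coef 2 * E_AC 2 w Q G) * t ^- 2) : R^o)
     =o_ (+oo_R) (fun t => t ^- 2 : R^o)) /\
  (nu < 2 ->
     (fun t => Pr (Y_one nu) t -
        (t^-1 + a_coef nu * E_AC nu w Q G * t ^- 2) : R^o)
     =o_ (+oo_R) (fun t => t ^- 2 : R^o)) /\
  (fun t => Pr (Y_two nu) t -
     (t^-1 + D_abs nu w Q G * t `^ (-1 - 2 / nu)) : R^o)
  =o_ (+oo_R) (fun t => t `^ (-1 - 2 / nu) : R^o) /\
  (fun t => Pr (H_one nu) t -
     (c / t + c `^ (1 + 2 / nu) * D_plus nu w Q G * t `^ (-1 - 2 / nu)) : R^o)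
  =o_ (+oo_R) (fun t => t `^ (-1 - 2 / nu) : R^o) /\
  (fun t => Pr (H_two nu) t -
     (c / t + c `^ (1 + 2 / nu) * D_abs nu w Q G * t `^ (-1 - 2 / nu)) : R^o)
  =o_ (+oo_R) (fun t => t `^ (-1 - 2 / nu) : R^o) /\
  ((exists i0 : 'I_m, forall i, (w i != 0) = (i == i0)) ->
     [/\ 2 < nu -> D_plus nu w Q G = 0,
         nu = 2 -> D_plus 2 w Q G + a_coef 2 * E_AC 2 w Q G = 0,
         nu < 2 -> a_coef nu * E_AC nu w Q G = 0,
         D_abs nu w Q G = 0
       & c `^ (1 + 2 / nu) * D_plus nu w Q G = 0 /\
         c `^ (1 + 2 / nu) * D_abs nu w Q G = 0]).
Proof.
move=> Pr c; split; first exact: (tail_Y_one_gt2 hRho hG hnu hw hW hGW hZ).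
split.
  move=> nu2; have := tail_Y_one_eq2 hRho hG hnu hw hW hGW hZ nu2.
  have -> // : D_plus 2 w Q G + a_coef 2 * E_AC 2 w Q G = D_plus nu w Q G + a_coef nu * E_AC nu w Q G.
  by rewrite nu2.
split; first exact: (tail_Y_one_lt2 hRho hG hnu hw hW hGW hZ).
split; first exact: (tail_Y_two hRho hG hnu hw hW hGW hZ).
split; first exact: (tail_H_one hRho hG hnu hw hW hGW hZ).
split; first exact: (tail_H_two hRho hG hnu hw hW hGW hZ).
move=> [i0 hi0].
have Dp := D_plus_single hRho hG hnu hw hi0.
have Da := D_abs_single hRho hG hnu hw hi0.
have E := E_AC_single G hnu hw hi0.
split=> //; first by move=> nu2; rewrite -nu2 Dp E mulr0 addr0.
  by rewrite E mulr0.
by rewrite Dp Da !mulr0.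
Qed.
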